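(* Let $g:\mathbb{R}^d\to\mathbb{R}$, $g\in C^2$, be such that, for a constant $L>0$, $$|\nabla g(x)-\nabla g(y)|\le L(1+|x|^l+|y|^l)|x-y|\quad\forall x,y\in\mathbb{R}^d.$$ Let $r>\frac l2>0$ and $\eta>0$. Let $u:=\eta|\cdot|^{2r+2}+g$. Then the probability measure $\pi_\beta$ with density $e^{-\beta u(x)}/\int_{\mathbb{R}^d}e^{-\beta u(y)}dy$ satisfies a Log-Sobolev inequality with constant independent of the dimension and exponential in $\beta$.
   Context: $\beta>0$ is the temperature parameter. The measure $\pi_\beta$ satisfies a Log-Sobolev inequality (LSI) with constant $\alpha>0$ if for all probability measures $\nu\ll\pi_\beta$ with $f:=d\nu/d\pi_\beta\in H^1(\mathbb{R}^d)$, $$\int_{\mathbb{R}^d} f\log f\,d\pi_\beta\le\frac1{2\alpha}\int_{\mathbb{R}^d}\frac{\Gamma(f,f)}{f}\,d\pi_\beta,\qquad \Gamma(f,g)=\frac1\beta\langle\nabla f,\nabla g\rangle .$$ *)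

(* Defs.v *)
From HB Require Import structures.
From mathcomp Require Import all_boot all_order all_algebra.
From mathcomp Require Import all_classical all_reals all_analysis.

Set Implicit Arguments.
Unset Strict Implicit.
Unset Printing Implicit Defensive.

Import Order.TTheory GRing.Theory Num.Theory.
Import numFieldNormedType.Exports.

Local Open Scope classical_set_scope.
Local Open Scope charge_scope.
Local Open Scope ring_scope.

(* R^n is 'rV[R]_n. The library provides its topology and normed-module
   structure (for the sup norm) but no measurable structure; it is given the
   product sigma-algebra, as for n.-tuple, which is the Borel sigma-algebra. *)
Definition measure_rV_display : measure_display.
Proof. exact: default_measure_display. Qed.

Section measurable_rV.
Variables (R : realType) (n : nat).

Definition rV_coor (i : 'I_n) (v : 'rV[R]_n) : measurableTypeR R := v ord0 i.

Let rV_set0 : g_sigma_preimage rV_coor set0.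
Proof. exact: sigma_algebra0. Qed.

Let rV_setC A : g_sigma_preimage rV_coor A -> g_sigma_preimage rV_coor (~` A).
Proof. exact: sigma_algebraC. Qed.

Let rV_bigcup (F : _^nat) : (forall i, g_sigma_preimage rV_coor (F i)) ->
  g_sigma_preimage rV_coor (\bigcup_i (F i)).
Proof. exact: sigma_algebra_bigcup. Qed.

HB.instance Definition _ := @isMeasurable.Build measure_rV_display
  'rV[R]_n (g_sigma_preimage rV_coor) rV_set0 rV_setC rV_bigcup.

End measurable_rV.

Lemma measurable_rV_coor (R : realType) n (i : 'I_n) :
  measurable_fun setT (@rV_coor R n i).
Proof.
move=> _ Y mY; rewrite setTI; apply: sub_sigma_algebra => /=.
rewrite -bigcup_seq/=; exists i => /=; first by rewrite mem_index_enum.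
by exists Y => //; rewrite setTI.
Qed.

Lemma measurable_fun_rV d (T : measurableType d) (R : realType) n
    (f : T -> 'rV[R]_n) :
  (forall i, measurable_fun setT (@rV_coor R n i \o f)) ->
  measurable_fun setT f.
Proof.
move=> mf.
have pf : g_sigma_preimage (fun i => @rV_coor R n i \o f) `<=` measurable.
  apply: smallest_sub; first exact: sigma_algebra_measurable.
  case: n f mf => [|n] f mf; first by rewrite big_ord0.
  rewrite -bigcup_mkord_ord; apply: bigcup_sub => i Ii.
  by move=> A [B mB <-]; exact: mf.
rewrite g_sigma_preimage_comp in pf.
by move=> _ A mA; apply: pf; exists A.
Qed.

Section lebesgue_rV.
Variable R : realType.

Definition cons_rV n (p : measurableTypeR R * 'rV[R]_n) : 'rV[R]_n.+1 :=
  row_mx (p.1 : R)%:M p.2 : 'rV[R]_(1 + n).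

Definition uncons_rV n (v : 'rV[R]_n.+1) : measurableTypeR R * 'rV[R]_n :=
  (v ord0 ord0, rsubmx (v : 'rV[R]_(1 + n))).

Lemma uncons_rVK n : cancel (@uncons_rV n) (@cons_rV n).
Proof.
move=> v; rewrite /cons_rV /uncons_rV /=.
rewrite (_ : (v ord0 ord0)%:M = lsubmx (v : 'rV[R]_(1 + n))); last first.
  apply/rowP => i; rewrite !mxE (ord1 i) eqxx mulr1n.
  by congr (v _ _); apply/val_inj.
exact: (@hsubmxK R 1 1 n v).
Qed.

Lemma cons_rVK n : cancel (@cons_rV n) (@uncons_rV n).
Proof.
case=> x v; rewrite /cons_rV /uncons_rV /= row_mxKr; congr pair.
have := @row_mxEl R 1 1 n (x : R)%:M v ord0 ord0.
rewrite [in RHS]mxE eqxx mulr1n.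
by have -> : lshift n (ord0 : 'I_1) = ord0 by exact/val_inj.
Qed.

Lemma measurable_cons_rV n : measurable_fun setT (@cons_rV n).
Proof.
apply: measurable_fun_rV => i; have [j->|j->] := split_ordP (i : 'I_(1 + n)).
  rewrite (_ : _ \o _ = fst) //; apply/funext => p /=.
  by rewrite /rV_coor /cons_rV [LHS](@row_mxEl R 1 1 n) mxE (ord1 j) eqxx.
rewrite (_ : _ \o _ = @rV_coor R n j \o snd).
  by apply: measurableT_comp => //; exact: measurable_rV_coor.
by apply/funext => p /=; rewrite /rV_coor /cons_rV [LHS](@row_mxEr R 1 1 n).
Qed.

Lemma measurable_uncons_rV n : measurable_fun setT (@uncons_rV n).
Proof.
apply/measurable_fun_pairP; split.
  exact: (@measurable_rV_coor R n.+1 ord0).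
apply: measurable_fun_rV => i.
rewrite (_ : _ \o _ = @rV_coor R n.+1 (rshift 1 i)).
  exact: measurable_rV_coor.
by apply/funext => v /=; rewrite /rV_coor /= mxE.
Qed.

HB.instance Definition _ n := isMeasurableFun.Build _ _ _ _ (@cons_rV n)
  (@measurable_cons_rV n).

Section lebesgue_rV_step.
Variables (n : nat) (m : {sigma_finite_measure set 'rV[R]_n -> \bar R}).

Definition lebesgue_rV_step : set 'rV[R]_n.+1 -> \bar R :=
  pushforward (@lebesgue_measure R \x m)%E (@cons_rV n).

Let step0 : lebesgue_rV_step set0 = 0%E.
Proof. exact: measure0. Qed.

Let step_ge0 A : (0 <= lebesgue_rV_step A)%E.
Proof. exact: measure_ge0. Qed.

Let step_sigma_additive : semi_sigma_additive lebesgue_rV_step.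
Proof. exact: measure_semi_sigma_additive. Qed.

HB.instance Definition _ := isMeasure.Build _ _ _ lebesgue_rV_step
  step0 step_ge0 step_sigma_additive.

Let step_sigma_finite : sigma_finite setT lebesgue_rV_step.
Proof.
have /sigma_finiteP[F [TF ndF Foo]] := sigma_finiteT (@lebesgue_measure R).
have /sigma_finiteP[G [TG ndG Goo]] := sigma_finiteT m.
exists (fun k => @uncons_rV n @^-1` (F k `*` G k)).
  rewrite -preimage_bigcup (_ : \bigcup_k _ = setT) ?preimage_setT//.
  rewrite -subTset => -[x v] _.
  have [i _ Fix] : (\bigcup_k F k) x by rewrite -TF.
  have [j _ Gjv] : (\bigcup_k G k) v by rewrite -TG.
  exists (maxn i j) => //; split.
    by move: x Fix; exact/subsetPset/ndF/leq_maxl.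
  by move: v Gjv; exact/subsetPset/ndG/leq_maxr.
move=> k; have [mF Fk] := Foo k; have [mG Gk] := Goo k.
have mFG := measurableX mF mG; split.
  by rewrite -[X in measurable X]setTI; exact: measurable_uncons_rV.
rewrite /lebesgue_rV_step /pushforward -comp_preimage.
rewrite (_ : _ \o _ = id); last by apply/funext => p; exact: cons_rVK.
by rewrite preimage_id product_measure1E// lte_mul_pinfty// ge0_fin_numE.
Qed.

HB.instance Definition _ := Measure_isSigmaFinite.Build _ _ _ lebesgue_rV_step
  step_sigma_finite.

End lebesgue_rV_step.

Fixpoint lebesgue_rV n : {sigma_finite_measure set 'rV[R]_n -> \bar R} :=
  if n is k.+1 return {sigma_finite_measure set 'rV[R]_n -> \bar R}
  then lebesgue_rV_step (lebesgue_rV k)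
  else \d_(0 : 'rV[R]_0).

End lebesgue_rV.

Section calculus.
Variables (R : realType) (n : nat).
Implicit Types (f phi : 'rV[R]_n -> R) (u v : 'rV[R]_n) (i : 'I_n).

Definition dotv u v : R := \sum_i u ord0 i * v ord0 i.

(* The library norm `|v| on 'rV[R]_n is the sup norm. *)
Definition enorm v : R := Num.sqrt (dotv v v).

Definition partial i f (x : 'rV[R]_n) : R := 'D_(delta_mx ord0 i) f x.

Definition grad f (x : 'rV[R]_n) : 'rV[R]_n := \row_i partial i f x.

Fixpoint Ck (k : nat) f : Prop :=
  if k is j.+1
  then (forall x, differentiable f x) /\ (forall i, Ck j (partial i f))
  else continuous f.

Definition test_function phi : Prop :=
  (forall k, Ck k phi) /\ compact (closure [set x | phi x != 0]).

Definition weak_gradient f (G : 'rV[R]_n -> 'rV[R]_n) : Prop :=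
  forall phi, test_function phi -> forall i,
    (\int[lebesgue_rV R n]_x (f x * partial i phi x)%:E =
     - \int[lebesgue_rV R n]_x (G x ord0 i * phi x)%:E)%E.

(* f belongs to H^1(R^n) = W^{1,2}(R^n) and G is a version of its weak
   gradient, which is determined almost everywhere by f. *)
Definition H1_grad f (G : 'rV[R]_n -> 'rV[R]_n) : Prop :=
  [/\ f \in Lfun (lebesgue_rV R n) 2%:E,
      forall i, (fun x => G x ord0 i) \in Lfun (lebesgue_rV R n) 2%:E
    & weak_gradient f G].

End calculus.

Section gibbs.
Variables (R : realType) (n : nat).
Implicit Types (beta alpha : R) (u : 'rV[R]_n -> R)
  (mu : probability 'rV[R]_n R).

Definition partition_function beta u : R :=
  \int[lebesgue_rV R n]_y expR (- (beta * u y)).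

(* If exp (- beta u) is not integrable, partition_function is 0 and so is the
   density below (division by 0 yields 0): no probability measure qualifies. *)
Definition gibbs_measure beta u mu : Prop :=
  forall A, measurable A ->
    (mu A = \int[lebesgue_rV R n]_(x in A)
      (expR (- (beta * u x)) / partition_function beta u)%:E)%E.

(* Gamma(f, g), as a function of the gradients of f and g. *)
Definition carre_du_champ beta (Gf Gg : 'rV[R]_n -> 'rV[R]_n) x : R :=
  beta^-1 * dotv (Gf x) (Gg x).

(* In f log f and Gamma(f, f) / f, the library's ln 0 = 0 and x / 0 = 0 give
   the usual conventions 0 log 0 = 0 and 0 / 0 = 0; the weak gradient of f
   vanishes almost everywhere on {f = 0}. *)
Definition log_sobolev beta mu alpha : Prop :=
  forall (nu : probability 'rV[R]_n R) (f : 'rV[R]_n -> R)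
      (G : 'rV[R]_n -> 'rV[R]_n),
    nu `<< mu ->
    (EFin \o f = 'd (charge_of_finite_measure nu) '/d mu %[ae mu]) ->
    H1_grad f G ->
    (\int[mu]_x (f x * ln (f x))%:E <=
     ((2 * alpha)^-1)%:E * \int[mu]_x (carre_du_champ beta G G x / f x)%:E)%E.

End gibbs.

(* Main.v *)
From HB Require Import structures.
Require Import Defs.
From mathcomp Require Import all_boot all_order all_algebra.
From mathcomp Require Import all_classical all_reals all_analysis.
From mathcomp Require Import measurable_realfun measurable_fun_approximation.
From mathcomp Require Import ring lra.

Set Implicit Arguments.
Unset Strict Implicit.
Unset Printing Implicit Defensive.

Import Order.TTheory GRing.Theory Num.Theory.
Import numFieldNormedType.Exports.

Local Open Scope classical_set_scope.
Local Open Scope ring_scope.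

(** The potential [u] is a bounded perturbation of a strongly convex one. By Cauchy-Schwarz the
    gradient of [g] fails to be monotone by at most L(1 + |x|^l + |y|^l)|x - y|^2. Since l/2 < r,
    the slope of q -> eta q^(r+1), taken at q = |x|^2, outgrows this defect far from the origin.
    Near the origin the slope is replaced by a large constant K. The resulting convex function
    [radial] makes W(x) = radial(|x|^2) + g(x) strongly convex with constant 1 ([gradient_monotone],
    [strong_convexity]), while 0 <= W - u <= osc ([radial_bounds]). K and osc are computed from L,
    l, r and eta alone, so neither the dimension nor g nor beta enters them.

    For the density exp(- beta W) the entropy is at most 1/(2 beta) times the Fisher information, as
    in the Bakry-Emery criterion. This is deduced from the Prekopa-Leindler inequality
    ([prekopa_leindler]), applied to h^(1/t) q and q with t + s = 1. Strong convexity pays for the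
    displacement between x and tx + sy ([sup_convolution_bound]), and the first-order term as s
    tends to 0 is the log-Sobolev inequality ([lsi_normalized]). Passing from W to u costs a factor
    exp(beta osc) ([holley_stroock]). The factor 1/beta in Gamma cancels the strong convexity
    constant beta of beta W, which leaves the constant exp(- osc beta).

    That argument concerns functions h bounded away from 0 and infinity with a quadratic upper
    Taylor bound. The rest extends it to every density f with a weak gradient G. The function f is
    mollified, multiplied by a squared cutoff and lifted by a constant delta. Because (f, G) ->
    |G|^2 / f is jointly convex, averaging does not increase the Fisher integrand ([avg_fisher]).
    The cutoff adds an error that vanishes as it widens. The entropy is lower semicontinuous: it is
    bounded below by tangent lines under weak convergence ([cutoff_lsi]), then by Fatou's lemma
    ([entropy_lsi]). With x / 0 = 0, convexity of |G|^2 / f requires G = 0 wherever f = 0; this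
    holds almost everywhere by [weak_gradient_zero], which tests the weak gradient against kernels
    that rise steeply and fall elsewhere. *)

(** * The Brunn-Minkowski inequality on the line *)

Section brunn_minkowski.
Variable R : realType.
Local Notation mu := (@lebesgue_measure R).

Definition affine (a b x : R) : measurableTypeR R := a * x + b.

Lemma measurable_affine (a b : R) :
  measurable_fun setT (affine a b : measurableTypeR R -> measurableTypeR R).
Proof.
by apply: measurable_funD => //; apply: measurable_funM.
Qed.

(** Lebesgue measure is determined by its values on half-open intervals, and the preimage of such an
    interval is again one, shorter by the factor [a]. *)
Lemma lebesgue_measure_affine (a b : R) (A : set (measurableTypeR R)) :
  0 < a -> measurable A ->
  (mu (affine a b @^-1` A) = a^-1%:E * mu A)%E.
Proof.
move=> a0 mA.
have mf := @measurable_affine a b.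
pose nu : {measure set (measurableTypeR R) -> \bar R} := pushforward mu (affine a b).
have h : forall X : set R, ocitv X -> lebesgue_measure X = mscale (NngNum (ltW a0)) (nu mf) X.
  move=> X [[x y] _ <-] /=.
  rewrite /mscale /nu /pushforward /=.
  rewrite [X in (_ * lebesgue_measure X)%E](_ : _ =
      `](x - b) / a, (y - b) / a]%classic); last first.
    apply/seteqP; split => z; rewrite /= /affine !in_itv /= => /andP[h1 h2].
      by apply/andP; split; [rewrite ltr_pdivrMr// ltrBlDr mulrC|
        rewrite ler_pdivlMr// lerBrDr mulrC].
    move: h1 h2; rewrite ltr_pdivrMr// ltrBlDr mulrC => ->.
    by rewrite ler_pdivlMr// lerBrDr mulrC => ->.
  rewrite !lebesgue_measure_itv/= !lte_fin.
  rewrite ltr_pM2r ?invr_gt0// ltrD2r.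
  case: ifPn => _; last by rewrite mule0.
  by rewrite -!EFinB -EFinM; congr EFin; field; rewrite gt_eqF.
have := lebesgue_measure_unique h mA.
rewrite /mscale /= /pushforward => ->.
by rewrite muleA -EFinM mulVf ?gt_eqF// mul1e.
Qed.

(** With a = max K1 and b = min K2, the sets t K1 + s b and t a + s K2 both lie in t K1 + s K2, one
    to the left and the other to the right of ta + sb. They share at most that point, so their
    measures add up. Letting [C] be any measurable superset avoids the measurability of a sumset. *)
Lemma brunn_minkowski_compact (t s : R) (K1 K2 C : set (measurableTypeR R)) :
  0 < t -> 0 < s ->
  compact (K1 : set R) -> compact (K2 : set R) -> K1 !=set0 -> K2 !=set0 ->
  measurable C -> (forall x y, K1 x -> K2 y -> C (t * x + s * y)) ->
  (t%:E * mu K1 + s%:E * mu K2 <= mu C)%E.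
Proof.
move=> t0 s0 cK1 cK2 n1 n2 mC H.
have mK1 : measurable K1 by exact: compact_measurable.
have mK2 : measurable K2 by exact: compact_measurable.
have cid (A : set R) : {within A, continuous (@id R)}.
  by apply: continuous_subspaceT => x; exact: cvg_id.
have [a] := compact_EVT_max n1 cK1 (cid _); rewrite inE => K1a amax.
have [b] := compact_EVT_min n2 cK2 (cid _); rewrite inE => K2b bmin.
(* [P] is t K1 + s b and [Q] is t a + s K2, both written as preimages under the inverse affine maps.
   The possible common point [c] is a null set and is removed from [Q]. *)
pose P := affine t^-1 (- (t^-1 * s * b)) @^-1` K1.
pose Q := affine s^-1 (- (s^-1 * t * a)) @^-1` K2.
have mP : measurable P by rewrite -[P]setTI; apply: measurable_affine.
have mQ : measurable Q by rewrite -[Q]setTI; apply: measurable_affine.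
have -> : (t%:E * mu K1 = mu P)%E.
  by rewrite /P lebesgue_measure_affine ?invr_gt0// invrK.
have -> : (s%:E * mu K2 = mu Q)%E.
  by rewrite /Q lebesgue_measure_affine ?invr_gt0// invrK.
pose c := t * a + s * b.
have -> : mu Q = mu (Q `\ c).
  have [Qc|nQc] := pselect (Q c); last by rewrite not_setD1.
  rewrite -[in LHS](@setD1K _ c Q)// measureU//.
  - by rewrite -[X in (X + _)%E]/(mu [set c]) lebesgue_measure_set1 add0e.
  - exact: measurableD.
  - by apply/seteqP; split => z //= -[-> []].
rewrite -measureU//; last 2 first.
- exact: measurableD.
- apply/seteqP; split => z //= -[Pz [Qz]]; apply.
  move: Pz; rewrite /P /= /affine => Pz.
  have /amax : (t^-1 * z - t^-1 * s * b) \in K1 by rewrite inE.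
  move: Qz; rewrite /Q /= /affine => Qz.
  have /bmin : (s^-1 * z - s^-1 * t * a) \in K2 by rewrite inE.
  move=> /(ler_wpM2l (ltW s0)) h1 /(ler_wpM2l (ltW t0)) h2.
  have e1 : s * (s^-1 * z - s^-1 * t * a) = z - t * a.
    by field; rewrite gt_eqF.
  have e2 : t * (t^-1 * z - t^-1 * s * b) = z - s * b.
    by field; rewrite gt_eqF.
  move: h1 h2; rewrite /= e1 e2 /c => h1 h2.
  by apply/eqP; rewrite eq_le; apply/andP; split; lra.
apply: le_measure; rewrite ?inE//.
  by apply: measurableU => //; apply: measurableD.
move=> z [|[+ _]]; rewrite /P /Q /= /affine => Kz.
  have -> : z = t * (t^-1 * z - t^-1 * s * b) + s * b.
    by field; rewrite gt_eqF.
  exact: H.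
have -> : z = t * a + s * (s^-1 * z - s^-1 * t * a).
  by field; rewrite gt_eqF.
exact: H.
Qed.

(** Inner regularity may return the empty set, for which Brunn-Minkowski fails; adjoining one point
    of [A] prevents this. *)
Lemma compact_approx (A : set (measurableTypeR R)) (e : R) : measurable A ->
  (mu A < +oo)%E -> A !=set0 -> 0 < e ->
  exists K : set R, [/\ compact K, K !=set0, K `<=` A & (mu A <= mu K + e%:E)%E].
Proof.
move=> mA fA [x Ax] e0.
have [V [cV VA Ve]] := lebesgue_regularity_inner mA fA e0.
have mV : measurable (V : set (measurableTypeR R)) by exact: compact_measurable.
exists (V `|` [set x]); split.
- by apply: compactU => //; exact: compact_set1.
- by exists x; right.
- by move=> z [/VA//|->].
- rewrite -[in leLHS](setDUK VA) measureU//; last 2 first.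
  + exact: measurableD.
  + by apply/seteqP; split => z //= [Vz []].
  apply: leeD; last exact: ltW.
  apply: le_measure; rewrite ?inE//.
  exact: measurableU.
Qed.

Lemma brunn_minkowski (t s : R) (A B C : set (measurableTypeR R)) :
  0 < t -> 0 < s -> measurable A -> measurable B -> measurable C ->
  A !=set0 -> B !=set0 -> (mu A < +oo)%E -> (mu B < +oo)%E ->
  (forall x y, A x -> B y -> C (t * x + s * y)) ->
  (t%:E * mu A + s%:E * mu B <= mu C)%E.
Proof.
move=> t0 s0 mA mB mC nA nB fA fB H.
apply/lee_addgt0Pr => e e0.
have ts0 : 0 < t + s by exact: addr_gt0.
have e'0 : 0 < e / (t + s) by exact: divr_gt0.
have [K1 [cK1 n1 K1A hK1]] := compact_approx mA fA nA e'0.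
have [K2 [cK2 n2 K2B hK2]] := compact_approx mB fB nB e'0.
have := @brunn_minkowski_compact t s K1 K2 C t0 s0 cK1 cK2 n1 n2 mC
  (fun x y h1 h2 => H x y (K1A _ h1) (K2B _ h2)).
move=> /(leeD2r e%:E); apply: le_trans.
have -> : (e%:E = t%:E * (e / (t + s))%:E + s%:E * (e / (t + s))%:E)%E.
  by rewrite -!EFinM -EFinD; congr EFin; field; rewrite gt_eqF.
rewrite addeACA; apply: leeD.
  rewrite -ge0_muleDr ?measure_ge0 ?lee_fin ?(ltW e'0)//.
  by apply: lee_wpmul2l => //; rewrite lee_fin ltW.
rewrite -ge0_muleDr ?measure_ge0 ?lee_fin ?(ltW e'0)//.
by apply: lee_wpmul2l => //; rewrite lee_fin ltW.
Qed.

End brunn_minkowski.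

(** * The Prekopa-Leindler inequality on the line, from the layer-cake formula *)

Section prekopa_leindler1.
Variable R : realType.
Local Notation mu := (@lebesgue_measure R).
Local Open Scope ereal_scope.

(** Levels are measured in units of [M] and kept in (0, 1). They recover y / M exactly when y <= M;
    otherwise only this upper bound survives, which suffices for the extended-real function on the
    larger side of Prekopa-Leindler. *)
Lemma lebesgue_truncated_itv (M : R) (y : \bar R) : (0 < M)%R -> 0 <= y ->
  mu [set x : R | (0 < x < 1)%R /\ (x * M)%:E < y] <= M^-1%:E * y.
Proof.
move=> M0 y0; have M'0 : (0 < M^-1)%R by rewrite invr_gt0.
have -> : [set x : R | (0 < x < 1)%R /\ (x * M)%:E < y] =
   [set x : R | (0 < x < 1)%R /\ x%:E < M^-1%:E * y].
  apply/seteqP; split => x /= [x01 h]; split => //.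
    move: h; case: y y0 => [y| |] y0 //=.
      by rewrite -EFinM !lte_fin [(_^-1 * _)%R]mulrC ltr_pdivlMr.
    by rewrite gt0_muley ?lte_fin// !ltry.
  move: h; case: y y0 => [y| |] y0 //=; last by rewrite ltry.
  by rewrite -EFinM !lte_fin [(_^-1 * _)%R]mulrC ltr_pdivlMr.
have : 0 <= M^-1%:E * y by rewrite mule_ge0// lee_fin ltW.
case: (M^-1%:E * y) => [z| |]//= z0; last by rewrite leey.
apply: (@le_trans _ _ (mu `]0%R, z[%classic)).
  apply: le_measure; rewrite ?inE//.
    rewrite (_ : mkset _ = `]0%R, 1%R[ `&` `]-oo, z[)%classic.
      exact: measurableI.
    apply/seteqP; split => x /=; rewrite !in_itv/= ?lte_fin.
      by move=> [/andP[-> ->] ->].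
    by move=> [/andP[-> ->] ->].
  by move=> x /= [/andP[x0 _]]; rewrite lte_fin in_itv/= x0.
rewrite lebesgue_measure_itv/=; case: ifPn => // _.
by rewrite oppr0 adde0.
Qed.

Lemma lebesgue_truncated_itv_eq (M : R) (y : R) : (0 < M)%R -> (0 <= y <= M)%R ->
  mu [set x : R | (0 < x < 1)%R /\ (x * M < y)%R] = (M^-1 * y)%:E.
Proof.
move=> M0 /andP[y0 yM].
rewrite (_ : mkset _ = `]0%R, (M^-1 * y)%R[)%classic.
  have h0 : (0 <= M^-1 * y)%R by rewrite mulr_ge0// invr_ge0 ltW.
  rewrite lebesgue_measure_itv/= lte_fin; case: ltP => h.
    by rewrite oppr0 adde0.
  by congr EFin; apply/eqP; rewrite eq_le h0 h.
apply/seteqP; split => x /=; rewrite in_itv /= [(_^-1 * _)%R]mulrC ltr_pdivlMr//.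
  by move=> [/andP[-> _] ->].
move=> /andP[x0 xM]; split => //; rewrite x0 /=.
by rewrite -(ltr_pM2r M0) mul1r (lt_le_trans xM).
Qed.

Lemma measurable_layer_set (f : measurableTypeR R -> \bar R) (M : R) :
  measurable_fun setT f ->
  measurable [set p : measurableTypeR R * measurableTypeR R |
    (0 < p.1 < 1)%R /\ (p.1 * M)%:E < f p.2].
Proof.
move=> mf.
rewrite (_ : mkset _ = (fst @^-1` `]0%R, 1%R[) `&`
   (setT `&` [set p : measurableTypeR R * measurableTypeR R | (p.1 * M)%:E < f p.2]))%classic.
  apply: measurableI.
    by rewrite -[X in measurable X]setTI; exact: measurable_fst.
  apply: measurable_lte => //.
    by apply/measurable_EFinP; apply: measurable_funM.
  exact: measurableT_comp.
by rewrite setTI; apply/seteqP; split => p /=; rewrite in_itv.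
Qed.

Lemma measurable_truncated_layer (f : measurableTypeR R -> \bar R) (M : R) :
  measurable_fun setT f ->
  measurable_fun setT (fun z : measurableTypeR R =>
    mu [set x : R | (0 < x < 1)%R /\ (x * M)%:E < f z]).
Proof.
move=> /(measurable_layer_set M) mA.
rewrite (_ : (fun z => _) = mu \o ysection [set p : measurableTypeR R * measurableTypeR R |
    (0 < p.1 < 1)%R /\ (p.1 * M)%:E < f p.2]).
  exact: measurable_fun_ysection.
apply/funext => z /=; congr (mu _).
by apply/seteqP; split => x; rewrite /ysection /= inE.
Qed.

Lemma layer_cake_swap (f : measurableTypeR R -> \bar R) (M : R) :
  measurable_fun setT f ->
  \int[mu]_(x in [set x : R | 0 < x < 1]%R) mu [set z | (x * M)%:E < f z] =
  \int[mu]_z mu [set x : R | (0 < x < 1)%R /\ (x * M)%:E < f z].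
Proof.
move=> /(measurable_layer_set M); set A := mkset _ => mA.
transitivity (\int[mu]_x \int[mu]_z (\1_A (x, z))%:E).
  rewrite integral_mkcond; apply: eq_integral => x _.
  rewrite -[RHS]/(fubini_F mu (EFin \o \1_A) x) indic_fubini_tonelli_FE//=.
  rewrite patchE; case: ifPn => hx.
    congr (mu _); apply/seteqP; split => z; rewrite /xsection /A /= inE/=.
      by move: hx; rewrite inE /= => -> .
    by case.
  rewrite (_ : xsection A x = set0) ?measure0//.
  apply/seteqP; split => z; rewrite /xsection /A /= ?inE//= => -[hx'].
  by move: hx; rewrite notin_setE /= hx'.
rewrite (fubini_tonelli (fun p => (\1_A p)%:E))//=; last first.
  by apply/measurable_EFinP; exact: measurable_indic.
apply: eq_integral => z _.
rewrite -[LHS]/(fubini_G mu (EFin \o \1_A) z) indic_fubini_tonelli_GE//=.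
by congr (mu _); apply/seteqP; split => x; rewrite /ysection /A /= inE/=.
Qed.

Lemma measurable_layer (f : measurableTypeR R -> \bar R) (M : R) :
  measurable_fun setT f ->
  measurable_fun setT (fun x : measurableTypeR R => mu [set z | (x * M)%:E < f z]).
Proof.
move=> mf.
pose A := [set p : measurableTypeR R * measurableTypeR R | (p.1 * M)%:E < f p.2].
have mA : measurable A.
  rewrite -[A]setTI; apply: measurable_lte => //.
    by apply/measurable_EFinP; apply: measurable_funM.
  exact: measurableT_comp.
rewrite (_ : (fun x => _) = mu \o xsection A).
  exact: measurable_fun_xsection.
apply/funext => x /=; congr (mu _).
by apply/seteqP; split => z; rewrite /xsection /A /= inE.
Qed.

Lemma weighted_amgm (t s a b : R) : (0 < t -> 0 < s -> t + s = 1 -> 0 <= a -> 0 <= b ->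
  a `^ t * b `^ s <= t * a + s * b)%R.
Proof.
move=> t0 s0 ts a0 b0.
have := @conjugate_powR R (a `^ t)%R (b `^ s)%R (t^-1)%R (s^-1)%R (powR_ge0 _ _) (powR_ge0 _ _).
rewrite !invr_gt0 !invrK => /(_ t0 s0 ts).
by rewrite -!powRrM !mulfV ?gt_eqF// !powRr1// [(a * _)%R]mulrC [(b * _)%R]mulrC.
Qed.

Lemma bounded_layer (f : measurableTypeR R -> R) (a M : R) :
  measurable_fun setT f -> (0 < M)%R -> (forall x, 0 <= f x <= M)%R ->
  \int[mu]_x (f x)%:E = a%:E ->
  \int[mu]_(x in [set x : R | 0 < x < 1]%R) mu [set z | (x * M)%:E < (f z)%:E] =
  (M^-1 * a)%:E.
Proof.
move=> mf M0 fM fa; rewrite layer_cake_swap; last exact/measurable_EFinP.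
under eq_integral do rewrite lebesgue_truncated_itv_eq// EFinM.
rewrite ge0_integralZl ?fa//; first exact/measurable_EFinP.
- by move=> x _; rewrite lee_fin; case/andP: (fM x).
- by rewrite lee_fin invr_ge0 ltW.
Qed.

(** Markov's inequality; it supplies the finiteness that [brunn_minkowski] asks of superlevel
    sets. *)
Lemma finite_layer (f : measurableTypeR R -> R) (a c : R) :
  measurable_fun setT f -> (0 < c)%R -> (forall x, 0 <= f x)%R ->
  \int[mu]_x (f x)%:E = a%:E ->
  mu [set z | c%:E < (f z)%:E] < +oo.
Proof.
move=> mf c0 f0 fa.
have := @le_integral_abse _ _ _ mu setT measurableT (EFin \o f) c
  ((measurable_EFinP _ _).2 mf) c0.
under eq_integral do rewrite /= ger0_norm//.
rewrite fa setTI => h.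
have {}h : mu [set x | c%:E <= `|(EFin \o f) x|] < +oo.
  rewrite -(@lte_pmul2l _ c%:E)// ?lte_fin// gt0_muley ?lte_fin//.
  by rewrite (le_lt_trans h)// ltry.
apply: le_lt_trans h; apply: le_measure; rewrite ?inE//.
- rewrite -[X in measurable X]setTI; apply: measurable_lte => //.
  exact/measurable_EFinP.
- rewrite -[X in measurable X]setTI; apply: measurable_lee => //.
  by apply: measurableT_comp => //; exact/measurable_EFinP.
- by move=> x /=; rewrite ger0_norm// => /ltW.
Qed.

(** Scale f and g by their suprema F and G, and set M = F^t G^s. Brunn-Minkowski compares the
    superlevel sets at levels lF, lG and lM. Integrating over l in (0, 1) gives t a/F + s b/G <=
    (1/M) times the integral of h, and the arithmetic-geometric inequality concludes. Values of [h]
    may be infinite, since in higher dimension [h] will be a section integral. *)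
Lemma prekopa_leindler1 (t s C a b : R) (f g : measurableTypeR R -> R)
    (h : measurableTypeR R -> \bar R) :
  (0 < t)%R -> (0 < s)%R -> (t + s = 1)%R ->
  measurable_fun setT f -> measurable_fun setT g -> measurable_fun setT h ->
  (forall x, 0 <= f x <= C)%R -> (forall x, 0 <= g x <= C)%R ->
  (forall x, 0 <= h x) ->
  \int[mu]_x (f x)%:E = a%:E -> \int[mu]_x (g x)%:E = b%:E ->
  (forall x y : R, (f x `^ t * g y `^ s)%:E <= h (t * x + s * y)%R) ->
  (a `^ t * b `^ s)%:E <= \int[mu]_x h x.
Proof.
move=> t0 s0 ts mf mg mh fC gC h0 fa gb H.
(* Either the function vanishes, and then the left-hand side is 0, or its supremum is positive and
   every level strictly below it is exceeded somewhere. *)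
have rr (k : measurableTypeR R -> R) c : (forall x, 0 <= k x <= C)%R ->
    \int[mu]_x (k x)%:E = c%:E -> c = 0%R \/
    exists M : R, [/\ (0 < M)%R, (forall x, 0 <= k x <= M)%R &
      (forall e : R, (e < 1)%R -> exists x, (e * M < k x)%R)].
  move=> kC kc.
  have hs : has_sup (range k).
    split; first by exists (k 0%R), 0%R.
    by exists C => _ [x _ <-]; case/andP: (kC x).
  have ks x : (k x <= sup (range k))%R by apply: sup_upper_bound => //; exists x.
  have [M0|M0] := leP (sup (range k)) 0%R.
    left; apply: EFin_inj; rewrite -kc integral0_eq// => x _.
    have /andP[k0 _] := kC x.
    by congr EFin; apply/eqP; rewrite eq_le k0 (le_trans (ks x)).
  right; exists (sup (range k)); split => //.
    by move=> x; rewrite ks andbT; case/andP: (kC x).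
  move=> e e1.
  have : (e * sup (range k) < sup (range k))%R by rewrite gtr_pMl.
  by move=> /sup_gt[|_ [x _ <-] hx]; [case: hs|exists x].
have Ih0 : 0 <= \int[mu]_x h x by apply: integral_ge0.
have [->|[F [F0 fF hF]]] := rr f a fC fa.
  by rewrite powR0 ?gt_eqF// mul0r.
have [->|[G [G0 gG hG]]] := rr g b gC gb.
  by rewrite powR0 ?gt_eqF// mulr0.
pose M := (F `^ t * G `^ s)%R.
have M0 : (0 < M)%R by rewrite mulr_gt0// powR_gt0.
(* Both superlevel sets are nonempty because l < 1, and (lF)^t (lG)^s = lM since t + s = 1. *)
have BM (l : R) : (0 < l < 1)%R ->
    t%:E * mu [set z | (l * F)%:E < (f z)%:E] + s%:E * mu [set z | (l * G)%:E < (g z)%:E] <=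
    mu [set z | (l * M)%:E < h z].
  move=> /andP[l0 l1]; apply: brunn_minkowski => //.
  - rewrite -[X in measurable X]setTI; apply: measurable_lte => //.
    exact/measurable_EFinP.
  - rewrite -[X in measurable X]setTI; apply: measurable_lte => //.
    exact/measurable_EFinP.
  - by rewrite -[X in measurable X]setTI; apply: measurable_lte.
  - by have [x hx] := hF _ l1; exists x; rewrite /= lte_fin.
  - by have [x hx] := hG _ l1; exists x; rewrite /= lte_fin.
  - apply: (finite_layer mf _ _ fa); first exact: mulr_gt0.
    by move=> x; case/andP: (fF x).
  - apply: (finite_layer mg _ _ gb); first exact: mulr_gt0.
    by move=> x; case/andP: (gG x).
  - move=> x y /=; rewrite !lte_fin => hx hy.
    apply: lt_le_trans (H x y); rewrite lte_fin.
    have -> : (l * M = (l * F) `^ t * (l * G) `^ s)%R.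
      rewrite !powRM ?(ltW l0) ?(ltW F0) ?(ltW G0)// /M.
      have -> : (l = l `^ t * l `^ s)%R.
        by rewrite -powRD ?ts ?powRr1 ?(ltW l0)//; apply/implyP => _; rewrite gt_eqF.
      by rewrite {2 3}(_ : l `^ t * l `^ s = l)%R; [ring|
        rewrite -powRD ?ts ?powRr1 ?(ltW l0)//; apply/implyP => _; rewrite gt_eqF].
    apply: ltr_pM; rewrite ?powR_ge0//.
    - by apply: gt0_ltr_powR; rewrite ?nnegrE ?mulr_ge0 ?(ltW l0) ?(ltW F0)//;
        case/andP: (fF x).
    - by apply: gt0_ltr_powR; rewrite ?nnegrE ?mulr_ge0 ?(ltW l0) ?(ltW G0)//;
        case/andP: (gG y).
have mI : measurable ([set x : R | 0 < x < 1]%R : set (measurableTypeR R)).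
  by rewrite (_ : mkset _ = `]0%R, 1%R[%classic).
have key : (t * (F^-1 * a))%:E + (s * (G^-1 * b))%:E <= M^-1%:E * \int[mu]_x h x.
  have mL (k : measurableTypeR R -> R) c : measurable_fun setT k ->
      measurable_fun [set x : R | 0 < x < 1]%R
        (fun x : measurableTypeR R => mu [set z | (x * c)%:E < (k z)%:E]).
    move=> mk; apply: measurable_funTS; apply: (measurable_layer (f := EFin \o k)).
    exact/measurable_EFinP.
  have -> : (t * (F^-1 * a))%:E =
      \int[mu]_(x in [set x : R | 0 < x < 1]%R) (t%:E * mu [set z | (x * F)%:E < (f z)%:E]).
    rewrite ge0_integralZl ?lee_fin ?(ltW t0)//; last exact: mL.
    by rewrite (bounded_layer mf F0 fF fa).
  have -> : (s * (G^-1 * b))%:E =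
      \int[mu]_(x in [set x : R | 0 < x < 1]%R) (s%:E * mu [set z | (x * G)%:E < (g z)%:E]).
    rewrite ge0_integralZl ?lee_fin ?(ltW s0)//; last exact: mL.
    by rewrite (bounded_layer mg G0 gG gb).
  rewrite -ge0_integralD//; last 4 first.
  - by move=> x _; rewrite mule_ge0// lee_fin ltW.
  - by apply: measurable_funeM; exact: mL.
  - by move=> x _; rewrite mule_ge0// lee_fin ltW.
  - by apply: measurable_funeM; exact: mL.
  apply: (@le_trans _ _ (\int[mu]_(x in [set x : R | 0 < x < 1]%R) mu [set z | (x * M)%:E < h z])).
    apply: ge0_le_integral => //.
    - by move=> x _; rewrite adde_ge0// mule_ge0// lee_fin ltW.
    - apply: emeasurable_funD; apply: measurable_funeM; exact: mL.
    - apply: measurable_funTS; exact: measurable_layer.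
  rewrite layer_cake_swap// -ge0_integralZl//; last by rewrite lee_fin invr_ge0 ltW.
  apply: ge0_le_integral => //.
  - exact: measurable_truncated_layer.
  - by apply: measurable_funeM.
  - by move=> z _; exact: lebesgue_truncated_itv.
apply: (@le_trans _ _ (M%:E * ((t * (F^-1 * a))%:E + (s * (G^-1 * b))%:E))).
  have a0 : (0 <= a)%R.
    by rewrite -lee_fin -fa; apply: integral_ge0 => x _; rewrite lee_fin; case/andP: (fF x).
  have b0 : (0 <= b)%R.
    by rewrite -lee_fin -gb; apply: integral_ge0 => x _; rewrite lee_fin; case/andP: (gG x).
  have F'0 : (0 <= F^-1 * a)%R by rewrite mulr_ge0// invr_ge0 ltW.
  have G'0 : (0 <= G^-1 * b)%R by rewrite mulr_ge0// invr_ge0 ltW.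
  rewrite -EFinD -EFinM lee_fin.
  have -> : (a `^ t * b `^ s = M * ((F^-1 * a) `^ t * (G^-1 * b) `^ s))%R.
    rewrite mulrACA -!powRM ?(ltW F0) ?(ltW G0)//.
    by rewrite !mulVKf ?gt_eqF//.
  by apply: ler_wpM2l; [exact: ltW|exact: weighted_amgm].
have -> : \int[mu]_x h x = M%:E * (M^-1%:E * \int[mu]_x h x).
  by rewrite muleA -EFinM divff ?gt_eqF// mul1e.
by apply: lee_wpmul2l => //; rewrite lee_fin ltW.
Qed.

End prekopa_leindler1.

(** * Coordinates, Gaussian integrals and Prekopa-Leindler in any dimension *)

Section rV_basics.
Variable R : realType.
Local Notation mu := (@lebesgue_measure R).

Lemma cons_rV0 n (p : measurableTypeR R * 'rV[R]_n) : cons_rV p ord0 ord0 = p.1.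
Proof. exact: (congr1 fst (cons_rVK p)). Qed.

Lemma cons_rVS n (p : measurableTypeR R * 'rV[R]_n) i :
  cons_rV p ord0 (lift ord0 i) = p.2 ord0 i.
Proof.
rewrite -[in RHS](cons_rVK p) /uncons_rV /= [RHS]mxE.
by apply: congr1; exact/val_inj.
Qed.

Lemma dotv_cons n (p q : measurableTypeR R * 'rV[R]_n) :
  dotv (cons_rV p) (cons_rV q) = p.1 * q.1 + dotv p.2 q.2.
Proof.
rewrite /dotv big_ord_recl !cons_rV0; congr +%R.
by apply: eq_bigr => i _; rewrite !cons_rVS.
Qed.

Lemma cons_rV_lin n (t s x y : R) (v w : 'rV[R]_n) :
  t *: cons_rV (x : measurableTypeR R, v) + s *: cons_rV (y : measurableTypeR R, w) =
  cons_rV (t * x + s * y : measurableTypeR R, t *: v + s *: w).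
Proof.
apply/rowP => i; rewrite [LHS]mxE ![(_ *: cons_rV _) _ _]mxE; case: (unliftP ord0 i) => [j|] ->.
  by rewrite !cons_rVS /= !mxE.
by rewrite !cons_rV0.
Qed.

Lemma measurable_cons_section n (x : measurableTypeR R) :
  measurable_fun setT (fun v : 'rV[R]_n => cons_rV (x, v)).
Proof.
apply: (@measurableT_comp _ _ _ _ _ _ (@cons_rV R n) _ (fun v => (x, v))).
  exact: measurable_cons_rV.
exact: pair1_measurable.
Qed.

Lemma ge0_integral_rVS n (f : 'rV[R]_n.+1 -> \bar R) :
  measurable_fun setT f -> (forall x, 0 <= f x)%E ->
  (\int[lebesgue_rV R n.+1]_x f x =
   \int[mu]_x \int[lebesgue_rV R n]_v f (cons_rV (x, v)))%E.
Proof.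
move=> mf f0.
rewrite -[LHS]/(integral (pushforward (mu \x lebesgue_rV R n)%E (@cons_rV R n)) setT f).
rewrite ge0_integral_pushforward//.
rewrite preimage_setT fubini_tonelli1//.
  by apply: measurableT_comp => //; exact: measurable_cons_rV.
by move=> x; exact: f0.
Qed.

Lemma measurable_integral_section n (f : 'rV[R]_n.+1 -> \bar R) :
  measurable_fun setT f -> (forall x, 0 <= f x)%E ->
  measurable_fun setT (fun x : measurableTypeR R =>
    \int[lebesgue_rV R n]_v f (cons_rV (x, v)))%E.
Proof.
move=> mf f0.
apply: (@measurable_fun_fubini_tonelli_F _ _ _ _ _ (lebesgue_rV R n) (f \o @cons_rV R n)) => //.
  by apply: measurableT_comp => //; exact: measurable_cons_rV.
by move=> x; exact: f0.
Qed.

Lemma measurable_dotv n : measurable_fun setT (fun x : 'rV[R]_n => dotv x x).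
Proof.
apply: measurable_sum => i; apply: measurable_funM; exact: measurable_rV_coor.
Qed.

Lemma gaussian_line (c : R) : 0 < c ->
  exists J : R, 0 < J /\ (\int[mu]_x (expR (- (c * (x * x))))%:E = J%:E)%E.
Proof.
move=> c0.
(* The standard deviation for which the normal density is proportional to exp(- c x^2). *)
pose sg := (Num.sqrt (2 * c))^-1.
have s0 : 0 < Num.sqrt (2 * c) by rewrite sqrtr_gt0 mulr_gt0.
have sg0 : sg != 0 by rewrite gt_eqF// invr_gt0.
have := integral_normal_pdf 0 sg.
rewrite /normal_pdf (negbTE sg0) /normal_fun.
have pk : 0 < normal_peak sg by rewrite normal_peak_gt0.
under eq_integral do rewrite EFinM.
rewrite ge0_integralZl//; last 2 first.
- by apply/measurable_EFinP; apply: measurable_normal_fun.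
- by rewrite lee_fin ltW.
move=> h; exists (normal_peak sg)^-1; split; first by rewrite invr_gt0.
rewrite -[RHS]mule1 -h muleA -EFinM mulVf ?gt_eqF// mul1e.
apply: eq_integral => x _; congr (expR _)%:E.
rewrite subr0 /sg exprVn sqr_sqrtr ?mulr_ge0// ?(ltW c0)//.
by field; rewrite gt_eqF.
Qed.

Lemma gaussian_rV n (c : R) : 0 < c ->
  exists J : R, 0 < J /\ (\int[lebesgue_rV R n]_x (expR (- (c * dotv x x)))%:E = J%:E)%E.
Proof.
move=> c0; elim: n => [|n [J [J0 hJ]]].
  exists 1; split => //; rewrite integral_dirac//; last first.
    apply/measurable_EFinP; apply: measurableT_comp => //.
    by apply: measurable_funN; apply: measurable_funM => //; exact: measurable_dotv.
  by rewrite diracT mul1e /dotv big_ord0 mulr0 oppr0 expR0.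
have [J1 [J10 hJ1]] := gaussian_line c0.
exists (J1 * J); split; first exact: mulr_gt0.
rewrite ge0_integral_rVS; last 2 first.
- apply/measurable_EFinP; apply: measurableT_comp => //.
  by apply: measurable_funN; apply: measurable_funM => //; exact: measurable_dotv.
- by move=> x; rewrite lee_fin expR_ge0.
under eq_integral => x _.
  under eq_integral => v _.
    rewrite dotv_cons /= mulrDr opprD expRD EFinM.
    over.
  rewrite ge0_integralZl//=; last first.
    apply/measurable_EFinP; apply: measurableT_comp => //.
    by apply: measurable_funN; apply: measurable_funM => //; exact: measurable_dotv.
  rewrite hJ.
  over.
rewrite ge0_integralZr//=; last 2 first.
- apply/measurable_EFinP; apply: measurableT_comp => //.
  by apply: measurable_funN; apply: measurable_funM => //; apply: measurable_funM.
- by rewrite lee_fin ltW.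
by rewrite hJ1 EFinM.
Qed.

(** Induction on the dimension: the inequality in dimension n, applied to the sections at x, y and
    tx + sy, is the pointwise hypothesis of the one-dimensional inequality for the section
    integrals. Gaussian domination is the form of boundedness that passes to sections and also makes
    their integrals finite and bounded. *)
Lemma prekopa_leindler n (t s c C a b : R) (u v : 'rV[R]_n -> R) (w : 'rV[R]_n -> \bar R) :
  0 < t -> 0 < s -> t + s = 1 -> 0 < c ->
  measurable_fun setT u -> measurable_fun setT v -> measurable_fun setT w ->
  (forall x, 0 <= u x <= C * expR (- (c * dotv x x))) ->
  (forall x, 0 <= v x <= C * expR (- (c * dotv x x))) ->
  (forall x, 0 <= w x)%E ->
  (\int[lebesgue_rV R n]_x (u x)%:E = a%:E)%E ->
  (\int[lebesgue_rV R n]_x (v x)%:E = b%:E)%E ->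
  (forall x y, ((u x `^ t * v y `^ s)%:E <= w (t *: x + s *: y)%R)%E) ->
  ((a `^ t * b `^ s)%:E <= \int[lebesgue_rV R n]_x w x)%E.
Proof.
move=> t0 s0 ts c0.
have cst_ge0 m (k : 'rV[R]_m -> R) e : 
    (forall x, 0 <= k x <= e * expR (- (c * dotv x x))) -> 0 <= e.
  move=> h; have /andP[h1 h2] := h 0; have := le_trans h1 h2.
  by rewrite pmulr_lge0// expR_gt0.
have gauss_section m (e x : R) (z : 'rV[R]_m) : 0 <= e ->
    e * expR (- (c * dotv (cons_rV (x : measurableTypeR R, z)) (cons_rV (x : measurableTypeR R, z))))
    <= e * expR (- (c * dotv z z)).
  move=> e0; apply: ler_wpM2l => //.
  rewrite ler_expR lerN2; apply: ler_wpM2l; first exact: ltW.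
  by rewrite dotv_cons /= lerDr -expr2 sqr_ge0.
elim: n u v w C a b => [|n IH] u v w C a b mu_ mv mw uC vC w0 ua vb H.
  move: ua vb; rewrite !integral_dirac//; try exact/measurable_EFinP.
  rewrite !diracT !mul1e => -[<-] -[<-].
  by apply: le_trans (H 0 0) _; rewrite !scaler0 addr0.
have [J [J0 hJ]] := gaussian_rV n c0.
(* The section integrals are real-valued and bounded by C J, where J is the Gaussian mass in
   dimension n. *)
have sec (k : 'rV[R]_n.+1 -> R) e : measurable_fun setT k ->
    (forall x, 0 <= k x <= C * expR (- (c * dotv x x))) ->
    (\int[lebesgue_rV R n.+1]_x (k x)%:E = e%:E)%E ->
    exists K : measurableTypeR R -> R,
    [/\ measurable_fun setT K, (forall x, 0 <= K x <= C * J),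
      (forall x, \int[lebesgue_rV R n]_v (k (cons_rV (x, v)))%:E = (K x)%:E)%E
      & (\int[mu]_x (K x)%:E = e%:E)%E].
  move=> mk kC ke.
  have k0 x : (0 <= (k x)%:E)%E by rewrite lee_fin; case/andP: (kC x).
  have mk' : measurable_fun setT (EFin \o k) by exact/measurable_EFinP.
  pose K x := (\int[lebesgue_rV R n]_v (k (cons_rV (x, v)))%:E)%E.
  have K0 x : (0 <= K x)%E by apply: integral_ge0.
  have C0 : 0 <= C by exact: cst_ge0 kC.
  have KJ x : (K x <= (C * J)%:E)%E.
    rewrite EFinM -hJ -ge0_integralZl//; last first.
      apply/measurable_EFinP; apply: measurableT_comp => //.
      by apply: measurable_funN; apply: measurable_funM => //; exact: measurable_dotv.
    apply: ge0_le_integral => //.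
    - exact: (measurableT_comp mk' (@measurable_cons_section n x)).
    - apply: measurable_funeM; apply/measurable_EFinP; apply: measurableT_comp => //.
      by apply: measurable_funN; apply: measurable_funM => //; exact: measurable_dotv.
    - move=> y _; rewrite -EFinM lee_fin; have /andP[_] := kC (cons_rV (x, y)).
      by move=> /le_trans; apply; exact: gauss_section.
  have Kf x : K x \is a fin_num by rewrite ge0_fin_numE// (le_lt_trans (KJ x))// ltry.
  exists (fine \o K); split.
  - apply: measurableT_comp => //; exact: (measurable_integral_section mk').
  - move=> x; rewrite -!lee_fin /= fineK//.
    by apply/andP; split; [exact: K0|exact: KJ].
  - by move=> x; rewrite /= fineK.
  - rewrite -ke ge0_integral_rVS//; apply: eq_integral => x _.
    by rewrite /= fineK.
have [U [mU U0 UE Ua]] := sec u a mu_ uC ua.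
have [V [mV V0 VE Vb]] := sec v b mv vC vb.
rewrite ge0_integral_rVS//.
apply: (@prekopa_leindler1 R t s (C * J) a b U V) => //.
- exact: measurable_integral_section.
- by move=> x; apply: integral_ge0.
move=> x y.
apply: (IH (fun z => u (cons_rV (x : measurableTypeR R, z)))
   (fun z => v (cons_rV (y : measurableTypeR R, z)))
   (fun z => w (cons_rV (t * x + s * y : measurableTypeR R, z))) C) => //.
- exact: (measurableT_comp mu_ (@measurable_cons_section n x)).
- exact: (measurableT_comp mv (@measurable_cons_section n y)).
- exact: (measurableT_comp mw (@measurable_cons_section n (t * x + s * y))).
- move=> z; have /andP[-> h] := uC (cons_rV (x : measurableTypeR R, z)).
  by rewrite (le_trans h)// gauss_section// (cst_ge0 _ _ _ uC).
- move=> z; have /andP[-> h] := vC (cons_rV (y : measurableTypeR R, z)).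
  by rewrite (le_trans h)// gauss_section// (cst_ge0 _ _ _ uC).
- by move=> z z'; apply: le_trans (H _ _) _; rewrite cons_rV_lin.
Qed.

End rV_basics.

(** * Elementary tools: bounded weights, scalar products, power bounds *)

Section bounded_weight.
Context d (T : measurableType d) (R : realType) (mu : {measure set T -> \bar R}).

Lemma bounded_mul_integrable (q f : T -> R) (B : R) :
  mu.-integrable setT (EFin \o q) -> measurable_fun setT f ->
  (forall x, `|f x| <= B) -> mu.-integrable setT (EFin \o (fun x => f x * q x)).
Proof.
move=> iq mf fB.
have mq : measurable_fun setT q.
  by apply/measurable_EFinP; exact: measurable_int iq.
have iBq : mu.-integrable setT (EFin \o (fun x => B * q x)).
  by have := integrableZl measurableT B iq.
apply: (le_integrable measurableT _ _ iBq).
  by apply/measurable_EFinP; exact: measurable_funM.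
move=> x _ /=; rewrite lee_fin !normrM ler_wpM2r//.
by rewrite (le_trans (fB x))// ler_norm.
Qed.

End bounded_weight.

Lemma measurable_funV d (T : measurableType d) (R : realType) (f : T -> R) :
  measurable_fun setT f -> measurable_fun setT (fun x => (f x)^-1).
Proof.
(* Writes 1/f as f |f|^(-2), which also agrees with the value 0 where f vanishes. *)
move=> mf; rewrite (_ : (fun x => _) = (fun x => f x * (`|f x| `^ (-1)) ^+ 2)).
  apply: measurable_funM => //; apply: measurable_funX.
  apply: (measurableT_comp (@measurable_powR R (-1))).
  exact: measurableT_comp.
apply/funext => x; rewrite powR_inv1//.
have [->|fx0] := eqVneq (f x) 0; first by rewrite mul0r invr0.
by rewrite exprVn real_normK ?num_real// expr2 invfM mulrA divff// mul1r.
Qed.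

Lemma normr_between (R : realType) (a b x : R) : a <= x <= b -> `|x| <= `|a| + `|b|.
Proof.
move=> /andP[ax xb]; rewrite ler_norml; apply/andP; split.
  rewrite lerNl -[leLHS]addr0 lerD// -(normrN a).
  by rewrite (le_trans _ (ler_norm (- a)))// lerN2.
by rewrite -[leLHS]add0r lerD// (le_trans xb)// ler_norm.
Qed.

Section dotv_theory.
Variables (R : realType) (n : nat).
Implicit Types u v w : 'rV[R]_n.

Lemma dotvC u v : dotv u v = dotv v u.
Proof. by apply: eq_bigr => i _; rewrite mulrC. Qed.

Lemma dotvDl u v w : dotv (u + v) w = dotv u w + dotv v w.
Proof. by rewrite /dotv -big_split; apply: eq_bigr => i _; rewrite mxE mulrDl. Qed.

Lemma dotvZl a u v : dotv (a *: u) v = a * dotv u v.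
Proof. by rewrite /dotv mulr_sumr; apply: eq_bigr => i _; rewrite mxE mulrA. Qed.

Lemma dotvDr u v w : dotv u (v + w) = dotv u v + dotv u w.
Proof. by rewrite dotvC dotvDl dotvC [dotv w u]dotvC. Qed.

Lemma dotvZr a u v : dotv u (a *: v) = a * dotv u v.
Proof. by rewrite dotvC dotvZl dotvC. Qed.

Lemma dotvNl u v : dotv (- u) v = - dotv u v.
Proof. by rewrite -scaleN1r dotvZl mulN1r. Qed.

Lemma dotvNr u v : dotv u (- v) = - dotv u v.
Proof. by rewrite dotvC dotvNl dotvC. Qed.

Lemma dotvBl u v w : dotv (u - v) w = dotv u w - dotv v w.
Proof. by rewrite dotvDl dotvNl. Qed.

Lemma dotvBr u v w : dotv u (v - w) = dotv u v - dotv u w.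
Proof. by rewrite dotvDr dotvNr. Qed.

Lemma dotv_ge0 u : 0 <= dotv u u.
Proof. by apply: sumr_ge0 => i _; rewrite -expr2 sqr_ge0. Qed.

Lemma dotv_young (k : R) u v : 0 < k ->
  dotv u v <= k / 2 * dotv u u + (2 * k)^-1 * dotv v v.
Proof.
move=> k0; have := dotv_ge0 (k *: u - v).
rewrite dotvBl !dotvBr !dotvZl !dotvZr [dotv v u]dotvC => h.
have -> : k / 2 * dotv u u + (2 * k)^-1 * dotv v v = dotv u v +
    (2 * k)^-1 * (k * (k * dotv u u) - k * dotv u v - (k * dotv u v - dotv v v)).
  by field; rewrite gt_eqF.
by rewrite lerDl mulr_ge0// invr_ge0 mulr_ge0// ltW.
Qed.

End dotv_theory.

Lemma gaussian_integrable (R : realType) n (c : R) : 0 < c ->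
  (lebesgue_rV R n).-integrable setT (EFin \o (fun x => expR (- (c * dotv x x)))).
Proof.
move=> c0; have [J [J0 hJ]] := gaussian_rV n c0.
apply/integrableP; split.
  apply/measurable_EFinP; apply: measurableT_comp => //.
  by apply: measurable_funN; apply: measurable_funM => //; exact: measurable_dotv.
under eq_integral do rewrite /= ger0_norm ?expR_ge0//.
by rewrite hJ ltry.
Qed.

(** From ln(1 + y) >= y / (1 + y) and exp v >= 1 + v. The bound is exact to first order in y, the
    order that matters when y is proportional to s and s tends to 0. *)
Lemma powR_ge1D (R : realType) (t y : R) : 0 < t -> 0 <= y ->
  1 + t * (y / (1 + y)) <= (1 + y) `^ t.
Proof.
move=> t0 y0; have y1 : 0 < 1 + y by rewrite ltr_pwDl.
rewrite /powR gt_eqF//; apply: le_trans (expR_ge1Dx _).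
rewrite lerD2l; apply: ler_wpM2l; first exact: ltW.
have e1 : (1 + y)^-1 = 1 + - (y / (1 + y)) by field; rewrite gt_eqF.
rewrite -lerN2 -lnV ?posrE//; have := @le_ln1Dx R (- (y / (1 + y))).
by rewrite -e1; apply; rewrite ltrN2 ltr_pdivrMr// mul1r ltrDr.
Qed.

(** * Log-Sobolev inequality for strongly log-concave densities and regular functions *)

Section lsi_smooth.
Variables (R : realType) (n : nat).
Local Notation leb := (lebesgue_rV R n).
Variables (V : 'rV[R]_n -> R) (kappa c C : R).
Hypothesis kappa0 : 0 < kappa.
Hypothesis c0 : 0 < c.
Hypothesis mV : measurable_fun setT V.
Hypothesis VC : forall x, expR (- V x) <= C * expR (- (c * dotv x x)).
Hypothesis cvxV : forall t s x y, 0 < t -> 0 < s -> t + s = 1 ->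
  V (t *: x + s *: y) <= t * V x + s * V y - kappa / 2 * (t * s) * dotv (x - y) (x - y).

Let q x := expR (- V x).

Let mq : measurable_fun setT q.
Proof. by apply: measurableT_comp => //; exact: measurable_funN. Qed.

Lemma log_concave_integrable : leb.-integrable setT (EFin \o q).
Proof.
have ig := integrableZl measurableT C (gaussian_integrable n c0).
apply: (le_integrable measurableT _ _ ig); first exact/measurable_EFinP.
move=> x _; rewrite /= lee_fin ger0_norm ?expR_ge0//.
by rewrite (le_trans (VC x))// ler_norm.
Qed.

Variables (h : 'rV[R]_n -> R) (H : 'rV[R]_n -> 'rV[R]_n) (delta M B K : R).
Hypothesis delta0 : 0 < delta.
Hypothesis K0 : 0 <= K.
Hypothesis mh : measurable_fun setT h.
Hypothesis mH : measurable_fun setT (fun x => dotv (H x) (H x)).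
Hypothesis hM : forall x, delta <= h x <= M.
Hypothesis HB : forall x, dotv (H x) (H x) <= B.
Hypothesis descent : forall x y,
  h y <= h x + dotv (H x) (y - x) + K / 2 * dotv (y - x) (y - x).

Let h0 x : 0 < h x. Proof. by case/andP: (hM x) => /(lt_le_trans delta0). Qed.

(** The pointwise hypothesis of Prekopa-Leindler for h^(1/t) q and q. The gain (kappa/2) ts |x -
    y|^2 from strong convexity absorbs the Taylor remainder of h and, through Young's inequality,
    the linear term in x - y; what remains is of order s times |H|^2 / h^2. The positivity
    assumption holds once s is small. *)
Lemma sup_convolution_bound t s x y : 0 < t -> 0 < s -> t + s = 1 ->
  0 < kappa * t - K / delta * s ->
  h x * (q x `^ t * q y `^ s) <=
  h (t *: x + s *: y) * expR (s * (2 * (kappa * t - K / delta * s))^-1 *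
     (dotv (H (t *: x + s *: y)) (H (t *: x + s *: y)) / h (t *: x + s *: y) ^+ 2)) *
  q (t *: x + s *: y).
Proof.
move=> t0 s0 ts; set k := kappa * t - _ => k0.
set z := t *: x + s *: y; set D := dotv (x - y) (x - y).
have hz := h0 z.
have D0 : 0 <= D by exact: dotv_ge0.
have xz : x - z = s *: (x - y).
  rewrite /z -[X in X - _](scale1r x) -ts scalerDl scalerBr.
  by rewrite opprD addrACA subrr add0r.
pose p := (h z)^-1 *: H z.
(* Taylor bound at z with x - z = s (x - y), divided by h z >= delta, then 1 + v <= exp v. *)
have hx : h x <= h z * expR (s * dotv p (x - y) + K / delta * s ^+ 2 / 2 * D).
  have e1 : h x = h z * (1 + (h x - h z) / h z) by field; rewrite gt_eqF.
  rewrite [leLHS]e1; apply: ler_wpM2l; first exact: ltW.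
  apply: le_trans (expR_ge1Dx _) _; rewrite ler_expR.
  have := descent z x; rewrite xz !dotvZr dotvZl -/D => hd.
  have -> : (h x - h z) / h z = (h z)^-1 * (h x - h z) by rewrite mulrC.
  apply: (@le_trans _ _ ((h z)^-1 * (s * dotv (H z) (x - y) + K / 2 * (s * (s * D))))).
    apply: ler_wpM2l; first by rewrite invr_ge0 ltW.
    by rewrite lerBlDl addrA.
  rewrite mulrDr; apply: lerD; first by rewrite /p dotvZl mulrCA.
  have -> : K / delta * s ^+ 2 / 2 * D = delta^-1 * (K / 2 * (s * (s * D))) by ring.
  apply: ler_wpM2r; first by rewrite !mulr_ge0// ltW.
  by rewrite lef_pV2 ?posrE//; case/andP: (hM z).
rewrite /q -!expRM -expRD.
apply: (@le_trans _ _ (h z * expR (s * dotv p (x - y) + K / delta * s ^+ 2 / 2 * D) *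
   expR (- V x * t + - V y * s))).
  by apply: ler_wpM2r; rewrite ?expR_ge0.
rewrite -!mulrA; apply: ler_wpM2l; first exact: ltW.
rewrite -!expRD ler_expR.
have := cvxV x y t0 s0 ts; rewrite -/z -/D => hV.
(* The weight [k] is the convexity left after the remainder has been paid for, so all terms in |x -
   y|^2 cancel. *)
have := @dotv_young R n k (x - y) p k0; rewrite -/D dotvC => hY.
have pp : dotv (H z) (H z) / h z ^+ 2 = dotv p p.
  by rewrite /p dotvZl dotvZr; field; rewrite gt_eqF.
rewrite mulrA pp.
have := ler_wpM2l (ltW s0) hY => {}hY.
apply: (@le_trans _ _ (s * (k / 2 * D + (2 * k)^-1 * dotv p p) +
  K / delta * s ^+ 2 / 2 * D - (V z + kappa / 2 * (t * s) * D))); first lra.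
rewrite le_eqVlt; apply/orP; left; apply/eqP.
rewrite /k; field.
have -> : kappa * t * delta - K * s = delta * k by rewrite /k; field; rewrite gt_eqF.
by rewrite mulf_neq0 ?gt_eqF.
Qed.

Local Notation "'I' f" := (\int[leb]_x (f x * q x)) (at level 10, f at level 9).

Let D x := dotv (H x) (H x) / h x ^+ 2.

Let mD : measurable_fun setT D.
Proof.
by apply: measurable_funM => //; apply: measurable_funV; exact: measurable_funX.
Qed.

Let D_ge0 x : 0 <= D x.
Proof. by rewrite /D divr_ge0 ?dotv_ge0// exprn_ge0// ltW. Qed.

Let DB x : D x <= B / delta ^+ 2.
Proof.
apply: ler_pM; [exact: dotv_ge0|by rewrite invr_ge0 exprn_ge0// ltW|exact: HB|].
rewrite lef_pV2 ?posrE ?exprn_gt0// ler_pXn2r ?nnegrE ?(ltW delta0) ?(ltW (h0 x))//.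
by case/andP: (hM x).
Qed.

(** Both sides of Prekopa-Leindler are expanded around the partition function Z: the left exceeds Z
    by about s times the entropy, the right by at most a multiple of s times the Fisher information.
    After division by s the parasitic factors tend to 1 with s. *)
Lemma lsi_normalized_step t s : 0 < t -> 0 < s -> t + s = 1 ->
  0 < kappa * t - K / delta * s ->
  0 < \int[leb]_x q x ->
  I h = \int[leb]_x q x ->
  0 <= I (fun x => h x * ln (h x)) ->
  I (fun x => h x * ln (h x)) <=
  (1 + s / t * (I (fun x => h x * ln (h x)) / \int[leb]_x q x)) *
  ((2 * (kappa * t - K / delta * s))^-1 *
    expR (s * (2 * (kappa * t - K / delta * s))^-1 * (B / delta ^+ 2))) *
  I (fun x => dotv (H x) (H x) / h x).
Proof.
move=> t0 s0 ts k0 Z0 hZ E0; set Z := \int[leb]_x q x; set E := I (fun x => h x * ln (h x)) in E0 *.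
set k := (2 * _)^-1; set J := I (fun x => dotv (H x) (H x) / h x).
have k'0 : 0 < k by rewrite invr_gt0 mulr_gt0.
have iq := log_concave_integrable.
have M0 : 0 < M by case/andP: (hM 0) => /(lt_le_trans delta0) + /(lt_le_trans _) => /[swap]; apply.
(* The exponent 1/t is chosen so that u(x)^t q(y)^s = h(x) q(x)^t q(y)^s. *)
pose u x := h x `^ t^-1 * q x.
have mu_ : measurable_fun setT u.
  by apply: measurable_funM => //; exact: (measurableT_comp (@measurable_powR R t^-1)).
pose e x := expR (s * k * D x).
have me : measurable_fun setT e.
  by apply: measurableT_comp => //; apply: measurable_funM.
pose eB := expR (s * k * (B / delta ^+ 2)).
have eeB x : 0 < e x <= eB.
  rewrite expR_gt0 /= ler_expR ler_wpM2l// mulr_ge0// ltW//.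
pose w x := h x * e x * q x.
have iu : leb.-integrable setT (EFin \o u).
  apply: (@bounded_mul_integrable _ _ _ _ _ (fun x => h x `^ t^-1) (M `^ t^-1)) => //.
    by exact: (measurableT_comp (@measurable_powR R t^-1)).
  move=> x; rewrite ger0_norm ?powR_ge0//; apply: ge0_ler_powR.
  - by rewrite invr_ge0 ltW.
  - by rewrite nnegrE ltW.
  - by rewrite nnegrE ltW.
  - by case/andP: (hM x).
have iw : leb.-integrable setT (EFin \o w).
  apply: (@bounded_mul_integrable _ _ _ _ _ (fun x => h x * e x) (M * eB)) => //.
    exact: measurable_funM.
  move=> x; have /andP[e0 eB'] := eeB x; have /andP[_ hM'] := hM x.
  rewrite ger0_norm; last by rewrite mulr_ge0// ltW.
  by apply: ler_pM => //; exact: ltW.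
pose C' := (M `^ t^-1 + 1) * C.
have C0 : 0 <= C.
  by have := le_trans (expR_ge0 _) (VC 0); rewrite pmulr_lge0// expR_gt0.
have PL : (\int[leb]_x u x) `^ t * Z `^ s <= \int[leb]_x w x.
  rewrite -lee_fin [leRHS]fineK ?integrable_fin_num//.
  apply: (@prekopa_leindler R n t s c C' _ _ u q (fun x => (w x)%:E)) => //.
  - by apply/measurable_EFinP; apply: measurable_funM => //; exact: measurable_funM.
  - move=> x; rewrite mulr_ge0 ?powR_ge0 ?expR_ge0//= /C' -mulrA; apply: ler_pM; rewrite ?powR_ge0 ?expR_ge0//.
      apply: (@le_trans _ _ (M `^ t^-1)); last by rewrite lerDl.
      apply: ge0_ler_powR; rewrite ?nnegrE ?invr_ge0 ?(ltW t0) ?(ltW M0) ?(ltW (h0 x))//.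
      by case/andP: (hM x).
    exact: VC.
  - move=> x; rewrite expR_ge0/= /C' -mulrA; apply: le_trans (VC x) _.
    rewrite ler_peMl//; last by rewrite lerDr powR_ge0.
    by rewrite mulr_ge0// expR_ge0.
  - move=> x; by rewrite lee_fin !mulr_ge0 ?expR_ge0// ltW.
  - by rewrite [RHS]fineK ?integrable_fin_num.
  - by rewrite [RHS]fineK ?integrable_fin_num.
  - move=> x y; rewrite lee_fin /u powRM ?powR_ge0 ?expR_ge0// -powRrM mulVf ?gt_eqF//.
    rewrite powRr1 ?(ltW (h0 x))// -mulrA; exact: sup_convolution_bound.
(* Since 1/t = 1 + s/t, h^(1/t) = h exp((s/t) ln h) >= h + (s/t) h ln h. *)
have lower : Z + s / t * E <= \int[leb]_x u x.
  have iE : leb.-integrable setT (EFin \o (fun x => h x * ln (h x) * q x)).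
    apply: (@bounded_mul_integrable _ _ _ _ _ (fun x => h x * ln (h x))
      (M * (`|ln delta| + `|ln M|))) => //.
      by apply: measurable_funM => //; exact: (measurableT_comp (@measurable_ln R)).
    move=> x; have /andP[h1 h2] := hM x.
    rewrite normrM; apply: ler_pM => //; first by rewrite ger0_norm ?(ltW (h0 x)).
    have l1 : ln delta <= ln (h x) by rewrite ler_ln ?posrE.
    have l2 : ln (h x) <= ln M by rewrite ler_ln ?posrE.
    by apply: normr_between; rewrite l1.
  have ih : leb.-integrable setT (EFin \o (fun x => h x * q x)).
    apply: (@bounded_mul_integrable _ _ _ _ _ h M) => //.
    by move=> x; case/andP: (hM x); rewrite ger0_norm// ltW.
  have isE : leb.-integrable setT (EFin \o (fun x => s / t * (h x * ln (h x) * q x))).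
    by have := integrableZl measurableT (s / t) iE.
  have -> : Z = I h by rewrite hZ.
  rewrite -RintegralZl// -RintegralD//.
  apply: le_Rintegral => //.
    by have := integrableD measurableT ih isE.
  move=> x _; rewrite [_ * (_ * q x)]mulrA -mulrDl; apply: ler_wpM2r; first exact: expR_ge0.
  have -> : h x `^ t^-1 = h x * expR (s / t * ln (h x)).
    rewrite -[X in X * expR _](lnK (h0 x)) -expRD /powR gt_eqF//; congr expR.
    have -> : s = 1 - t by rewrite -ts addrC addKr.
    by field; rewrite gt_eqF.
  rewrite [_ * (_ * ln _)]mulrCA -{1}[h x]mulr1 -mulrDr.
  by apply: ler_wpM2l; [exact: ltW|exact: expR_ge1Dx].
(* Uses exp v <= 1 + v exp v for v = s k D(x), with exp v bounded uniformly by [eB]. *)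
have upper : \int[leb]_x w x <= Z + s * k * eB * J.
  have iJ : leb.-integrable setT (EFin \o (fun x => dotv (H x) (H x) / h x * q x)).
    apply: (@bounded_mul_integrable _ _ _ _ _ (fun x => dotv (H x) (H x) / h x)
      (B / delta)) => //.
      by apply: measurable_funM => //; exact: measurable_funV.
    move=> x; have /andP[h1 h2] := hM x.
    rewrite ger0_norm; last by rewrite divr_ge0 ?dotv_ge0// ltW.
    apply: ler_pM; rewrite ?dotv_ge0 ?invr_ge0 ?(ltW (h0 x))//.
    by rewrite lef_pV2 ?posrE.
  have ih : leb.-integrable setT (EFin \o (fun x => h x * q x)).
    apply: (@bounded_mul_integrable _ _ _ _ _ h M) => //.
    by move=> x; case/andP: (hM x); rewrite ger0_norm// ltW.
  have isJ : leb.-integrable setT (EFin \o (fun x => s * k * eB * (dotv (H x) (H x) / h x * q x))).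
    by have := integrableZl measurableT (s * k * eB) iJ.
  have -> : Z = I h by rewrite hZ.
  rewrite -RintegralZl// -RintegralD//.
  apply: le_Rintegral => //.
    by have := integrableD measurableT ih isJ.
  move=> x _; rewrite [_ * (_ * q x)]mulrA -mulrDl; apply: ler_wpM2r; first exact: expR_ge0.
  have -> : s * k * eB * (dotv (H x) (H x) / h x) = h x * (s * k * D x * eB).
    by rewrite /D; field; rewrite gt_eqF.
  have -> : h x + h x * (s * k * D x * eB) = h x * (1 + s * k * D x * eB) by ring.
  apply: ler_wpM2l; first exact: ltW.
  have y0 : 0 <= s * k * D x by rewrite mulr_ge0 ?D_ge0// mulr_ge0// ltW.
  have /andP[e0 eB'] := eeB x.
  have h1 : 1 - s * k * D x <= (e x)^-1.
    by rewrite /e -expRN; exact: expR_ge1Dx.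
  have h2 : e x * (1 - s * k * D x) <= 1.
    by have := ler_wpM2l (ltW e0) h1; rewrite mulfV ?gt_eqF.
  have h3 := ler_wpM2l y0 eB'.
  move: h2 h3; lra.
have st0 : 0 < s / t by exact: divr_gt0.
have eZ0 : 0 <= E / Z by rewrite divr_ge0// ltW.
have y1 : 0 < 1 + s / t * (E / Z).
  by rewrite ltr_pwDl// mulr_ge0// ltW.
have J0 : 0 <= J.
  apply: Rintegral_ge0 => x _; rewrite mulr_ge0 ?expR_ge0//.
  by rewrite divr_ge0 ?dotv_ge0// ltW.
have sE : s / t * E = Z * (s / t * (E / Z)) by field; rewrite !gt_eqF.
have ZE : E = Z * (E / Z) by field; rewrite gt_eqF.
move: y1 lower; set y := s / t * (E / Z) => y1 lower.
have y0 : 0 <= y by rewrite /y mulr_ge0// ltW.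
have tys : t * y = s * (E / Z) by rewrite /y; field; rewrite !gt_eqF.
(* Here Z^t Z^s = Z, and t y = s E / Z, so after Z is cancelled both sides carry the factor s. *)
have : Z * (1 + t * (y / (1 + y))) <= Z + s * k * eB * J.
  apply: le_trans upper; apply: le_trans PL.
  rewrite sE in lower.
  apply: (@le_trans _ _ ((Z * (1 + y)) `^ t * Z `^ s)); last first.
    apply: ler_wpM2r; first exact: powR_ge0.
    apply: ge0_ler_powR; rewrite ?(ltW t0)// ?nnegrE.
    - by rewrite mulr_ge0 ?(ltW Z0) ?(ltW y1).
    - apply: le_trans lower; rewrite addr_ge0 ?(ltW Z0)//.
      by rewrite mulr_ge0 ?(ltW Z0).
    - by rewrite mulrDr mulr1.
  rewrite powRM ?(ltW Z0) ?(ltW y1)// [leRHS]mulrAC -powRD ?ts ?powRr1 ?(ltW Z0)//; last first.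
    by apply/implyP => _; rewrite gt_eqF.
  by apply: ler_wpM2l; [exact: ltW|exact: powR_ge1D].
rewrite mulrDr mulr1 lerD2l [t * (y / _)]mulrA tys.
have -> : Z * (s * (E / Z) / (1 + y)) = s * (E / (1 + y)).
  by field; rewrite !gt_eqF.
rewrite -!mulrA ler_pM2l// ler_pdivrMr// => /le_trans; apply.
by rewrite le_eqVlt /eB -!mulrA; apply/orP; left; apply/eqP; ring.
Qed.

(** The bound of [lsi_normalized_step] is continuous in s at 0, where it equals (2 kappa)^(-1) times
    the Fisher information. A negative entropy needs no argument, since the right-hand side is
    nonnegative. *)
Lemma lsi_normalized :
  0 < \int[leb]_x q x ->
  I h = \int[leb]_x q x ->
  I (fun x => h x * ln (h x)) <=
  (2 * kappa)^-1 * I (fun x => dotv (H x) (H x) / h x).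
Proof.
move=> Z0 hZ; set E := I (fun x => h x * ln (h x)).
set J := I (fun x => dotv (H x) (H x) / h x).
have J0 : 0 <= J.
  apply: Rintegral_ge0 => x _; rewrite mulr_ge0 ?expR_ge0//.
  by rewrite divr_ge0 ?dotv_ge0// ltW.
have [E0|/ltW E0] := leP 0 E; last first.
  by rewrite (le_trans E0)// mulr_ge0// invr_ge0 mulr_ge0// ltW.
set e := E / \int[leb]_x q x.
pose ks (s : R) : R := (2 * (kappa * (1 - s) - K / delta * s))^-1.
pose F (s : R) : R := (1 + s / (1 - s) * e) * (ks s * expR (s * ks s * (B / delta ^+ 2))) * J.
have ks0 : ks 0 = (2 * kappa)^-1 by rewrite /ks subr0 mulr1 mulr0 subr0.
have F0 : F 0 = (2 * kappa)^-1 * J.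
  by rewrite /F ks0 !mul0r expR0 addr0 mul1r mulr1.
rewrite -F0.
have ck : {for 0, continuous ks}.
  apply: continuousV.
    by rewrite subr0 mulr1 mulr0 subr0 gt_eqF// mulr_gt0.
  apply: continuousM; first exact: cvg_cst.
  apply: continuousB; apply: continuousM; try exact: cvg_cst; last exact: cvg_id.
  by apply: continuousB; [exact: cvg_cst|exact: cvg_id].
have cF : {for 0, continuous F}.
  apply: continuousM; last exact: cvg_cst.
  apply: continuousM.
    apply: continuousD; first exact: cvg_cst.
    apply: continuousM; last exact: cvg_cst.
    apply: continuousM; first exact: cvg_id.
    apply: continuousV; first by rewrite subr0 oner_neq0.
    by apply: continuousB; [exact: cvg_cst|exact: cvg_id].
  apply: continuousM; first exact: ck.
  have cs : {for 0, continuous (fun s : R => s * ks s * (B / delta ^+ 2))}.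
    apply: continuousM; last exact: cvg_cst.
    by apply: continuousM; [exact: cvg_id|exact: ck].
  exact: (cvg_comp _ _ cs (@continuous_expR R _)).
rewrite leNgt; apply/negP => FE.
have h1 : \forall s \near (0 : R), F s < E by exact: (cvgr_lt _ cF).
have h2 : \forall s \near (0 : R), 0 < kappa * (1 - s) - K / delta * s.
  have c2 : {for 0, continuous (fun s : R => kappa * (1 - s) - K / delta * s)}.
    apply: continuousB; apply: continuousM; try exact: cvg_cst; last exact: cvg_id.
    by apply: continuousB; [exact: cvg_cst|exact: cvg_id].
  by apply: (cvgr_gt _ c2); rewrite subr0 mulr1 mulr0 subr0.
have h3 : \forall s \near (0 : R), s < 1.
  by apply: (cvgr_lt _ (@cvg_id _ _)).
have [eps /= eps0 heps] : exists2 eps : R, 0 < eps & forall s, `|s| < eps ->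
    [/\ F s < E, 0 < kappa * (1 - s) - K / delta * s & s < 1].
  have := filterI h1 (filterI h2 h3) => -[eps /= eps0 he]; exists eps => // s hs.
  by have [|a [b c']] := he s; rewrite /= ?sub0r ?normrN.
have s0 : 0 < eps / 2 by rewrite divr_gt0.
have [|f1 f2 f3] := heps (eps / 2).
  by rewrite gtr0_norm// ltr_pdivrMr// ltr_pMr// ltr1n.
have := @lsi_normalized_step (1 - eps / 2) (eps / 2) _ s0 _ f2 Z0 hZ E0.
rewrite subrK subr_gt0 => /(_ f3 erefl).
by rewrite -/E -/J -/e -/(ks (eps / 2)) -/(F (eps / 2)) leNgt f1.
Qed.

End lsi_smooth.

(** * Stability under bounded perturbation: the Holley-Stroock argument *)

Section holley_stroock.
Variables (R : realType) (n : nat).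
Local Notation leb := (lebesgue_rV R n).

(** Otherwise q would vanish almost everywhere while being nowhere zero, so the whole space would be
    null and Gaussians would integrate to 0. *)
Lemma positive_integral_gt0 (q : 'rV[R]_n -> R) :
  leb.-integrable setT (EFin \o q) -> (forall x, 0 < q x) ->
  0 < \int[leb]_x q x.
Proof.
move=> iq q0.
have : 0 <= \int[leb]_x q x by apply: Rintegral_ge0 => x _; exact: ltW.
rewrite le_eqVlt => /predU1P[/esym h|//].
have mq := measurable_int _ iq.
have : (\int[leb]_x `|(EFin \o q) x| = 0)%E.
  under eq_integral do rewrite gee0_abs ?lee_fin ?(ltW (q0 _))//.
  by rewrite -[LHS]fineK ?integrable_fin_num// -/(Rintegral leb setT q) h.
move/(ae_eq_integral_abs leb measurableT mq) => /= hae.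
have [J [J0 hJ]] := @gaussian_rV R n 1 ltr01.
suff : (\int[leb]_x (expR (- (1 * dotv x x)))%:E = \int[leb]_x (cst 0 x))%E.
  by rewrite hJ integral0 => -[/eqP]; rewrite gt_eqF.
apply: ae_eq_integral => //.
  exact: measurable_int (gaussian_integrable n ltr01).
apply: filterS hae => x /(_ I) [/eqP]; by rewrite gt_eqF.
Qed.

(** This is the Bregman divergence of the convex function y ln y, that is, its gap above the tangent
    line at m. *)
Lemma entropy_gap_ge0 (m y : R) : 0 < m -> 0 < y ->
  0 <= y * ln y - y * ln m - y + m.
Proof.
move=> m0 y0; have := @le_ln1Dx R (m / y - 1).
have -> : 1 + (m / y - 1) = m / y by ring.
rewrite ln_div ?posrE// ltrBrDr addNr divr_gt0// => /(_ isT).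
move=> /(ler_wpM2l (ltW y0)).
have -> : y * (m / y - 1) = m - y by field; rewrite gt_eqF.
by rewrite mulrBr; lra.
Qed.

Variables (V p : 'rV[R]_n -> R) (kappa c C a b : R).
Hypothesis kappa0 : 0 < kappa.
Hypothesis c0 : 0 < c.
Hypothesis mV : measurable_fun setT V.
Hypothesis VC : forall x, expR (- V x) <= C * expR (- (c * dotv x x)).
Hypothesis cvxV : forall t s x y, 0 < t -> 0 < s -> t + s = 1 ->
  V (t *: x + s *: y) <= t * V x + s * V y - kappa / 2 * (t * s) * dotv (x - y) (x - y).
Hypothesis a0 : 0 < a.
Hypothesis mp : measurable_fun setT p.
Hypothesis pab : forall x, a * expR (- V x) <= p x <= b * expR (- V x).
Hypothesis p1 : \int[leb]_x p x = 1.

Let q x := expR (- V x).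

Let iq : leb.-integrable setT (EFin \o q).
Proof. exact: (log_concave_integrable c0 mV VC). Qed.

Let ip : leb.-integrable setT (EFin \o p).
Proof.
have ibq := integrableZl measurableT b iq.
apply: (le_integrable measurableT _ _ ibq); first exact/measurable_EFinP.
move=> x _; rewrite /= lee_fin; have /andP[h1 h2] := pab x.
rewrite ger0_norm; first by rewrite (le_trans h2)// ler_norm.
by rewrite (le_trans _ h1)// mulr_ge0 ?expR_ge0// ltW.
Qed.

Variables (h : 'rV[R]_n -> R) (H : 'rV[R]_n -> 'rV[R]_n) (delta M B K : R).
Hypothesis delta0 : 0 < delta.
Hypothesis K0 : 0 <= K.
Hypothesis mh : measurable_fun setT h.
Hypothesis mH : measurable_fun setT (fun x => dotv (H x) (H x)).
Hypothesis hM : forall x, delta <= h x <= M.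
Hypothesis HB : forall x, dotv (H x) (H x) <= B.
Hypothesis descent : forall x y,
  h y <= h x + dotv (H x) (y - x) + K / 2 * dotv (y - x) (y - x).

Let h0 x : 0 < h x. Proof. by case/andP: (hM x) => /(lt_le_trans delta0). Qed.

Section integrability.
Variable w : 'rV[R]_n -> R.
Hypothesis iw : leb.-integrable setT (EFin \o w).

Let integrable_h : leb.-integrable setT (EFin \o (fun x => h x * w x)).
Proof.
apply: (@bounded_mul_integrable _ _ _ _ _ h M) => // x.
by case/andP: (hM x); rewrite ger0_norm// ltW.
Qed.

Let integrable_hlnh : leb.-integrable setT (EFin \o (fun x => h x * ln (h x) * w x)).
Proof.
apply: (@bounded_mul_integrable _ _ _ _ _ (fun x => h x * ln (h x))
  (M * (`|ln delta| + `|ln M|))) => //.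
  by apply: measurable_funM => //; exact: (measurableT_comp (@measurable_ln R)).
move=> x; have /andP[h1 h2] := hM x.
rewrite normrM; apply: ler_pM => //; first by rewrite ger0_norm ?(ltW (h0 x)).
have M0 := lt_le_trans (h0 x) h2.
by apply: normr_between; rewrite !ler_ln ?posrE ?h1.
Qed.

Let integrable_fisher : leb.-integrable setT (EFin \o (fun x => dotv (H x) (H x) / h x * w x)).
Proof.
apply: (@bounded_mul_integrable _ _ _ _ _ (fun x => dotv (H x) (H x) / h x)
  (B / delta)) => //.
  by apply: measurable_funM => //; exact: measurable_funV.
move=> x; have /andP[h1 h2] := hM x.
rewrite ger0_norm; last by rewrite divr_ge0 ?dotv_ge0// ltW.
apply: ler_pM; rewrite ?dotv_ge0 ?invr_ge0 ?(ltW (h0 x))//.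
by rewrite lef_pV2 ?posrE.
Qed.

Lemma smooth_integrable :
  [/\ leb.-integrable setT (EFin \o (fun x => h x * w x)),
      leb.-integrable setT (EFin \o (fun x => h x * ln (h x) * w x)) &
      leb.-integrable setT (EFin \o (fun x => dotv (H x) (H x) / h x * w x))].
Proof. by []. Qed.

Lemma Rintegral_entropy_gap (m : R) :
  leb.-integrable setT (EFin \o (fun x => (h x * ln (h x) - h x * ln m - h x + m) * w x)) /\
  \int[leb]_x ((h x * ln (h x) - h x * ln m - h x + m) * w x) =
  \int[leb]_x (h x * ln (h x) * w x) - (ln m + 1) * \int[leb]_x (h x * w x) +
    m * \int[leb]_x w x.
Proof.
have i1 := integrableZl measurableT (- (ln m + 1)) integrable_h.
have i2 := integrableZl measurableT m iw.
have i3 := integrableD measurableT integrable_hlnh i1.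
have e : (fun x => (h x * ln (h x) - h x * ln m - h x + m) * w x) =
   (fun x => h x * ln (h x) * w x + (- (ln m + 1)) * (h x * w x) + m * w x).
  by apply/funext => x; ring.
rewrite e; split.
  by have := integrableD measurableT i3 i2.
rewrite RintegralD// RintegralD// !RintegralZl//.
by rewrite mulNr.
Qed.

End integrability.

(** Both sides are homogeneous of degree one in h, so [lsi_normalized] is applied to h / m, with m
    the mean of h under the normalized q. *)
Lemma lsi_smooth :
  \int[leb]_x (h x * ln (h x) * q x) -
    \int[leb]_x (h x * q x) * ln (\int[leb]_x (h x * q x) / \int[leb]_x q x) <=
  (2 * kappa)^-1 * \int[leb]_x (dotv (H x) (H x) / h x * q x).
Proof.
have [ih ihl ifi] := smooth_integrable iq.
have Z0 : 0 < \int[leb]_x q x by apply: positive_integral_gt0 => // x; rewrite expR_gt0.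
have A0 : 0 < \int[leb]_x (h x * q x).
  by apply: positive_integral_gt0 => // x; rewrite mulr_gt0 ?expR_gt0.
set A := \int[leb]_x (h x * q x) in A0 *.
set Z := \int[leb]_x q x in Z0 *; set m := A / Z.
have m0 : 0 < m by rewrite divr_gt0.
have m'0 : 0 < m^-1 by rewrite invr_gt0.
have := @lsi_normalized R n V kappa c C kappa0 c0 mV VC cvxV
  (fun x => m^-1 * h x) (fun x => m^-1 *: H x) (m^-1 * delta) (m^-1 * M)
  (m^-1 * (m^-1 * B)) (m^-1 * K).
have -> : \int[leb]_x (m^-1 * h x * expR (- V x)) = Z.
  under eq_Rintegral do rewrite -mulrA.
  by rewrite RintegralZl// -/A /m; field; rewrite !gt_eqF.
have -> : \int[leb]_x (m^-1 * h x * ln (m^-1 * h x) * expR (- V x)) =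
   m^-1 * (\int[leb]_x (h x * ln (h x) * q x) - A * ln m).
  under eq_Rintegral => x _.
    rewrite lnM ?posrE// lnV ?posrE// (_ : _ * expR _ = m^-1 * (h x * ln (h x) * q x) +
      (- (m^-1 * ln m)) * (h x * q x)); last by rewrite /q; ring.
    over.
  rewrite RintegralD//; last 2 first.
  - by have := integrableZl measurableT m^-1 ihl.
  - by have := integrableZl measurableT (- (m^-1 * ln m)) ih.
  by rewrite !RintegralZl// -/A; ring.
have -> : \int[leb]_x (dotv (m^-1 *: H x) (m^-1 *: H x) / (m^-1 * h x) * expR (- V x)) =
   m^-1 * \int[leb]_x (dotv (H x) (H x) / h x * q x).
  rewrite -RintegralZl//; apply: eq_Rintegral => x _.
  by rewrite dotvZl dotvZr /q; field; rewrite !gt_eqF.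
move=> lsi; rewrite -(ler_pM2l m'0) [leRHS]mulrCA; apply: lsi => //.
- exact: mulr_gt0.
- by rewrite mulr_ge0// ltW.
- exact: measurable_funM.
- under eq_fun do rewrite dotvZl dotvZr.
  by do 2 apply: measurable_funM => //.
- by move=> x; have /andP[h1 h2] := hM x; rewrite !ler_pM2l ?h1.
- by move=> x; rewrite dotvZl dotvZr !ler_pM2l.
- move=> x y; rewrite dotvZl; have := descent x y => /(ler_wpM2l (ltW m'0)).
  by rewrite !mulrDr !mulrA.
Qed.

(** The entropy under p is at most the integral against p of the Bregman gap at any level m, here
    the q-mean. That gap is nonnegative, unlike h ln h, so p <= b q may be used under the integral,
    and for this m the q-integral is the entropy for q. The Fisher information is compared the other
    way through a q <= p. *)
Lemma holley_stroock :
  \int[leb]_x (h x * ln (h x) * p x) -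
    \int[leb]_x (h x * p x) * ln (\int[leb]_x (h x * p x)) <=
  b / a * (2 * kappa)^-1 * \int[leb]_x (dotv (H x) (H x) / h x * p x).
Proof.
have [ihq ihlq ifiq] := smooth_integrable iq.
have [ihp ihlp ifip] := smooth_integrable ip.
have p0 x : 0 < p x.
  by case/andP: (pab x) => + _; apply: lt_le_trans; rewrite mulr_gt0 ?expR_gt0.
have b0 : 0 < b.
  have /andP[h1 h2] := pab 0; have := lt_le_trans (p0 0) h2.
  by rewrite pmulr_lgt0 ?expR_gt0.
have Z0 : 0 < \int[leb]_x q x by apply: positive_integral_gt0 => // x; rewrite expR_gt0.
have Aq0 : 0 < \int[leb]_x (h x * q x).
  by apply: positive_integral_gt0 => // x; rewrite mulr_gt0 ?expR_gt0.
have A0 : 0 < \int[leb]_x (h x * p x).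
  by apply: positive_integral_gt0 => // x; rewrite mulr_gt0.
have := lsi_smooth.
set Aq := \int[leb]_x (h x * q x) in Aq0 *; set Z := \int[leb]_x q x in Z0 *.
set A := \int[leb]_x (h x * p x) in A0 *.
set m := Aq / Z; have m0 : 0 < m by rewrite divr_gt0.
move=> lsi.
have [gq gqE] := Rintegral_entropy_gap iq m.
have [gp gpE] := Rintegral_entropy_gap ip m.
have gap := entropy_gap_ge0 m0 A0.
have s1 : \int[leb]_x ((h x * ln (h x) - h x * ln m - h x + m) * p x) <=
    b * \int[leb]_x ((h x * ln (h x) - h x * ln m - h x + m) * q x).
  rewrite -RintegralZl//; apply: le_Rintegral => //.
    by have := integrableZl measurableT b gq.
  move=> x _; rewrite mulrCA; apply: ler_wpM2l; first exact: entropy_gap_ge0.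
  by case/andP: (pab x).
have s2 : a * \int[leb]_x (dotv (H x) (H x) / h x * q x) <=
    \int[leb]_x (dotv (H x) (H x) / h x * p x).
  rewrite -RintegralZl//; apply: le_Rintegral => //.
    by have := integrableZl measurableT a ifiq.
  move=> x _; rewrite mulrCA; apply: ler_wpM2l; first by rewrite divr_ge0 ?dotv_ge0 ?ltW.
  by case/andP: (pab x).
rewrite gqE gpE -/A -/Aq -/Z p1 in s1.
set E := \int[leb]_x (h x * ln (h x) * p x) in s1 *.
apply: (@le_trans _ _ (b * ((2 * kappa)^-1 * \int[leb]_x (dotv (H x) (H x) / h x * q x)))).
  apply: (@le_trans _ _ (E - (ln m + 1) * A + m * 1)); first by move: gap; lra.
  apply: (le_trans s1); apply: ler_wpM2l; first exact: ltW.
  apply: le_trans lsi; rewrite le_eqVlt; apply/orP; left; apply/eqP.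
  by rewrite -/m /m; field; rewrite gt_eqF.
have -> : b / a * (2 * kappa)^-1 = b * (2 * kappa)^-1 * a^-1 by ring.
rewrite mulrA -[leRHS]mulrA; apply: ler_wpM2l.
  by rewrite mulr_ge0 ?invr_ge0 ?mulr_ge0// ltW.
by rewrite mulrC ler_pdivlMr// mulrC.
Qed.

End holley_stroock.

(** * Open sets are measurable for the product sigma-algebra *)

Section continuous_measurable_rV.
Variables (R : realType) (n : nat).

Definition rV_box (x : 'rV[R]_n) (e : R) : set 'rV[R]_n :=
  [set y | forall i, `|x ord0 i - y ord0 i| < e].

Lemma measurable_rV_box x e : measurable (rV_box x e).
Proof.
rewrite (_ : rV_box x e = \bigcap_(i in [set: 'I_n]) (rV_coor i @^-1` ball (x ord0 i) e)).
  apply: fin_bigcap_measurable; first exact: finite_finset.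
  move=> i _; rewrite -[X in measurable X]setTI.
  by apply: measurable_rV_coor => //; exact: measurable_ball.
by apply/seteqP; split => y h i => [_|]; have := h i; [|move=> /(_ I)].
Qed.

Lemma rV_box_ball x e : 0 < e -> rV_box x e = ball x e.
Proof.
move=> e0; apply/seteqP; split => y; rewrite /ball /=.
  by move=> h; split => // i j; rewrite (ord1 i); exact: h.
by move=> [_ h] i; exact: h.
Qed.

(** An open set is the union of the boxes with rational centre and radius 1/(m+1) that it contains;
    the pairs (centre, m) are enumerated through [pickle]. *)
Lemma open_measurable_rV (U : set 'rV[R]_n) : open U -> measurable U.
Proof.
move=> oU.
pose bx (v : 'rV[rat]_n) (m : nat) := rV_box (map_mx (@ratr R) v) m.+1%:R^-1.
pose A (k : nat) := if unpickle k is Some (v, m) then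
   (if `[< bx v m `<=` U >] then bx v m else set0) else set0.
rewrite (_ : U = \bigcup_k A k).
  apply: bigcup_measurable => k _; rewrite /A.
  case: unpickle => [[v m]|]; last exact: measurable0.
  by case: ifP => _; [exact: measurable_rV_box|exact: measurable0].
apply/seteqP; split => [x Ux|x [k _]]; last first.
  by rewrite /A; case: unpickle => [[v m]|//]; case: asboolP => // + bxx; apply.
have /nbhs_ballP[e /= e0 xeU] : nbhs x U by exact: open_nbhs_nbhs.
have e20 : 0 < e / 2 by rewrite divr_gt0.
have [m hm] : exists m : nat, m.+1%:R^-1 < e / 2.
  have [m _ hm] := near_infty_natSinv_lt (PosNum e20).
  by exists m; apply: (hm m) => /=.
have m0 : 0 < m.+1%:R^-1 :> R by rewrite invr_gt0.
have /choice[v hv] : forall i : 'I_n, exists v : rat, `|ratr v - x ord0 i| < m.+1%:R^-1 :> R.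
  move=> i; have [|w] := @rat_in_itvoo R (x ord0 i - m.+1%:R^-1) (x ord0 i + m.+1%:R^-1).
    by rewrite ltrD2l (lt_trans _ m0)// oppr_lt0.
  by rewrite in_itv/= => /andP[h1 h2]; exists w; rewrite ltr_distl h1.
exists (pickle (\row_i v i, m)) => //; rewrite /A pickleK.
case: asboolP => [_|].
  by move=> i; rewrite !mxE; exact: hv.
case=> y hy; apply: xeU; rewrite -rV_box_ball// => i.
rewrite -(subrK (ratr (v i)) (x ord0 i)) -addrA; apply: le_lt_trans (ler_normD _ _) _.
rewrite [e]splitr ltrD//; first by rewrite distrC (lt_trans (hv i)).
by have := hy i; rewrite !mxE => /lt_trans; apply.
Qed.

Lemma continuous_measurable_rV (f : 'rV[R]_n -> R) :
  continuous f -> measurable_fun setT f.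
Proof.
move=> cf; apply: (measurability _ (RGenOpens.measurableE R)).
move=> _ [_ [a [b ->] <-]]; rewrite setTI; apply: open_measurable_rV.
by apply: open_comp => //; exact: interval_open.
Qed.

End continuous_measurable_rV.

(* Young's inequality is the tangent-line inequality of the convex power. *)
Lemma powR_tangent (R : realType) (r x y : R) : 0 < r -> 0 <= x -> 0 <= y ->
  (r + 1) * y `^ r * (x - y) <= x `^ (r + 1) - y `^ (r + 1).
Proof.
move=> r0 x0 y0.
have r10 : 0 < r + 1 by rewrite addr_gt0.
have := @conjugate_powR R x (y `^ r) (r + 1) ((r + 1) / r) x0 (powR_ge0 _ _) r10.
rewrite divr_gt0// => /(_ isT).
have -> : (r + 1)^-1 + ((r + 1) / r)^-1 = 1 by field; rewrite !gt_eqF.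
move=> /(_ erefl); rewrite -powRrM.
have -> : r * ((r + 1) / r) = r + 1 by field; rewrite gt_eqF.
move=> h; have := ler_wpM2l (ltW r10) h.
have -> : (r + 1) * (x `^ (r + 1) / (r + 1) + y `^ (r + 1) / ((r + 1) / r)) =
  x `^ (r + 1) + r * y `^ (r + 1) by field; rewrite !gt_eqF.
have -> : y `^ (r + 1) = y * y `^ r.
  have [->|yn0] := eqVneq y 0; first by rewrite mul0r powR0// gt_eqF.
  by rewrite powRD ?powRr1 1?mulrC//; apply/implyP => _.
by move=> {}h; rewrite mulrBr [leLHS](_ : _ = (r + 1) * (x * y `^ r) - (r + 1) * (y * y `^ r)); [lra|ring].
Qed.

(** * The modified radial potential and its distance to the original one *)

Section convex_radial.
Variables (R : realType) (L a r eta : R).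
Hypotheses (L0 : 0 < L) (a0 : 0 < a) (ar : a < r) (eta0 : 0 < eta).

Let r0 : 0 < r. Proof. exact: lt_trans ar. Qed.
Let er0 : 0 < eta * (r + 1). Proof. by rewrite mulr_gt0// addr_gt0. Qed.

(** This is where a < r is used. The left side is half of what [gradient_monotone] requires from a
    pair of points, so that two such bounds add up. The constant depends on L, a, r and eta only,
    the source of the independence of the dimension. *)
Lemma radial_threshold : exists2 K, 0 < K & forall q, 0 <= q ->
  L * (1 / 2 + q `^ a) + 1 / 2 <= Num.max K (eta * (r + 1) * q `^ r).
Proof.
have one_powR p : 1 = 1 `^ p :> R by rewrite powR1.
have ra0 : 0 < r - a by rewrite subr_gt0.
(* For q >= Q >= 1 one has q^(r-a) >= T, hence eta (r+1) q^r >= q^a (3L/2 + 1/2), and q^a >= 1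
   leaves L q^a + L/2 + 1/2. *)
pose T := (3 / 2 * L + 1 / 2) / (eta * (r + 1)).
pose Q := (Num.max 1 T) `^ (r - a)^-1.
have Q1 : 1 <= Q.
  rewrite /Q [leLHS](one_powR (r - a)^-1); apply: ge0_ler_powR.
  - by rewrite invr_ge0 ltW.
  - by rewrite nnegrE.
  - by rewrite nnegrE le_max ler01.
  - by rewrite le_max lexx.
exists (L * (1 / 2 + Q `^ a) + 1 / 2).
  by rewrite addr_gt0// mulr_gt0// ltr_pwDl// powR_ge0.
move=> q q0; rewrite le_max; have [qQ|Qq] := leP q Q.
  apply/orP; left; rewrite lerD2r ler_pM2l// lerD2l.
  by apply: ge0_ler_powR; rewrite ?nnegrE// ltW// (lt_le_trans _ Q1).
apply/orP; right.
have q1 : 1 <= q by rewrite (le_trans Q1)// ltW.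
have qa1 : 1 <= q `^ a by rewrite [leLHS](one_powR a); apply: ge0_ler_powR; rewrite ?nnegrE ?(ltW a0).
have qra : T <= q `^ (r - a).
  apply: (@le_trans _ _ (Num.max 1 T)); first by rewrite le_max lexx orbT.
  have -> : Num.max 1 T = Q `^ (r - a).
    by rewrite /Q -powRrM mulVf ?gt_eqF// powRr1// le_max ler01.
  by apply: ge0_ler_powR; rewrite ?nnegrE ?(ltW ra0)// ?(ltW Qq)// (le_trans _ Q1).
have -> : q `^ r = q `^ a * q `^ (r - a).
  by rewrite -powRD ?subrKC//; apply/implyP => _; rewrite gt_eqF// (lt_le_trans _ q1).
have h1 : 3 / 2 * L + 1 / 2 <= eta * (r + 1) * q `^ (r - a).
  have := ler_wpM2l (ltW er0) qra; apply: le_trans.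
  by rewrite le_eqVlt /T; apply/orP; left; apply/eqP; field; rewrite !gt_eqF// addr_gt0.
have h2 := ler_wpM2l (le_trans ler01 qa1) h1.
rewrite mulrCA; apply: le_trans h2.
have h3 : L / 2 + 1 / 2 <= q `^ a * (L / 2 + 1 / 2).
  by rewrite ler_peMl// addr_ge0// ltW// divr_gt0.
by move: h3; lra.
Qed.

End convex_radial.

Section derive_tangent.
Variable R : realType.

(** The two supporting lines, at x and at x + h, squeeze the difference quotient between G(x) and
    G(x + h). *)
Lemma is_derive_tangent (F G : R -> R) (x : R) :
  (forall x y, G y * (x - y) <= F x - F y) -> {for x, continuous G} ->
  is_derive x 1 F (G x).
Proof.
move=> FG cG.
suff h : h^-1 *: (F (h *: (1 : R) + x) - F x) @[h --> 0^'] --> G x.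
  apply: DeriveDef; first by apply/cvg_ex; exists (G x).
  exact/cvg_lim.
apply/cvgrPdist_lt => e e0.
have cGs : G (h + x) @[h --> (0 : R)] --> G x.
  have : (h + x) @[h --> (0 : R)] --> x.
    by rewrite -[X in _ --> X]add0r; apply: cvgD; [exact: cvg_id|exact: cvg_cst].
  by move=> /cvg_comp; apply; exact: cG.
have [eps /= eps0 he] : \forall h \near (0 : R), `|G x - G (h + x)| < e.
  by move/cvgrPdist_lt : cGs => /(_ e e0).
exists eps => //= h hh h0; apply: le_lt_trans (he h hh).
have hn : 0 < `|h| by rewrite normr_gt0.
rewrite -(ler_pM2r hn) -!normrM mulrBl.
have -> : h^-1 *: (F (h *: (1 : R) + x) - F x) * h = F (h + x) - F x.
  by rewrite /GRing.scale /= mulr1 mulrAC mulVf ?mul1r// -normr_gt0.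
have h1 := FG (h + x) x; have h2 := FG x (h + x).
rewrite addrK in h1.
have e2 : x - (h + x) = - h by ring.
rewrite e2 in h2.
rewrite [leRHS]normrM -normrM mulrBl !ler0_norm; lra.
Qed.

End derive_tangent.

Section radial_primitive.
Variables (R : realType) (K r eta : R).
Hypotheses (K0 : 0 < K) (r0 : 0 < r) (eta0 : 0 < eta).

Let q1 := (K / (eta * (r + 1))) `^ r^-1.

Let er0 : 0 < eta * (r + 1). Proof. by rewrite mulr_gt0// addr_gt0. Qed.

Let q10 : 0 < q1. Proof. by apply: powR_gt0; rewrite divr_gt0. Qed.

Let q1E : eta * (r + 1) * q1 `^ r = K.
Proof.
rewrite /q1 -powRrM mulVf ?gt_eqF// powRr1 ?divr_ge0 ?ltW//.
by field; rewrite !gt_eqF// addr_gt0.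
Qed.

(* [radial_slope] is nondecreasing, constant near the origin and equal to the
   derivative of [eta * q `^ (r + 1)] far from it; its primitive [radial]
   differs from [eta * q `^ (r + 1)] by a bounded amount. *)
Definition radial_slope (q : R) : R := eta * (r + 1) * (Num.max q q1) `^ r.

Definition radial (q : R) : R :=
  eta * (Num.max q q1) `^ (r + 1) + K * Num.min q q1 - eta * q1 `^ (r + 1).

Lemma radial_slope_ge (q : R) : 0 <= q ->
  Num.max K (eta * (r + 1) * q `^ r) <= radial_slope q.
Proof.
move=> q0; rewrite ge_max /radial_slope -{1}q1E !ler_pM2l//.
by apply/andP; split; apply: ge0_ler_powR;
  rewrite ?(ltW r0)// ?nnegrE ?le_max ?lexx ?orbT ?q0 ?(ltW q10)//.
Qed.

Lemma radial_slope_nd (x y : R) : x <= y -> radial_slope x <= radial_slope y.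
Proof.
move=> xy; rewrite /radial_slope ler_pM2l//; apply: ge0_ler_powR.
- exact: ltW.
- by rewrite nnegrE le_max (ltW q10) orbT.
- by rewrite nnegrE le_max (ltW q10) orbT.
- by rewrite ge_max !le_max xy lexx orbT.
Qed.

(** Convexity of [radial], stated through supporting lines. The tangent inequality of the power is
    glued to the linear piece of slope K; they fit because eta (r+1) q1^r = K. *)
Lemma radial_tangent (x y : R) : radial_slope y * (x - y) <= radial x - radial y.
Proof.
have [X0 Y0] : 0 <= Num.max x q1 /\ 0 <= Num.max y q1.
  by rewrite !le_max (ltW q10) !orbT.
have := powR_tangent r0 X0 Y0 => /(ler_wpM2l (ltW eta0)).
rewrite /radial /radial_slope.
have [yq|qy] := leP y q1; have [xq|qx] := leP x q1.
- by rewrite q1E; lra.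
- move=> h; have e1 : eta * ((r + 1) * q1 `^ r * (x - q1)) = K * (x - q1).
    by rewrite -q1E; ring.
  by rewrite q1E; move: h; rewrite e1; lra.
- have h2 : K <= eta * (r + 1) * y `^ r.
    by rewrite -q1E ler_pM2l//; apply: ge0_ler_powR;
      rewrite ?(ltW r0)// ?nnegrE ?(ltW q10) ?(ltW qy)// (ltW (lt_trans q10 qy)).
  have := ler_wpM2r (_ : 0 <= q1 - x) h2; rewrite subr_ge0 => /(_ xq) {}h2 h1.
  have e1 : eta * ((r + 1) * y `^ r * (q1 - y)) = eta * (r + 1) * y `^ r * (q1 - y).
    by ring.
  rewrite e1 in h1; move: h1 h2; set z := eta * (r + 1) * y `^ r; lra.
- set z := y `^ r; move=> h.
  have e1 : eta * ((r + 1) * z * (x - y)) = eta * (r + 1) * z * (x - y) by ring.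
  by move: h; rewrite e1; lra.
Qed.

(** Supporting lines with continuous slopes give the derivative everywhere, including the junction
    [q1]. *)
Lemma is_derive_radial (q : R) : is_derive q 1 radial (radial_slope q).
Proof.
apply: is_derive_tangent; first exact: radial_tangent.
rewrite /radial_slope; apply: continuousM; first exact: cvg_cst.
have cm : {for q, continuous (fun q : R => Num.max q q1)}.
  by apply: continuous_max; [exact: cvg_id|exact: cvg_cst].
have m0 : 0 < Num.max q q1 by rewrite lt_max q10 orbT.
have cl : {for q, continuous (fun q : R => r * ln (Num.max q q1))}.
  apply: continuousM; first exact: cvg_cst.
  exact: (cvg_comp _ _ cm (continuous_ln m0)).
have ce := cvg_comp _ _ cl (@continuous_expR R _).
have e z : (Num.max z q1) `^ r = expR (r * ln (Num.max z q1)).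
  by rewrite /powR gt_eqF// lt_max q10 orbT.
rewrite (_ : (fun _ => _) = (fun z : R => expR (r * ln (Num.max z q1)))); first exact: ce.
exact/funext.
Qed.

(** With m = min(q, q1) the difference is K m - eta m^(r+1). It is nonnegative since the slope of
    eta q^(r+1) on [0, m] does not exceed K, and it is at most K q1. *)
Lemma radial_bounds (q : R) : 0 <= q ->
  0 <= radial q - eta * q `^ (r + 1) <= K * q1.
Proof.
move=> q0.
have -> : radial q - eta * q `^ (r + 1) =
    K * Num.min q q1 - eta * (Num.min q q1) `^ (r + 1).
  by rewrite /radial; case: leP => _; ring.
set m := Num.min q q1.
have m0 : 0 <= m by rewrite le_min q0 ltW.
have mq : m <= q1 by rewrite ge_min lexx orbT.
have Pm0 : 0 <= eta * m `^ (r + 1) by rewrite mulr_ge0 ?powR_ge0 ?ltW.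
apply/andP; split; last first.
  by have := ler_wpM2l (ltW K0) mq; move: Pm0; lra.
have h : eta * (r + 1) * m `^ r <= K.
  by rewrite -q1E ler_pM2l//; apply: ge0_ler_powR; rewrite ?(ltW r0) ?nnegrE// ltW.
have h2 := ler_wpM2r m0 h.
have := powR_tangent r0 (lexx 0) m0; rewrite powR0 ?gt_eqF ?addr_gt0//.
move=> /(ler_wpM2l (ltW eta0)).
have -> : eta * ((r + 1) * m `^ r * (0 - m)) = - (eta * (r + 1) * m `^ r * m) by ring.
by move: h2; lra.
Qed.

End radial_primitive.

(** * Derivatives along lines and strong convexity of the modified potential *)

Section line_derivative.
Variables (R : realType) (n : nat).
Implicit Types (x y d : 'rV[R]_n).

Lemma cauchy_schwarz x y : dotv x y <= enorm x * enorm y.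
Proof.
have e0 (u : 'rV[R]_n) : 0 <= enorm u by exact: sqrtr_ge0.
have [xy0|xy0] := leP (dotv x y) 0; first by rewrite (le_trans xy0)// mulr_ge0.
rewrite -(@ler_pXn2r _ 2) ?nnegrE ?mulr_ge0 ?(ltW xy0)//.
rewrite exprMn /enorm !sqr_sqrtr ?dotv_ge0//.
have := dotv_ge0 y; rewrite le_eqVlt => /predU1P[y0|y0].
  exfalso; move: xy0; have -> : dotv x y = 0; last by rewrite ltxx.
  apply: big1 => i _; suff -> : y ord0 i = 0 by rewrite mulr0.
  have /allP : all (fun i => (true ==> (y ord0 i * y ord0 i == 0))) (index_enum 'I_n).
    rewrite -psumr_eq0; first by rewrite -[X in X == 0]/(dotv y y) -y0.
    by move=> j _; rewrite -expr2 sqr_ge0.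
  by move=> /(_ i); rewrite mem_index_enum /= => /(_ isT); rewrite -expr2 sqrf_eq0 => /eqP.
have := dotv_ge0 (dotv y y *: x - dotv x y *: y).
rewrite dotvBl !dotvBr !dotvZl !dotvZr [dotv y x]dotvC => h.
rewrite -(ler_pM2l y0) -subr_ge0; apply: le_trans h _.
by rewrite le_eqVlt; apply/orP; left; apply/eqP; ring.
Qed.

Lemma is_derive_line (f : 'rV[R]_n -> R) y d (t : R) :
  differentiable f (y + t *: d) ->
  is_derive t 1 (fun t => f (y + t *: d)) (dotv (grad f (y + t *: d)) d).
Proof.
set z := y + t *: d => df.
have -> : dotv (grad f z) d = 'D_d f z.
  rewrite deriveE// {2}(row_sum_delta d) linear_sum /=; apply: eq_bigr => i _.
  by rewrite linearZ /= mxE /partial deriveE// mulrC.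
have e : (fun h : R => h^-1 *: (f (y + (h *: (1 : R) + t) *: d) - f (y + t *: d))) =
    (fun h : R => h^-1 *: (f (h *: d + z) - f z)).
  apply/funext => h; rewrite /z; congr (_ *: (f _ - _)).
  have -> : h *: (1 : R) = h by rewrite /GRing.scale /= mulr1.
  by rewrite scalerDl addrCA.
have df' : derivable f z d by exact: diff_derivable.
apply: DeriveDef; first by rewrite /derivable e.
by rewrite /derive e.
Qed.

Lemma is_derive_line_dotv y d (t : R) :
  is_derive t 1 (fun t => dotv (y + t *: d) (y + t *: d)) (2 * dotv (y + t *: d) d).
Proof.
have -> : (fun t : R => dotv (y + t *: d) (y + t *: d)) =
    (fun t : R => dotv y y + 2 * dotv y d * t + dotv d d * t ^+ 2).
  apply/funext => s; rewrite !dotvDl !dotvDr !dotvZl !dotvZr [dotv d y]dotvC; ring.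
apply: is_derive_eq; rewrite /GRing.scale /= dotvDl dotvZl; ring.
Qed.

End line_derivative.

Lemma enorm_powR (R : realType) n (x : 'rV[R]_n) (l : R) :
  enorm x `^ l = dotv x x `^ (l / 2).
Proof.
by rewrite /enorm -powR12_sqrt ?dotv_ge0// -powRrM [l / 2]mulrC.
Qed.

Lemma convex_of_nondecreasing_derivative (R : realType) (f df : R -> R) (t : R) :
  (forall x : R, is_derive x 1 f (df x)) -> {homo df : x y / x <= y} ->
  0 < t -> t < 1 -> f t <= t * f 1 + (1 - t) * f 0.
Proof.
move=> fdf ndf t0 t1.
have cf : continuous f by move=> x; apply/differentiable_continuous/derivable1_diffP; case: (fdf x).
have [c1] := MVT t0 (fun x _ => fdf x) (continuous_subspaceT cf).
rewrite in_itv/= => /andP[_ c1t]; rewrite subr0 => h1.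
have [c2] := MVT t1 (fun x _ => fdf x) (continuous_subspaceT cf).
rewrite in_itv/= => /andP[tc2 _] h2.
have h := ndf _ _ (ltW (lt_trans c1t tc2)).
have t'0 : 0 <= t * (1 - t) by rewrite mulr_ge0 ?subr_ge0 ?(ltW t0) ?(ltW t1).
have := ler_wpM2l t'0 h.
have -> : t * (1 - t) * df c1 = (1 - t) * (f t - f 0) by rewrite h1; ring.
have -> : t * (1 - t) * df c2 = t * (f 1 - f t) by rewrite h2; ring.
lra.
Qed.

Lemma above_tangent (R : realType) (f df : R -> R) :
  (forall x : R, is_derive x 1 f (df x)) -> {homo df : x y / x <= y} ->
  f 0 + df 0 <= f 1.
Proof.
move=> fdf ndf.
have cf : continuous f by move=> x; apply/differentiable_continuous/derivable1_diffP; case: (fdf x).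
have [c] := MVT ltr01 (fun x _ => fdf x) (continuous_subspaceT cf).
rewrite in_itv/= => /andP[c0 _]; rewrite subr0 mulr1 => h.
by have := ndf _ _ (ltW c0); rewrite -h; lra.
Qed.

Section strong_convexity.
Variables (R : realType) (L l : R) (n : nat) (g : 'rV[R]_n -> R) (F G : R -> R).
Hypothesis L0 : 0 < L.
Hypothesis dg : forall x, differentiable g x.
Hypothesis gL : forall x y : 'rV[R]_n, enorm (grad g x - grad g y) <=
  L * (1 + enorm x `^ l + enorm y `^ l) * enorm (x - y).
Hypothesis dF : forall q : R, is_derive q 1 F (G q).
Hypothesis Gnd : {homo G : x y / x <= y}.
Hypothesis Gge : forall q, 0 <= q -> L * (1 / 2 + q `^ (l / 2)) + 1 / 2 <= G q.

Let W x := F (dotv x x) + g x.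

Definition line_slope (y d : 'rV[R]_n) (t : R) : R :=
  let z := y + t *: d in G (dotv z z) * (2 * dotv z d) + dotv (grad g z) d.

Lemma is_derive_potential y d (t : R) :
  is_derive t 1 (fun t : R => W (y + t *: d)) (line_slope y d t).
Proof.
apply: (@is_deriveD _ _ _ (fun t : R => F (dotv (y + t *: d) (y + t *: d)))
  (fun t : R => g (y + t *: d))).
  exact: (is_derive1_comp (dF _) (is_derive_line_dotv y d t)).
exact: is_derive_line.
Qed.

(** With a = G(|x|^2) and b = G(|y|^2), 2(ax - by).(x - y) = (a + b)|x - y|^2 + (a - b)(|x|^2 -
    |y|^2), whose last term is nonnegative because G is nondecreasing. The lower bound on G gives a
    + b >= L(1 + |x|^l + |y|^l) + 1, which covers the loss due to g and leaves 1. No second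
    derivative of g is involved. *)
Lemma gradient_monotone (x y : 'rV[R]_n) :
  dotv (x - y) (x - y) <=
  2 * dotv (G (dotv x x) *: x - G (dotv y y) *: y) (x - y) +
  dotv (grad g x - grad g y) (x - y).
Proof.
set a := G (dotv x x); set b := G (dotv y y).
have e1 : 2 * dotv (a *: x - b *: y) (x - y) =
    (a + b) * dotv (x - y) (x - y) + (a - b) * (dotv x x - dotv y y).
  rewrite !dotvBl !dotvBr !dotvZl [dotv y x]dotvC; ring.
have h1 : 0 <= (a - b) * (dotv x x - dotv y y).
  have [h|h] := leP (dotv y y) (dotv x x).
    by rewrite mulr_ge0 ?subr_ge0// Gnd.
  by rewrite mulr_le0 ?subr_le0 ?(ltW h)// Gnd// ltW.
have e0 (u : 'rV[R]_n) : 0 <= enorm u by exact: sqrtr_ge0.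
have h2 : - (L * (1 + enorm x `^ l + enorm y `^ l) * dotv (x - y) (x - y)) <=
    dotv (grad g x - grad g y) (x - y).
  rewrite lerNl -dotvNl; apply: le_trans (cauchy_schwarz _ _) _.
  have -> : enorm (- (grad g x - grad g y)) = enorm (grad g x - grad g y).
    by rewrite /enorm dotvNl dotvNr opprK.
  apply: le_trans (ler_wpM2r (e0 _) (gL x y)) _.
  have ee (u : 'rV[R]_n) : enorm u * enorm u = dotv u u.
    by rewrite -expr2 sqr_sqrtr// dotv_ge0.
  by rewrite -[leLHS]mulrA ee.
have ha := Gge (dotv_ge0 x); have hb := Gge (dotv_ge0 y).
rewrite -/a in ha; rewrite -/b in hb; rewrite !enorm_powR in h2.
have h3 : L * (1 + dotv x x `^ (l / 2) + dotv y y `^ (l / 2)) + 1 <= a + b.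
  by move: ha hb; lra.
have := ler_wpM2r (dotv_ge0 (x - y)) h3.
rewrite e1 mulrDl mul1r; move: h1 h2; lra.
Qed.

Lemma line_slope_monotone y d : {homo (fun t : R => line_slope y d t - t * dotv d d) : s t / s <= t}.
Proof.
move=> s t; rewrite le_eqVlt => /predU1P[->//|st].
have st0 : 0 < t - s by rewrite subr_gt0.
have := gradient_monotone (y + t *: d) (y + s *: d).
have -> : y + t *: d - (y + s *: d) = (t - s) *: d.
  by rewrite opprD addrACA subrr add0r scalerBl.
rewrite !dotvZr dotvZl [2 * _]mulrCA -mulrDr ler_pM2l//.
rewrite !dotvBl !dotvZl /line_slope; lra.
Qed.

Let is_derive_slope y d (t : R) :
  is_derive t 1 (fun t : R => W (y + t *: d) - t ^+ 2 / 2 * dotv d d)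
    (line_slope y d t - t * dotv d d).
Proof.
apply: is_deriveB; first exact: is_derive_potential.
by apply: is_derive_eq; rewrite /GRing.scale /=; field.
Qed.

(** On the line from y to x, subtracting t^2/2 |x - y|^2 reduces strong convexity with constant 1 to
    convexity, which follows from the monotone slope. *)
Lemma strong_convexity t s x y : 0 < t -> 0 < s -> t + s = 1 ->
  W (t *: x + s *: y) <= t * W x + s * W y - 1 / 2 * (t * s) * dotv (x - y) (x - y).
Proof.
move=> t0 s0 ts; have t1 : t < 1 by rewrite -ts ltrDl.
have := convex_of_nondecreasing_derivative (is_derive_slope y (x - y))
  (line_slope_monotone y (x - y)) t0 t1.
have -> : y + t *: (x - y) = t *: x + s *: y.
  have -> : s = 1 - t by rewrite -ts addrC addKr.
  by rewrite scalerBr scalerBl scale1r addrCA.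
have -> : y + 1 *: (x - y) = x by rewrite scale1r subrKC.
rewrite scale0r addr0; have -> : s = 1 - t by rewrite -ts addrC addKr.
by rewrite expr1n expr0n /=; lra.
Qed.

(** Serves to dominate exp(- beta W) by a Gaussian, as Prekopa-Leindler and integrability
    require. *)
Lemma quadratic_lower_bound x :
  W 0 + dotv (grad g 0) x + 1 / 2 * dotv x x <= W x.
Proof.
have := above_tangent (is_derive_slope 0 x) (line_slope_monotone 0 x).
rewrite /line_slope scale0r scale1r !add0r expr1n expr0n /=.
have -> : dotv 0 x = 0 by rewrite -(scale0r x) dotvZl mul0r.
lra.
Qed.

End strong_convexity.

(** * Smooth functions of one variable and a smooth bump *)

Section smooth1.
Variable R : realType.
Implicit Types (f g : R -> R) (k : nat).

Fixpoint C1d k f : Prop :=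
  if k is j.+1 then (forall x, derivable f x 1) /\ C1d j (derive1 f) else continuous f.

Lemma C1d_eq k f g : f =1 g -> C1d k f -> C1d k g.
Proof. by move=> /funext ->. Qed.

Lemma C1dW k f : C1d k.+1 f -> C1d k f.
Proof.
elim: k f => [|k IH] f [df].
  by move=> _ x; apply/differentiable_continuous/derivable1_diffP.
by move=> h; split => //; exact: IH.
Qed.

Lemma C1d_continuous k f : C1d k f -> continuous f.
Proof. by elim: k => // k IH /C1dW /IH. Qed.

Lemma C1d_S k f df : (forall x : R, is_derive x 1 f (df x)) -> C1d k df -> C1d k.+1 f.
Proof.
move=> h cf; split; first by move=> x; case: (h x).
by apply: C1d_eq cf => x; rewrite derive1E; case: (h x).
Qed.

Lemma C1d_is_derive k f (x : R) : C1d k.+1 f -> is_derive x 1 f ((derive1 f) x).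
Proof. by case=> df _; rewrite derive1E; exact/derivableP. Qed.

Lemma C1dD k f g : C1d k f -> C1d k g -> C1d k (fun x => f x + g x).
Proof.
elim: k f g => [|k IH] f g; first by move=> cf cg x; apply: continuousD; [exact: cf|exact: cg].
move=> cf cg; apply: (@C1d_S _ _ (fun x => (derive1 f) x + (derive1 g) x)).
  by move=> x; apply: is_deriveD; [exact: (C1d_is_derive x cf)|exact: (C1d_is_derive x cg)].
by apply: IH; [case: cf|case: cg].
Qed.

Lemma C1dM k f g : C1d k f -> C1d k g -> C1d k (fun x => f x * g x).
Proof.
elim: k f g => [|k IH] f g; first by move=> cf cg x; apply: continuousM; [exact: cf|exact: cg].
move=> cf cg; apply: (@C1d_S _ _ (fun x => f x * (derive1 g) x + g x * (derive1 f) x)).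
  by move=> x; apply: is_deriveM; [exact: (C1d_is_derive x cf)|exact: (C1d_is_derive x cg)].
by apply: C1dD; apply: IH; try exact: C1dW; [case: cg|case: cf].
Qed.

Lemma C1d_cst k (c : R) : C1d k (fun=> c).
Proof.
elim: k c => [|k IH] c; first by move=> x; exact: cvg_cst.
by apply: (@C1d_S _ _ (fun=> 0)) => // x; exact: is_derive_cst.
Qed.

Lemma C1d_affine k f (a b : R) : C1d k f -> C1d k (fun x => f (a * x + b)).
Proof.
have da (x : R) : is_derive x 1 (fun x : R => a * x + b) a.
  by apply: is_derive_eq; rewrite /GRing.scale /=; ring.
elim: k f => [|k IH] f cf.
  move=> x; have ca : {for x, continuous (fun x : R => a * x + b)}.
    by apply/differentiable_continuous/derivable1_diffP; case: (da x).
  by apply: (cvg_comp _ _ ca); exact: cf.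
apply: (@C1d_S _ _ (fun x => (derive1 f) (a * x + b) * a)).
  move=> x; exact: (is_derive1_comp (C1d_is_derive _ cf) (da x)).
by apply: C1dM; [apply: IH; case: cf|exact: C1d_cst].
Qed.

(** P(1/u) exp(-1/u), extended by 0. Allowing a polynomial factor makes the class stable under
    differentiation, so smoothness of exp(-1/u) comes from one induction. *)
Definition flat (P : {poly R}) (u : R) : R :=
  if 0 < u then P.[u^-1] * expR (- u^-1) else 0.

Lemma poly_bound (P : {poly R}) : exists2 C, 0 <= C &
  forall w : R, 1 <= w -> `|P.[w]| <= C * w ^+ (size P).
Proof.
exists (\sum_(i < size P) `|P`_i|); first by apply: sumr_ge0.
move=> w w1; rewrite horner_coef mulr_suml; apply: le_trans (ler_norm_sum _ _ _) _.
apply: ler_sum => i _; rewrite normrM ler_wpM2l//.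
rewrite ger0_norm ?exprn_ge0 ?(le_trans ler01 w1)//.
by apply: ler_weXn2l => //; exact/ltnW/ltn_ord.
Qed.

(** With m = size P, exp(1/u) >= u^(-(m+2)) / (m+2)! beats P(1/u) with two powers of u to spare;
    this makes the derivative at 0 vanish. *)
Lemma flat_small (P : {poly R}) : exists2 C, 0 <= C &
  forall u, u <= 1 -> `|flat P u| <= C * u ^+ 2.
Proof.
have [C C0 hC] := poly_bound P; pose m := size P.
exists (C * (m.+2)`!%:R); first by rewrite mulr_ge0.
move=> u u1; rewrite /flat; case: ltP => [u0|_]; last first.
  by rewrite normr0 mulr_ge0 ?sqr_ge0// mulr_ge0.
have w1 : 1 <= u^-1 by rewrite invr_ge1// unitfE gt_eqF.
rewrite normrM [X in _ * X]ger0_norm ?expR_ge0// expRN.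
have h1 := hC _ w1.
have := @expR_ge1Dxn R u^-1 m.+1; rewrite invr_ge0 ltW// => /(_ isT) h2.
have f0 : 0 < (m.+2)`!%:R :> R by rewrite ltr0n fact_gt0.
have wm0 : 0 < u^-1 ^+ m.+2 by rewrite exprn_gt0// invr_gt0.
have h3 : (expR u^-1)^-1 <= (m.+2)`!%:R / u^-1 ^+ m.+2.
  rewrite -[leRHS]invrK invf_div lef_pV2 ?posrE ?expR_gt0 ?divr_gt0//.
  by apply: le_trans h2; rewrite lerDr.
apply: (@le_trans _ _ (C * u^-1 ^+ m * ((m.+2)`!%:R / u^-1 ^+ m.+2))).
  by apply: ler_pM => //; rewrite invr_ge0 expR_ge0.
rewrite le_eqVlt; apply/orP; left; apply/eqP.
rewrite -addn2 exprD; have : u^-1 ^+ m != 0 by rewrite expf_neq0// invr_neq0// gt_eqF.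
by move: (u^-1 ^+ m) => v v0; field; rewrite gt_eqF.
Qed.

Lemma is_derive_flat (P : {poly R}) (u : R) :
  is_derive u 1 (flat P) (flat ('X^2 * (P - P^`())) u).
Proof.
have [u0|u0|<-] := ltgtP 0 u.
- have -> : flat ('X^2 * (P - P^`())) u = (u^-1 ^+ 2 * (P - P^`()).[u^-1]) * expR (- u^-1).
    by rewrite /flat u0 hornerM hornerXn.
  apply: (@near_eq_is_derive R R^o R^o (fun v : R => P.[v^-1] * expR (- v^-1))).
  + near=> v; rewrite /flat; have -> // : 0 < v.
    by near: v; exact: lt_nbhsr.
  + have un0 : u != 0 by rewrite gt_eqF.
    have dV : is_derive u 1 (fun v : R => v^-1) (- (u ^- 2)).
      have := @is_deriveV R id u 1 1 un0 (is_derive_id _ _).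
      by rewrite /GRing.scale /= mulr1.
    have dg : is_derive u^-1 1 (fun w : R => P.[w] * expR (- w))
        (P.[u^-1] * (expR (- u^-1) * -1) + expR (- u^-1) * P^`().[u^-1]).
      by apply: is_deriveM.
    have h := is_derive1_comp dg dV; apply: (is_derive_eq h).
    by rewrite hornerD hornerN -exprVn; ring.
- have -> : flat ('X^2 * (P - P^`())) u = 0 by rewrite /flat ltNge ltW.
  apply: (@near_eq_is_derive R R^o R^o (cst 0)).
  + near=> v; rewrite /flat; have -> // : 0 < v = false.
    by apply/negbTE; rewrite -leNgt ltW//; near: v; exact: lt_nbhsl.
- have -> : flat ('X^2 * (P - P^`())) 0 = 0 by rewrite /flat ltxx.
  have [C C0 hC] := flat_small P.
  suff h : h^-1 *: (flat P (h *: (1 : R) + 0) - flat P 0) @[h --> 0^'] --> (0 : R).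
    apply: DeriveDef; first by apply/cvg_ex; exists 0.
    exact/cvg_lim.
  apply/cvgrPdist_lt => e e0.
  have [d [d0 d1 de]] : exists d, [/\ 0 < d, d <= 1 & d <= e / (C + 1)].
    exists (Num.min 1 (e / (C + 1))); rewrite !ge_min !lexx orbT.
    by rewrite lt_min ltr01 divr_gt0// ltr_pwDr.
  exists d => //= h; rewrite /ball_ /= sub0r normrN => hd hn.
  have h1 := lt_le_trans hd d1; have he := lt_le_trans hd de.
  have -> : h *: (1 : R) + 0 = h by rewrite /GRing.scale /= mulr1 addr0.
  rewrite ?sub0r ?normrN [flat P 0]/flat ltxx subr0 /GRing.scale /= normrM normfV.
  have h0 : 0 < `|h| by rewrite normr_gt0.
  rewrite mulrC ltr_pdivrMr//.
  have := hC h (le_trans (ler_norm _) (ltW h1)) => /le_lt_trans; apply.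
  rewrite -real_normK ?num_real// expr2 mulrA ltr_pM2r//.
  move: he; rewrite ltr_pdivlMr ?ltr_pwDr//; apply: le_lt_trans.
  by rewrite mulrC ler_wpM2l// lerDl.
Unshelve. all: by end_near. Qed.

Lemma C1d_flat k (P : {poly R}) : C1d k (flat P).
Proof.
elim: k P => [|k IH] P; last exact: (C1d_S (is_derive_flat P)).
move=> x; apply/differentiable_continuous/derivable1_diffP.
by case: (is_derive_flat P x).
Qed.

Definition bump_fun (u : R) : R := flat 1 u * flat 1 (1 - u).

Lemma C1d_bump k : C1d k bump_fun.
Proof.
apply: C1dM; first exact: C1d_flat.
apply: (@C1d_eq _ (fun u => flat 1 (-1 * u + 1))); last exact/C1d_affine/C1d_flat.
by move=> u; rewrite mulN1r addrC.
Qed.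

Lemma flat1_ge0 u : 0 <= flat 1 u.
Proof. by rewrite /flat; case: ifP => // _; rewrite hornerC mul1r expR_ge0. Qed.

Lemma flat1_le1 u : flat 1 u <= 1.
Proof.
rewrite /flat; case: ifPn => // u0; rewrite hornerC mul1r -[leRHS]expR0 ler_expR.
by rewrite oppr_le0 invr_ge0 ltW.
Qed.

Lemma bump_ge0 u : 0 <= bump_fun u.
Proof. by rewrite mulr_ge0// flat1_ge0. Qed.

Lemma bump_le1 u : bump_fun u <= 1.
Proof. by rewrite mulr_ile1// ?flat1_ge0// flat1_le1. Qed.

Lemma bump_out u : ~~ (0 < u < 1) -> bump_fun u = 0.
Proof.
rewrite negb_and -!leNgt /bump_fun /flat => /orP[u0|u1].
  by rewrite ltNge u0 mul0r.
by rewrite subr_gt0 [u < 1]ltNge u1 mulr0.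
Qed.

Lemma bump_gt0 u : 0 < u < 1 -> 0 < bump_fun u.
Proof.
move=> /andP[u0 u1]; rewrite /bump_fun /flat u0 subr_gt0 u1.
by rewrite !hornerC !mul1r mulr_gt0 ?expR_gt0.
Qed.

End smooth1.

(** * Affine changes of variable and mollifiers on the line *)

Section change_of_variables.
Variable R : realType.
Local Notation mu := (@lebesgue_measure R).

Lemma ge0_integral_affine (a b : R) (f : measurableTypeR R -> \bar R) :
  0 < a -> measurable_fun setT f -> (forall x, 0 <= f x)%E ->
  (\int[mu]_x f (a * x + b)%R = a^-1%:E * \int[mu]_x f x)%E.
Proof.
move=> a0 mf f0; have ma := @measurable_affine R a b.
have a'0 : 0 <= a^-1 by rewrite invr_ge0 ltW.
rewrite -[LHS]/(\int[mu]_(x in affine a b @^-1` setT) (f \o affine a b) x)%E.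
rewrite -(ge0_integral_pushforward ma mu measurableT)//; last first.
transitivity (\int[mscale (NngNum a'0) mu]_x f x)%E.
  apply: eq_measure_integral => A mA _.
  by rewrite /mscale /= /pushforward lebesgue_measure_affine.
by rewrite ge0_integral_mscale.
Qed.

Lemma ge0_integral_opp (f : measurableTypeR R -> \bar R) :
  measurable_fun setT f -> (forall x, 0 <= f x)%E ->
  (\int[mu]_x f (- x)%R = \int[mu]_x f x)%E.
Proof.
move=> mf f0.
have mo : measurable_fun setT (-%R : measurableTypeR R -> measurableTypeR R).
  exact: oppr_measurable.
rewrite -[LHS]/(\int[mu]_(x in -%R @^-1` setT) (f \o -%R) x)%E.
rewrite -(ge0_integral_pushforward mo mu measurableT)//.
apply: eq_measure_integral => A mA _.
exact: lebesgue_measureN.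
Qed.

End change_of_variables.

Section mollifier.
Variable R : realType.
Local Notation mu := (@lebesgue_measure R).

Definition mollifier (rho : R) (th : R -> R) :=
  [/\ forall k, C1d k th, forall u, 0 <= th u, forall u, rho < `|u| -> th u = 0 &
      (\int[mu]_u (th u)%:E = 1)%E].

Lemma C1d_measurable k (f : R -> R) : C1d k f ->
  measurable_fun [set: measurableTypeR R] f.
Proof. by move=> /C1d_continuous; exact: continuous_measurable_fun. Qed.

Lemma integral_translate_opp (th : R -> R) (a : R) :
  measurable_fun [set: measurableTypeR R] th -> (forall u, 0 <= th u) ->
  (\int[mu]_u (th (a - u))%:E = \int[mu]_u (th u)%:E)%E.
Proof.
move=> mth th0.
have e0 := @ge0_integral_affine R 1 a (fun u => (th u)%:E) ltr01.
have e1 := @ge0_integral_opp R (fun u => (th (a + u))%:E).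
rewrite e1; last 2 first.
- apply/measurable_EFinP; apply: measurableT_comp => //; exact: measurable_funD.
- by move=> x; rewrite lee_fin.
transitivity (\int[mu]_x (th (1 * x + a))%:E)%E.
  by apply: eq_integral => x _; rewrite mul1r addrC.
by rewrite e0 ?invr1 ?mul1e//; exact/measurable_EFinP.
Qed.

Lemma integral_translate (th : R -> R) (a : R) :
  measurable_fun [set: measurableTypeR R] th -> (forall u, 0 <= th u) ->
  (\int[mu]_u (th (u - a))%:E = \int[mu]_u (th u)%:E)%E.
Proof.
move=> mth th0.
transitivity (\int[mu]_x (th (1 * x - a))%:E)%E.
  by apply: eq_integral => x _; rewrite mul1r.
rewrite (@ge0_integral_affine R 1 (- a) (fun u => (th u)%:E)) ?invr1 ?mul1e//.
exact/measurable_EFinP.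
Qed.

Lemma mollifierN rho th : mollifier rho th -> mollifier rho (fun u => th (- u)).
Proof.
case=> cth th0 ths th1; split.
- move=> k; apply: (@C1d_eq _ _ (fun u => th (-1 * u + 0))); last exact: C1d_affine.
  by move=> u; rewrite mulN1r addr0.
- by move=> u; exact: th0.
- by move=> u hu; rewrite ths// normrN.
- by rewrite (@ge0_integral_opp R (fun u => (th u)%:E))//;
    apply/measurable_EFinP; exact: (C1d_measurable (cth 0%N)).
Qed.

Definition bump_mass : R := fine (\int[mu]_u (bump_fun u)%:E)%E.

Lemma measurable_bump : measurable_fun [set: measurableTypeR R] (@bump_fun R).
Proof. exact: (C1d_measurable (C1d_bump R 0)). Qed.

Lemma integrable_bump : mu.-integrable setT (EFin \o @bump_fun R).
Proof.
have h : mu.-integrable setT (EFin \o (\1_`[0, 1]%classic : R -> R)).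
  exact: (@integrable_indic_itv R 0 1 true false).
apply: (le_integrable measurableT _ _ h); first by apply/measurable_EFinP; exact: measurable_bump.
move=> u _; rewrite /= lee_fin !ger0_norm ?bump_ge0// ?indic_ge0//.
rewrite indicE; have [u01|u01] := boolP (0 < (u : R) < 1); last by rewrite bump_out.
rewrite mem_set ?bump_le1//= in_itv/=.
by case/andP: u01 => /ltW -> /ltW ->.
Qed.

Lemma bump_massE : (\int[mu]_u (bump_fun u)%:E = bump_mass%:E)%E.
Proof. by rewrite /bump_mass fineK// integrable_fin_num// integrable_bump. Qed.

Lemma bump_mass_gt0 : 0 < bump_mass.
Proof.
rewrite lt_neqAle eq_sym; apply/andP; split; last first.
  by rewrite fine_ge0// integral_ge0// => u _; rewrite lee_fin bump_ge0.
apply/negP => /eqP m0.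
have : (\int[mu]_u `|(EFin \o @bump_fun R) u| = 0)%E.
  under eq_integral do rewrite gee0_abs ?lee_fin ?bump_ge0//.
  by rewrite bump_massE m0.
have mb : measurable_fun setT (EFin \o @bump_fun R) by apply/measurable_EFinP; exact: measurable_bump.
move=> /(ae_eq_integral_abs mu measurableT mb)[N [mN N0 hN]].
have : (mu `]0%R, 1%R[%classic <= mu N)%E.
  apply: le_measure; rewrite ?inE//.
  move=> u /=; rewrite in_itv/= => u01; apply: hN => /= /(_ I) /= [].
  by apply/eqP; rewrite gt_eqF// bump_gt0.
by rewrite N0 lebesgue_measure_itv/= lte01 oppr0 adde0 lee_fin ler10.
Qed.

Definition scaled_bump (d u : R) : R := bump_fun (d^-1 * u) / (d * bump_mass).

Lemma scaled_bump_mollifier d : 0 < d -> mollifier d (scaled_bump d).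
Proof.
move=> d0; have m0 := bump_mass_gt0.
have dm0 : 0 < (d * bump_mass)^-1 by rewrite invr_gt0 mulr_gt0.
split.
- move=> k; apply: C1dM; last exact: C1d_cst.
  apply: (@C1d_eq _ _ (fun u => bump_fun (d^-1 * u + 0))); last exact/C1d_affine/C1d_bump.
  by move=> u; rewrite addr0.
- by move=> u; rewrite mulr_ge0 ?bump_ge0// ltW.
- move=> u hu; rewrite /scaled_bump bump_out ?mul0r//; apply: contraTN hu => /andP[u0 u1].
  have u0' : 0 < u by move: u0; rewrite pmulr_rgt0// invr_gt0.
  by rewrite gtr0_norm// -leNgt; move: u1; rewrite mulrC ltr_pdivrMr// mul1r => /ltW.
- under eq_integral => u _ do rewrite /scaled_bump EFinM.
  rewrite ge0_integralZr//; last 3 first.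
  + apply/measurable_EFinP; apply: (measurableT_comp (measurable_bump)).
    exact: measurable_funM.
  + by move=> u _; rewrite lee_fin bump_ge0.
  + by rewrite lee_fin ltW.
  rewrite (_ : (\int[mu]_u (bump_fun (d^-1 * u))%:E = \int[mu]_u (bump_fun (d^-1 * u + 0))%:E)%E); last first.
    by apply: eq_integral => u _; rewrite addr0.
  rewrite (@ge0_integral_affine R d^-1 0 (fun u => (bump_fun u)%:E)); last 3 first.
  + by rewrite invr_gt0.
  + apply/measurable_EFinP; exact: measurable_bump.
  + by move=> x; rewrite lee_fin bump_ge0.
  rewrite bump_massE invrK -!EFinM; congr EFin; field.
  by rewrite !gt_eqF.
Qed.

(** A smooth step: 0 for u <= 0, [bump_mass] for u >= 1, nondecreasing in between. *)
Definition bump_prim (u : R) : R := \int[mu]_(t in `]-oo, u]) bump_fun t.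

Lemma is_derive_bump_prim (u : R) : is_derive u 1 bump_prim (bump_fun u).
Proof.
have uu1 : u < u + 1 by rewrite ltrDl.
have ii : mu.-integrable [set` Interval -oo%O (BRight (u + 1))] (EFin \o @bump_fun R).
  by apply: (integrableS measurableT) => //; exact: integrable_bump.
have cc : {for u, continuous (@bump_fun R)} by exact: (C1d_continuous (C1d_bump R 0)).
have [h1 h2] := continuous_FTC1 uu1 ii (ltNyr u) cc.
by apply: DeriveDef => //; rewrite -derive1E.
Qed.

Lemma C1d_bump_prim k : C1d k bump_prim.
Proof. exact/C1dW/(C1d_S is_derive_bump_prim)/C1d_bump. Qed.

Lemma bump_prim_nd : {homo bump_prim : u v / u <= v}.
Proof.
move=> u v uv; rewrite /bump_prim /Rintegral fine_le ?integrable_fin_num//.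
- apply: (integrableS measurableT) => //; exact: integrable_bump.
- apply: (integrableS measurableT) => //; exact: integrable_bump.
- apply: ge0_subset_integral => //.
  + by apply: measurable_funTS; apply/measurable_EFinP; exact: measurable_bump.
  + by move=> x _; rewrite lee_fin bump_ge0.
  + by move=> x /=; rewrite !in_itv/= => /le_trans; apply.
Qed.

Lemma bump_prim_le0 u : u <= 0 -> bump_prim u = 0.
Proof.
move=> u0; rewrite /bump_prim /Rintegral integral0_eq// => t /=; rewrite in_itv/= => tu.
by rewrite bump_out// negb_and -leNgt (le_trans tu u0).
Qed.

Lemma bump_prim_ge1 u : 1 <= u -> bump_prim u = bump_mass.
Proof.
move=> u1; rewrite /bump_prim /bump_mass /Rintegral integral_mkcond; congr fine.
apply: eq_integral => t _; rewrite patchE; case: ifPn => //.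
rewrite notin_setE /= in_itv/= => /negP; rewrite -ltNge => ut.
by rewrite bump_out// negb_and -!leNgt (ltW (le_lt_trans u1 ut)) orbT.
Qed.

Lemma bump_prim_bounds u : 0 <= bump_prim u <= bump_mass.
Proof.
apply/andP; split.
  by apply: Rintegral_ge0 => x _; exact: bump_ge0.
have [u1|u1] := leP u 1; first by rewrite -(bump_prim_ge1 (lexx 1)) bump_prim_nd.
by rewrite bump_prim_ge1// ltW.
Qed.

End mollifier.

Section one_sided.
Variable R : realType.
Local Notation mu := (@lebesgue_measure R).

(** Difference of two smooth steps: it rises on [0, d], is constant on [d, tau] and falls on
    [tau, tau + d]. *)
Definition trapezoid (d tau u : R) : R :=
  bump_prim (d^-1 * u) - bump_prim (d^-1 * (u - tau)).

(* A nonnegative kernel supported in [0, tau + d] that rises only on the much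
   smaller interval [0, d]. *)
Lemma one_sided_kernel (tau d : R) : 0 < d -> d <= tau / 2 ->
  exists th : R -> R, mollifier (tau + d) th /\
    forall u, derive1 th u <= 2 / tau * scaled_bump d u.
Proof.
move=> d0 dt; have t0 : 0 < tau by lra.
have dV0 : 0 < d^-1 by rewrite invr_gt0.
have m0 := bump_mass_gt0 R; set m := bump_mass R in m0.
have cT k : C1d k (trapezoid d tau).
  apply: C1dD.
    apply: (@C1d_eq _ _ (fun u => bump_prim (d^-1 * u + 0))); first by move=> u; rewrite addr0.
    exact/C1d_affine/C1d_bump_prim.
  apply: (@C1d_eq _ _ (fun u => bump_prim (d^-1 * u + (- (d^-1 * tau))) * -1)).
    by move=> u; rewrite mulrN1 mulrBr.
  by apply: C1dM; [exact/C1d_affine/C1d_bump_prim|exact: C1d_cst].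
have dT (u : R) : is_derive u 1 (trapezoid d tau)
    (bump_fun (d^-1 * u) * d^-1 - bump_fun (d^-1 * (u - tau)) * d^-1).
  apply: is_deriveB.
    have h : is_derive u 1 (fun u : R => d^-1 * u) d^-1.
      by apply: is_derive_eq; rewrite /GRing.scale /=; ring.
    exact: (is_derive1_comp (is_derive_bump_prim _) h).
  have h : is_derive u 1 (fun u : R => d^-1 * (u - tau)) d^-1.
    by apply: is_derive_eq; rewrite /GRing.scale /=; ring.
  exact: (is_derive1_comp (is_derive_bump_prim _) h).
have T0 u : 0 <= trapezoid d tau u.
  rewrite subr_ge0; apply: bump_prim_nd.
  by rewrite ler_pM2l// lerBlDr lerDl ltW.
have Tm u : trapezoid d tau u <= m.
  have /andP[_ h1] := bump_prim_bounds (d^-1 * u).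
  have /andP[h2 _] := bump_prim_bounds (d^-1 * (u - tau)).
  by rewrite /trapezoid lerBlDr (le_trans h1)// lerDl.
have Tout u : ~~ (0 <= u <= tau + d) -> trapezoid d tau u = 0.
  rewrite negb_and -!ltNge /trapezoid => /orP[u0|ut].
    rewrite !bump_prim_le0 ?subrr// pmulr_rle0// ?ltW//.
    by rewrite subr_lt0 (lt_trans u0).
  rewrite !bump_prim_ge1 ?subrr//.
    by rewrite mulrC ler_pdivlMr// mul1r lerBrDr addrC ltW.
  by rewrite mulrC ler_pdivlMr// mul1r; move: (ltW ut); lra.
have Tin u : d <= u <= tau -> trapezoid d tau u = m.
  move=> /andP[du ut]; rewrite /trapezoid bump_prim_ge1; last first.
    by rewrite mulrC ler_pdivlMr// mul1r.
  by rewrite bump_prim_le0 ?subr0// pmulr_rle0// subr_le0.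
have mT : measurable_fun [set: measurableTypeR R] (trapezoid d tau).
  exact: (C1d_measurable (cT 0%N)).
have iT : mu.-integrable setT (EFin \o trapezoid d tau).
  have h := integrableZl measurableT m (@integrable_indic_itv R 0 (tau + d) true false).
  apply: (le_integrable measurableT _ _ h); first exact/measurable_EFinP.
  move=> u _; rewrite /= lee_fin !ger0_norm ?mulr_ge0 ?indic_ge0 ?(ltW m0)//.
  rewrite indicE; have [ui|ui] := boolP (0 <= (u : R) <= tau + d).
    by rewrite mem_set ?mulr1//= in_itv.
  by rewrite Tout// mulr_ge0// ltW.
pose M := fine (\int[mu]_u (trapezoid d tau u)%:E)%E.
have ME : (\int[mu]_u (trapezoid d tau u)%:E = M%:E)%E.
  by rewrite /M fineK// integrable_fin_num.
(* The plateau has height m and length tau - d >= tau/2. *)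
have Mge : m * (tau / 2) <= M.
  rewrite -lee_fin -ME.
  apply: (@le_trans _ _ (\int[mu]_u (m%:E * (\1_`[d, tau] u)%:E))%E).
    rewrite ge0_integralZl//; last 2 first.
    - by apply/measurable_EFinP; exact: measurable_indic.
    - by rewrite lee_fin ltW.
    rewrite integral_indic// setIT. rewrite -[X in (_ <= _ * X)%E]/(lebesgue_measure `[d, tau]%classic) lebesgue_measure_itv/= lte_fin.
    have -> : d < tau by lra.
    by rewrite -EFinB -EFinM lee_fin ler_pM2l//; lra.
  apply: ge0_le_integral => //.
  - by move=> u _; rewrite mule_ge0 ?lee_fin// ltW.
  - by apply: measurable_funeM; apply/measurable_EFinP; exact: measurable_indic.
  - exact/measurable_EFinP.
  - move=> u _; rewrite -EFinM lee_fin indicE.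
    have [ui|ui] := boolP (d <= (u : R) <= tau).
      by rewrite mem_set ?mulr1 ?Tin//= in_itv.
    by rewrite memNset ?mulr0//= in_itv/=; exact/negP.
have M0 : 0 < M by apply: lt_le_trans Mge; rewrite mulr_gt0// divr_gt0.
exists (fun u => trapezoid d tau u * M^-1); split.
- split.
  + by move=> k; apply: C1dM => //; exact: C1d_cst.
  + by move=> u; rewrite mulr_ge0// invr_ge0 ltW.
  + move=> u hu; rewrite Tout ?mul0r//; apply: contraTN hu => /andP[u0 ut].
    by rewrite -leNgt ger0_norm.
  + under eq_integral do rewrite EFinM.
    rewrite ge0_integralZr//; last 3 first.
    - exact/measurable_EFinP.
    - by move=> u _; rewrite lee_fin.
    - by rewrite lee_fin invr_ge0 ltW.
    by rewrite ME -EFinM divff// gt_eqF.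
- move=> u.
  have h : is_derive u 1 (fun u => trapezoid d tau u * M^-1)
     ((bump_fun (d^-1 * u) * d^-1 - bump_fun (d^-1 * (u - tau)) * d^-1) * M^-1).
    by apply: is_derive_eq; rewrite /GRing.scale /=; ring.
  rewrite derive1E derive_val.
  (* Only an upper bound on the derivative is wanted, so the falling edge is dropped. *)
  apply: (@le_trans _ _ (bump_fun (d^-1 * u) * d^-1 * M^-1)).
    apply: ler_wpM2r; first by rewrite invr_ge0 ltW.
    by rewrite gerBl mulr_ge0 ?bump_ge0// ltW.
  have -> : 2 / tau * scaled_bump d u = bump_fun (d^-1 * u) * d^-1 * (m * (tau / 2))^-1.
    by rewrite /scaled_bump -/m; field; rewrite !gt_eqF.
  apply: ler_wpM2l; first by rewrite mulr_ge0 ?bump_ge0// ltW.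
  by rewrite lef_pV2 ?posrE// mulr_gt0// divr_gt0.
Qed.

End one_sided.

(** * Product functions and product kernels in dimension n *)

Section product_functions.
Variables (R : realType) (n : nat).
Local Notation mu := (@lebesgue_measure R).
Implicit Types (th : 'I_n -> R -> R) (x : 'rV[R]_n).

Definition prodf th x : R := \prod_i th i (x ord0 i).

(** Differentiating only the j-th factor keeps partial derivatives of products inside the class of
    products. *)
Definition dfactor (j : 'I_n) th (i : 'I_n) : R -> R :=
  if i == j then derive1 (th i) else th i.

Lemma prodfD1 (j : 'I_n) th x :
  prodf th x = th j (x ord0 j) * \prod_(i | i != j) th i (x ord0 i).
Proof. by rewrite /prodf (bigD1 j). Qed.

Lemma prodf_dfactor (j : 'I_n) th x :
  prodf (dfactor j th) x =
  derive1 (th j) (x ord0 j) * \prod_(i | i != j) th i (x ord0 i).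
Proof.
rewrite (prodfD1 j) /dfactor eqxx; congr (_ * _).
by apply: eq_bigr => i /negbTE ->.
Qed.

Lemma partial_prodf (j : 'I_n) th x : derivable (th j) (x ord0 j) 1 ->
  partial j (prodf th) x = prodf (dfactor j th) x.
Proof.
move=> dth; rewrite prodf_dfactor /partial /derive.
set c := \prod_(i | i != j) _.
have e (h : R) : h^-1 *: (prodf th (h *: delta_mx ord0 j + x) - prodf th x) =
   (h^-1 *: (th j (h *: (1 : R) + x ord0 j) - th j (x ord0 j))) * c.
  rewrite !(prodfD1 j) !mxE eqxx /= -scalerAl mulrBl; congr (_ *: (_ * _ - _)).
    by rewrite eqxx.
  by apply: eq_bigr => i ij; rewrite !mxE eqxx /= (negbTE ij) mulr0 add0r.
under eq_fun do rewrite e.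
apply/cvg_lim => //; apply: cvgM; last exact: cvg_cst.
rewrite derive1E; exact: dth.
Qed.

Lemma differentiable_prodf th x : (forall i, derivable (th i) (x ord0 i) 1) ->
  differentiable (prodf th) x.
Proof.
move=> dth; rewrite /prodf.
elim: (index_enum _) => [|i s IH].
  rewrite (_ : (fun x => _) = cst 1); first exact: differentiable_cst.
  by apply/funext => z; rewrite big_nil.
rewrite (_ : (fun x => _) = (fun z => th i (z ord0 i) * \prod_(i <- s) th i (z ord0 i))); last first.
  by apply/funext => z; rewrite big_cons.
apply: differentiableM => //.
apply: (@differentiable_comp _ _ _ _ (fun z : 'rV[R]_n => z ord0 i : R) (th i)).
  exact: differentiable_coord.
by apply/derivable1_diffP; exact: dth.
Qed.

Lemma Ck_prodf k th : (forall i m, C1d m (th i)) -> Ck k (prodf th).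
Proof.
have df th' : (forall i m, C1d m (th' i)) -> forall x, differentiable (prodf th') x.
  by move=> cth x; apply: differentiable_prodf => i; have [+ _] := cth i 1%N; apply.
elim: k th => [|k IH] th cth.
  by move=> x; apply: differentiable_continuous; exact: df.
split; first exact: df.
move=> j; rewrite (_ : partial j (prodf th) = prodf (dfactor j th)).
  apply: IH => i m; rewrite /dfactor; case: ifP => // _.
  by have [_] := cth i m.+1.
apply/funext => x; apply: partial_prodf.
by have [+ _] := cth j 1%N; apply.
Qed.

Lemma measurable_prodf th : (forall i, measurable_fun [set: measurableTypeR R] (th i)) ->
  measurable_fun setT (prodf th).
Proof.
move=> mth; apply: measurable_prod => i _.
apply: (measurableT_comp (mth i)); exact: measurable_rV_coor.
Qed.

Definition closed_box (rho : R) := [set x : 'rV[R]_n | forall i, `|x ord0 i| <= rho].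

Lemma closed_closed_box rho : closed (closed_box rho).
Proof.
rewrite (_ : closed_box rho =
    \bigcap_(i in [set: 'I_n]) [set x : 'rV[R]_n | `|x ord0 i| <= rho]).
  apply: closed_bigI => i _.
  have := @closed_comp _ _ (fun x : 'rV[R]_n => `|x ord0 i : R|) [set y | y <= rho].
  apply; last exact: closed_le.
  move=> x _; apply: continuous_comp; first exact: coord_continuous.
  exact: norm_continuous.
by apply/seteqP; split => [x h i _|x h i]; [exact: h|exact: (h i I)].
Qed.

Lemma compact_closed_box rho : compact (closed_box rho).
Proof.
apply: bounded_closed_compact; last exact: closed_closed_box.
exists (`|rho|); split; first exact: num_real.
move=> M hM x hx /=; rewrite [leLHS]/Num.Def.normr /= mx_normrE; apply/bigmax_leP; split.
  by rewrite (le_trans (normr_ge0 rho))// ltW.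
by move=> [i j] _ /=; rewrite (ord1 i) (le_trans (hx j))// (le_trans (ler_norm rho))// ltW.
Qed.

Lemma compact_support_prodf th (rho : R) :
  (forall i u, rho < `|u| -> th i u = 0) ->
  compact (closure [set x | prodf th x != 0]).
Proof.
move=> hth; apply: (@subclosed_compact _ _ (closed_box rho)).
- exact: closed_closure.
- exact: compact_closed_box.
rewrite [X in _ `<=` X]((closure_id _).1 (@closed_closed_box rho)).
apply: closure_subset => x /= hx i.
by rewrite leNgt; apply: contra_neqN hx => h; rewrite (prodfD1 i) hth ?mul0r.
Qed.

End product_functions.

Lemma integral_prodf (R : realType) n (th : 'I_n -> R -> R) :
  (forall i, measurable_fun [set: measurableTypeR R] (th i)) ->
  (forall i u, 0 <= th i u) ->
  (forall i, \int[@lebesgue_measure R]_u (th i u)%:E = 1)%E ->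
  (\int[lebesgue_rV R n]_x (prodf th x)%:E = 1)%E.
Proof.
elim: n th => [|n IH] th mth th0 th1.
  rewrite integral_dirac//; last by apply/measurable_EFinP; exact: measurable_prodf.
  by rewrite diracT mul1e /prodf big_ord0.
rewrite ge0_integral_rVS; last 2 first.
- by apply/measurable_EFinP; exact: measurable_prodf.
- by move=> x; rewrite lee_fin; apply: prodr_ge0.
have e (u : R) (v : 'rV[R]_n) : prodf th (cons_rV (u : measurableTypeR R, v)) =
    th ord0 u * prodf (fun i => th (lift ord0 i)) v.
  by rewrite /prodf big_ord_recl cons_rV0; congr (_ * _); apply: eq_bigr => i _; rewrite cons_rVS.
under eq_integral => u _.
  under eq_integral => v _ do rewrite e EFinM.
  rewrite ge0_integralZl//; last 3 first.
  - by apply/measurable_EFinP; apply: measurable_prodf.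
  - by move=> v _; rewrite lee_fin; apply: prodr_ge0.
  - by rewrite lee_fin.
  rewrite IH// mule1.
  over.
exact: th1.
Qed.

Section product_kernel.
Variables (R : realType) (n : nat) (rho : R) (th : 'I_n -> R -> R).
Hypothesis hth : forall i, mollifier rho (th i).
Local Notation leb := (lebesgue_rV R n).
Implicit Types (x y : 'rV[R]_n).

Definition kernel_of (th : 'I_n -> R -> R) x y : R := prodf th (y - x).

Let cth i k : C1d k (th i). Proof. by case: (hth i). Qed.
Let mth i : measurable_fun [set: measurableTypeR R] (th i).
Proof. exact: (C1d_measurable (cth i 0%N)). Qed.
Let th0 i u : 0 <= th i u. Proof. by case: (hth i). Qed.

Lemma kernel_ge0 x y : 0 <= kernel_of th x y.
Proof. exact: prodr_ge0. Qed.

Lemma measurable_kernel_of :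
  measurable_fun setT (fun p : 'rV[R]_n * 'rV[R]_n => kernel_of th p.1 p.2).
Proof.
apply: measurable_prod => i _.
apply: (measurableT_comp (mth i)).
rewrite (_ : (fun p : 'rV[R]_n * 'rV[R]_n => _) = (fun p : 'rV[R]_n * 'rV[R]_n => rV_coor i p.2 - rV_coor i p.1)).
  apply: measurable_funB.
    exact: (measurableT_comp (@measurable_rV_coor R n i) measurable_snd).
  exact: (measurableT_comp (@measurable_rV_coor R n i) measurable_fst).
by apply/funext => p; rewrite !mxE.
Qed.

Lemma integral_kernelr x : (\int[leb]_y (kernel_of th x y)%:E = 1)%E.
Proof.
rewrite -[RHS](@integral_prodf R n (fun i u => th i (u - x ord0 i))).
- by apply: eq_integral => y _; congr EFin; apply: eq_bigr => i _; rewrite !mxE.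
- move=> i; apply: (measurableT_comp (mth i)); exact: measurable_funB.
- by move=> i u; exact: th0.
- by move=> i; rewrite integral_translate//; case: (hth i).
Qed.

Lemma integral_kernell y : (\int[leb]_x (kernel_of th x y)%:E = 1)%E.
Proof.
rewrite -[RHS](@integral_prodf R n (fun i u => th i (y ord0 i - u))).
- by apply: eq_integral => x _; congr EFin; apply: eq_bigr => i _; rewrite !mxE.
- move=> i; apply: (measurableT_comp (mth i)); exact: measurable_funB.
- by move=> i u; exact: th0.
- by move=> i; rewrite integral_translate_opp//; case: (hth i).
Qed.

Lemma kernel_support x y : kernel_of th x y != 0 -> forall i, `|y ord0 i - x ord0 i| <= rho.
Proof.
move=> h i; rewrite leNgt; apply: contra_neqN h => h.
rewrite /kernel_of (prodfD1 i) !mxE; case: (hth i) => _ _ -> //.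
by rewrite mul0r.
Qed.

Lemma kernel_prodf x : kernel_of th x = prodf (fun i u => th i (u - x ord0 i)).
Proof. by apply/funext => y; apply: eq_bigr => i _; rewrite !mxE. Qed.

Let cths x i k : C1d k (fun u => th i (u - x ord0 i)).
Proof.
apply: (@C1d_eq _ _ (fun u => th i (1 * u + (- x ord0 i)))); last exact: C1d_affine.
by move=> u; rewrite mul1r.
Qed.

Lemma test_function_kernel x : test_function (kernel_of th x).
Proof.
rewrite kernel_prodf; split; first by move=> k; apply: Ck_prodf => i m; exact: cths.
apply: (@compact_support_prodf _ _ _ (rho + `|x|)) => i u hu.
case: (hth i) => _ _ -> //; move: hu; rewrite -ltrBrDr => /lt_le_trans; apply.
apply: le_trans (lerB_dist _ _); rewrite lerD2l lerN2.
by rewrite [leRHS]/Num.Def.normr /= mx_normrE; apply/bigmax_geP; right; exists (ord0, i).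
Qed.

Lemma partial_kernel j x y :
  partial j (kernel_of th x) y = kernel_of (dfactor j th) x y.
Proof.
rewrite kernel_prodf partial_prodf; last first.
  by have [+ _] := cths x j 1%N; apply.
apply: eq_bigr => i _; rewrite !mxE /dfactor; case: ifP => // _.
have d1 : is_derive (y ord0 i) (1 : R) (fun u : R => u - x ord0 i) 1.
  by apply: is_derive_eq; rewrite subr0.
have d2 := C1d_is_derive (y ord0 i - x ord0 i) (cth i 1%N).
have d3 := @is_derive1_comp R (th i) (fun u : R => u - x ord0 i) (y ord0 i) _ _ d2 d1.
by rewrite derive1E; have := @derive_val _ _ _ _ _ _ _ d3; rewrite mulr1 => <-.
Qed.

End product_kernel.

(** * Averaging operators on integrable functions *)

Section averaging.
Variables (R : realType) (n : nat).
Local Notation leb := (lebesgue_rV R n).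
Implicit Types (q : 'rV[R]_n -> R).

Definition Lone q : Prop := leb.-integrable setT (EFin \o q).

Definition avg (k : 'rV[R]_n -> 'rV[R]_n -> R) q (x : 'rV[R]_n) : R :=
  \int[leb]_y (q y * k x y).

Lemma Lone_measurable q : Lone q -> measurable_fun setT q.
Proof. by move=> iq; apply/measurable_EFinP; exact: measurable_int iq. Qed.

Lemma LoneB q1 q2 : Lone q1 -> Lone q2 -> Lone (fun x => q1 x - q2 x).
Proof. by move=> h1 h2; have := integrableB measurableT h1 h2. Qed.

Lemma LoneD q1 q2 : Lone q1 -> Lone q2 -> Lone (fun x => q1 x + q2 x).
Proof. by move=> h1 h2; have := integrableD measurableT h1 h2. Qed.

Lemma LoneZ (c : R) q : Lone q -> Lone (fun x => c * q x).
Proof. by move=> h; have := integrableZl measurableT c h. Qed.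

Lemma Lone_abs q : Lone q -> Lone (fun x => `|q x|).
Proof. by move=> h; have := integrable_abse h. Qed.

Lemma Lone_le q1 q2 : Lone q2 -> measurable_fun setT q1 ->
  (forall x, `|q1 x| <= `|q2 x|) -> Lone q1.
Proof.
move=> h m1 h12; apply: (le_integrable measurableT _ _ h); first exact/measurable_EFinP.
by move=> x _ /=; rewrite lee_fin.
Qed.

Lemma Lone_bounded q1 q2 (B : R) : Lone q2 -> measurable_fun setT q1 ->
  (forall x, `|q1 x| <= B) -> Lone (fun x => q1 x * q2 x).
Proof. by move=> h m1 h12; exact: (bounded_mul_integrable h m1 h12). Qed.

Lemma Lone_indic (A : set 'rV[R]_n) : measurable A -> (leb A < +oo)%E -> Lone \1_A.
Proof.
move=> mA fA; apply/integrableP; split; first by apply/measurable_EFinP; exact: measurable_indic.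
under eq_integral do rewrite /= ger0_norm ?indic_ge0//.
by rewrite integral_indic// setIT.
Qed.

Section one_kernel.
Variables (k : 'rV[R]_n -> 'rV[R]_n -> R) (Bk : R).
Hypothesis mk : measurable_fun setT (fun p : 'rV[R]_n * 'rV[R]_n => k p.1 p.2).
Hypothesis k0 : forall x y, 0 <= k x y.
Hypothesis kB : forall x y, k x y <= Bk.
Hypothesis k1r : forall x, (\int[leb]_y (k x y)%:E = 1)%E.
Hypothesis k1l : forall y, (\int[leb]_x (k x y)%:E = 1)%E.

Lemma measurable_kernel_section x : measurable_fun setT (k x).
Proof. exact: (measurableT_comp mk (pair1_measurable x)). Qed.

Lemma avg_integrand_Lone q x : Lone q -> Lone (fun y => q y * k x y).
Proof.
move=> iq; have := @Lone_bounded (k x) q Bk iq (measurable_kernel_section x).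
under eq_fun do rewrite mulrC; apply.
by move=> y; rewrite ger0_norm.
Qed.

Lemma avg_product_integrable q : Lone q ->
  (leb \x leb)%E.-integrable setT (fun p => (q p.2 * k p.1 p.2)%:E).
Proof.
move=> iq; have mq := Lone_measurable iq.
have mqk : measurable_fun setT (fun p : 'rV[R]_n * 'rV[R]_n => (q p.2 * k p.1 p.2)%:E).
  apply/measurable_EFinP; apply: measurable_funM => //.
  exact: (measurableT_comp mq measurable_snd).
apply/(integrable21ltyP _ _ mqk).
under eq_integral => y _.
  under eq_integral => x _ do rewrite /= normrM [X in _ * X]ger0_norm// EFinM.
  rewrite ge0_integralZl//; last 2 first.
  - apply/measurable_EFinP; exact: (measurableT_comp mk (pair2_measurable y)).
  - by move=> x _; rewrite lee_fin.
  rewrite k1l mule1.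
  over.
by case/integrableP : iq.
Qed.

Lemma avg_EFin q x : Lone q -> ((avg k q x)%:E = \int[leb]_y (q y * k x y)%:E)%E.
Proof. by move=> iq; rewrite /avg fineK// integrable_fin_num//; exact: avg_integrand_Lone. Qed.

Lemma avg_Lone q : Lone q -> Lone (avg k q).
Proof.
move=> iq; have := integrable_fubini_F (avg_product_integrable iq).
by apply: eq_integrable => // x _; rewrite /fubini_F /= avg_EFin.
Qed.

Lemma avgB q1 q2 x : Lone q1 -> Lone q2 ->
  avg k (fun x => q1 x - q2 x) x = avg k q1 x - avg k q2 x.
Proof.
move=> i1 i2; rewrite /avg -RintegralB//; try exact: avg_integrand_Lone.
by apply: eq_Rintegral => y _; rewrite mulrBl.
Qed.

Lemma avgD q1 q2 x : Lone q1 -> Lone q2 ->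
  avg k (fun x => q1 x + q2 x) x = avg k q1 x + avg k q2 x.
Proof.
move=> i1 i2; rewrite /avg -RintegralD//; try exact: avg_integrand_Lone.
by apply: eq_Rintegral => y _; rewrite mulrDl.
Qed.

Lemma avgZ (c : R) q x : Lone q -> avg k (fun x => c * q x) x = c * avg k q x.
Proof.
move=> i1; rewrite /avg -RintegralZl//; last exact: avg_integrand_Lone.
by apply: eq_Rintegral => y _; rewrite mulrA.
Qed.

Lemma avg_ge0 q x : (forall y, 0 <= q y) -> 0 <= avg k q x.
Proof. by move=> q0; apply: Rintegral_ge0 => y _; rewrite mulr_ge0. Qed.

Lemma avg_le q1 q2 x : Lone q1 -> Lone q2 -> (forall y, q1 y <= q2 y) ->
  avg k q1 x <= avg k q2 x.
Proof.
move=> i1 i2 h; apply: le_Rintegral => //; try exact: avg_integrand_Lone.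
by move=> y _; rewrite ler_wpM2r.
Qed.

Lemma avg_abs q x : Lone q -> `|avg k q x| <= avg k (fun y => `|q y|) x.
Proof.
move=> iq; apply: le_trans (le_normr_Rintegral measurableT (avg_integrand_Lone x iq)) _.
rewrite le_eqVlt; apply/orP; left; apply/eqP; apply: eq_Rintegral => y _.
by rewrite normrM [X in _ * X]ger0_norm.
Qed.

Lemma Rintegral_avg q : Lone q -> \int[leb]_x avg k q x = \int[leb]_x q x.
Proof.
move=> iq; have ip := avg_product_integrable iq.
rewrite /Rintegral; congr fine.
transitivity (\int[leb]_x \int[leb]_y (q y * k x y)%:E)%E.
  by apply: eq_integral => x _; rewrite avg_EFin.
rewrite (Fubini ip); apply: eq_integral => y _ /=.
under eq_integral do rewrite EFinM.
have iky : leb.-integrable setT (EFin \o (fun x => k x y)).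
  apply/integrableP; split.
    apply/measurable_EFinP; exact: (measurableT_comp mk (pair2_measurable y)).
  by under eq_integral do rewrite /= ger0_norm//; rewrite k1l ltry.
by rewrite (integralZl measurableT iky) k1l mule1.
Qed.

(** Since the kernel has mass 1 in [x] for every [y], averaging |q| preserves its integral. *)
Lemma avg_contraction q : Lone q ->
  \int[leb]_x `|avg k q x| <= \int[leb]_x `|q x|.
Proof.
move=> iq; have iq' := Lone_abs iq; rewrite -(Rintegral_avg iq').
apply: le_Rintegral => //.
- exact/Lone_abs/avg_Lone.
- exact: avg_Lone.
- by move=> x _; exact: avg_abs.
Qed.

Lemma avg_le1 (A : set 'rV[R]_n) x : measurable A -> (leb A < +oo)%E ->
  0 <= avg k \1_A x <= 1.
Proof.
move=> mA fA; rewrite avg_ge0//=.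
rewrite -lee_fin avg_EFin; last exact: Lone_indic.
rewrite -(k1r x); apply: ge0_le_integral => //.
- by move=> y _; rewrite lee_fin mulr_ge0.
- apply/measurable_EFinP; apply: measurable_funM; first exact: measurable_indic.
  exact: measurable_kernel_section.
- by apply/measurable_EFinP; exact: measurable_kernel_section.
- by move=> y _; rewrite lee_fin ler_piMl// indic_le1.
Qed.

Lemma avg_eq1 (A : set 'rV[R]_n) x : (forall y, k x y != 0 -> A y) -> avg k \1_A x = 1.
Proof.
move=> h; rewrite /avg /Rintegral -[RHS]/(fine 1%E) -(k1r x); congr fine.
apply: eq_integral => y _; congr EFin; rewrite indicE.
have [->|ky] := eqVneq (k x y) 0; first by rewrite mulr0.
by rewrite mem_set ?mul1r//; exact: h.
Qed.

End one_kernel.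

End averaging.

Section rV_measure_facts.
Variables (R : realType) (n : nat).
Local Notation leb := (lebesgue_rV R n).

Lemma Rintegral_dct (f_ : nat -> 'rV[R]_n -> R) (f g : 'rV[R]_n -> R) :
  Lone g -> (forall m, measurable_fun setT (f_ m)) ->
  measurable_fun setT f -> (forall x, f_ ^~ x @ \oo --> f x) ->
  (forall m x, `|f_ m x| <= g x) ->
  (fun m => \int[leb]_x f_ m x) @ \oo --> \int[leb]_x f x.
Proof.
move=> ig mf_ mf ff fg.
have ffE x : [set: 'rV[R]_n] x -> (f_ m x)%:E @[m --> \oo] --> (f x)%:E.
  by move=> _; apply: cvg_EFin; [exact: nearW|exact: ff].
have [i1 _ h] := @dominated_convergence _ _ R leb setT measurableT
  (fun m x => (f_ m x)%:E) (fun x => (f x)%:E) (fun x => (g x)%:E)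
  (fun m => (measurable_EFinP _ _).2 (mf_ m)) ((measurable_EFinP _ _).2 mf)
  (aeW _ ffE) ig
  (aeW _ (fun x m _ => fg m x)).
apply: fine_cvg; rewrite fineK//; exact: integrable_fin_num.
Qed.

Lemma open_rV_box (x : 'rV[R]_n) (e : R) : open (rV_box x e).
Proof.
have [e0|e0] := ltP 0 e; first by rewrite rV_box_ball//; exact: ball_open.
(* For e <= 0 the box is empty, except in dimension 0, where the condition is vacuous and the box is
   the whole space. *)
case: n x => [|n'] x; last first.
  rewrite (_ : rV_box x e = set0); first exact: open0.
  apply/seteqP; split => y // /(_ ord0) /=.
  by rewrite ltNge (le_trans e0).
rewrite (_ : rV_box x e = setT); first exact: openT.
by apply/seteqP; split => y // _ [].
Qed.

(** A Gaussian is bounded below on the box by exp(-c) and has finite integral. *)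
Lemma rV_box_finite (x : 'rV[R]_n) (e : R) : (leb (rV_box x e) < +oo)%E.
Proof.
have mB := measurable_rV_box x e.
have ig := gaussian_integrable (R := R) n ltr01.
pose c := \sum_i (`|x ord0 i| + `|e|) ^+ 2.
have : (\int[leb]_y ((expR (- c))%:E * (\1_(rV_box x e) y)%:E) < +oo)%E.
  have /integrableP[mg hg] := ig; apply: le_lt_trans hg.
  apply: ge0_le_integral => //.
  - by apply: measurable_funeM; apply/measurable_EFinP; exact: measurable_indic.
  - exact: measurableT_comp.
  - move=> y _; rewrite /= -EFinM lee_fin ger0_norm ?expR_ge0// indicE.
    have [yB|yB] := pselect (rV_box x e y); last by rewrite memNset// mulr0 expR_ge0.
    rewrite mem_set// mulr1 ler_expR mul1r lerN2 /dotv /c; apply: ler_sum => i _.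
    rewrite -expr2 -real_normK ?num_real// ler_pXn2r ?nnegrE ?addr_ge0//.
    have := yB i; rewrite distrC => /ltW /(le_trans (lerB_dist _ _)).
    by rewrite lerBlDl => /le_trans; apply; rewrite lerD2l ler_norm.
rewrite ge0_integralZl//; last first.
  by apply/measurable_EFinP; exact: measurable_indic.
rewrite integral_indic// setIT.
rewrite -[X in (_ * X < _)%E]/(leb (rV_box x e)) [in X in _ -> X]ltey => h; apply/eqP => e1; move: h.
by rewrite e1 gt0_muley ?lte_fin ?expR_gt0// ltxx.
Qed.

Lemma rV_box_cover (x : 'rV[R]_n) :
  \forall m \near \oo, rV_box (0 : 'rV[R]_n) m.+1%:R x.
Proof.
have [m _ hm] := near_infty_natSinv_lt (PosNum (ltr01 : 0 < 1 :> R)).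
near=> N => i; rewrite mxE sub0r normrN.
apply: (@le_lt_trans _ _ `|x|).
  by rewrite [leRHS]/Num.Def.normr /= mx_normrE; apply/bigmax_geP; right; exists (ord0, i).
apply: (@lt_le_trans _ _ N%:R); last by rewrite ler_nat.
by near: N; exact: nbhs_infty_gtr.
Unshelve. all: by end_near. Qed.

(** Open sets form a generating class stable under intersection, as Dynkin's induction asks. *)
Lemma measurable_rV_open : @measurable _ 'rV[R]_n = <<s [set U : set 'rV[R]_n | open U] >>.
Proof.
apply/seteqP; split; last first.
  apply: smallest_sub; first exact: sigma_algebra_measurable.
  exact: open_measurable_rV.
apply: smallest_sub; first exact: smallest_sigma_algebra.
pose T := g_sigma_algebraType [set U : set 'rV[R]_n | open U].
have mc (i : 'I_n) : measurable_fun [set: T] (@rV_coor R n i : T -> R).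
  apply: (measurability _ (RGenOpens.measurableE R)).
  move=> _ [_ [a [b ->] <-]]; rewrite setTI; apply: sub_sigma_algebra => /=.
  have := @open_comp _ _ (fun v : 'rV[R]_n => v ord0 i : R) `]a, b[%classic.
  apply; last exact: interval_open.
  by move=> v _; exact: coord_continuous.
have mc' (i : 'I_n) (B : set (measurableTypeR R)) : measurable B ->
    <<s [set U : set 'rV[R]_n | open U] >> (setT `&` rV_coor i @^-1` B).
  by move=> mB; exact: mc.
case: n {T mc} mc' => [|n'] mc; first by rewrite big_ord0; exact: sub0set.
rewrite -bigcup_mkord_ord; apply: bigcup_sub => i Ii.
by move=> A [B mB <-]; exact: mc.
Qed.

End rV_measure_facts.

Import HBSimple.

(** * Convergence of approximate identities in L^1 *)

Section avg_convergence.
Variables (R : realType) (n : nat).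
Local Notation leb := (lebesgue_rV R n).
Variables (kk : nat -> 'rV[R]_n -> 'rV[R]_n -> R) (Bk rho : nat -> R).
Hypothesis mk : forall m, measurable_fun setT (fun p : 'rV[R]_n * 'rV[R]_n => kk m p.1 p.2).
Hypothesis k0 : forall m x y, 0 <= kk m x y.
Hypothesis kB : forall m x y, kk m x y <= Bk m.
Hypothesis k1r : forall m x, (\int[leb]_y (kk m x y)%:E = 1)%E.
Hypothesis k1l : forall m y, (\int[leb]_x (kk m x y)%:E = 1)%E.
Hypothesis ksupp : forall m x y, kk m x y != 0 -> forall i, `|y ord0 i - x ord0 i| <= rho m.
Hypothesis rho0 : rho @ \oo --> 0.

Let err (q : 'rV[R]_n -> R) m := \int[leb]_x `|avg (kk m) q x - q x|.

Let Lone_err q m : Lone q -> Lone (fun x => `|avg (kk m) q x - q x|).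
Proof. by move=> iq; apply/Lone_abs/LoneB => //; exact: (avg_Lone (mk m) (k0 m) (kB m) (k1l m)). Qed.

Let err_ge0 q m : 0 <= err q m.
Proof. exact: Rintegral_ge0. Qed.

Let err_triangle q1 q2 m : Lone q1 -> Lone q2 ->
  err q1 m <= err q2 m + 2 * \int[leb]_x `|q1 x - q2 x|.
Proof.
move=> i1 i2; have iB := LoneB i1 i2.
have iA := avg_Lone (mk m) (k0 m) (kB m) (k1l m) iB.
apply: (@le_trans _ _ (\int[leb]_x (`|avg (kk m) q2 x - q2 x| +
   (`|avg (kk m) (fun x => q1 x - q2 x) x| + `|q1 x - q2 x|)))).
  apply: le_Rintegral => //; first exact: Lone_err.
    apply: LoneD; first exact: Lone_err.
    by apply: LoneD; exact: Lone_abs.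
  move=> x _; rewrite (avgB (mk m) (k0 m) (kB m))//.
  have -> : avg (kk m) q1 x - q1 x = (avg (kk m) q2 x - q2 x) +
     ((avg (kk m) q1 x - avg (kk m) q2 x) - (q1 x - q2 x)) by ring.
  apply: le_trans (ler_normD _ _) _; rewrite lerD2l.
  exact: ler_normB.
rewrite RintegralD//; last 2 first.
- exact: Lone_err.
- by apply: LoneD; exact: Lone_abs.
rewrite RintegralD//; try exact: Lone_abs.
rewrite lerD2l mulr2n mulrDl mul1r lerD2r.
exact: (avg_contraction (mk m) (k0 m) (kB m) (k1l m)).
Qed.

Let conv q := err q @ \oo --> 0.

(** Averages are L^1 contractions, so replacing q by q' changes the error by at most twice their L^1
    distance. *)
Let conv_closed q : Lone q -> (forall e, 0 < e -> exists q', [/\ Lone q', conv q' &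
  \int[leb]_x `|q x - q' x| <= e]) -> conv q.
Proof.
move=> iq h; apply/cvgrPdist_lt => e e0.
have e30 : 0 < e / 4 by rewrite divr_gt0.
have [q' [iq' cq' hq']] := h _ e30.
have := cq' => /cvgrPdist_lt /(_ _ e30); apply: filterS => m.
rewrite !sub0r !normrN !ger0_norm// => h1.
have := err_triangle m iq iq'; move: h1 hq'; set a := \int[leb]_x _.
lra.
Qed.

Let convB q1 q2 : Lone q1 -> Lone q2 -> conv q1 -> conv q2 -> conv (fun x => q1 x - q2 x).
Proof.
move=> i1 i2 c1 c2.
have c12 : (fun m => err q1 m + err q2 m) @ \oo --> 0 by rewrite -[X in _ --> X]addr0; exact: cvgD.
apply: (squeeze_cvgr _ (cvg_cst 0) c12); near=> m; rewrite err_ge0 /=.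
rewrite /err -RintegralD//; try exact: Lone_err.
apply: le_Rintegral => //; first exact/Lone_err/LoneB.
  by apply: LoneD; exact: Lone_err.
move=> x _; rewrite (avgB (mk m) (k0 m) (kB m))//.
have -> : avg (kk m) q1 x - avg (kk m) q2 x - (q1 x - q2 x) =
   (avg (kk m) q1 x - q1 x) - (avg (kk m) q2 x - q2 x) by ring.
exact: ler_normB.
Unshelve. all: by end_near. Qed.

Let conv0 : conv (fun=> 0).
Proof.
rewrite /conv (_ : err _ = fun=> 0); first exact: cvg_cst.
apply/funext => m; rewrite /err /Rintegral integral0_eq// => x _.
rewrite /avg /Rintegral integral0_eq ?subrr ?normr0// => y _.
by rewrite mul0r.
Qed.

Let Lone0 : Lone (fun _ : 'rV[R]_n => 0 : R).
Proof. exact: integrable0. Qed.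

Let convD q1 q2 : Lone q1 -> Lone q2 -> conv q1 -> conv q2 -> conv (fun x => q1 x + q2 x).
Proof.
move=> i1 i2 c1 c2.
have := convB i1 (LoneB Lone0 i2) c1 (convB Lone0 i2 conv0 c2).
by under eq_fun do rewrite sub0r opprK.
Qed.

Let convZ (c : R) q : Lone q -> conv q -> conv (fun x => c * q x).
Proof.
move=> iq cq; have : (fun m => `|c| * err q m) @ \oo --> `|c| * 0 by apply: cvgM => //; exact: cvg_cst.
rewrite mulr0 /conv => h; rewrite (_ : err _ = (fun m => `|c| * err q m))//; apply/funext => m.
rewrite /err -RintegralZl//; last exact: Lone_err.
by apply: eq_Rintegral => x _; rewrite (avgZ (mk m) (k0 m) (kB m))// -mulrBr normrM.
Qed.

Let conv_lim (q_ : nat -> 'rV[R]_n -> R) q g : Lone g -> (forall j, Lone (q_ j)) -> Lone q ->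
  (forall x, q_ ^~ x @ \oo --> q x) -> (forall j x, `|q_ j x| <= g x) ->
  (forall x, `|q x| <= g x) ->
  (forall j, conv (q_ j)) -> conv q.
Proof.
move=> ig iq_ iq qq qg qg' cq; apply: conv_closed => // e e0.
have h : (fun j => \int[leb]_x `|q x - q_ j x|) @ \oo --> \int[leb]_x (fun=> 0) x.
  apply: (@Rintegral_dct _ _ _ _ (fun x => 2 * g x)).
  - exact: LoneZ.
  - by move=> j; apply: Lone_measurable; apply/Lone_abs/LoneB.
  - exact: measurable_cst.
  - move=> x; have : `|q x - q_ j x| @[j --> \oo] --> `|q x - q x|.
      by apply: cvg_norm; apply: cvgB; [exact: cvg_cst|exact: qq].
    by rewrite subrr normr0.
  - move=> j x; rewrite normr_id mulr2n mulrDl mul1r.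
    by apply: le_trans (ler_normB _ _) _; apply: lerD.
have z : \int[leb]_x (fun=> 0 : R) x = 0 by rewrite /Rintegral integral0_eq.
rewrite z in h.
have [j _ hj] : \forall j \near \oo, \int[leb]_x `|q x - q_ j x| < e.
  by have := h => /cvgrPdist_lt /(_ _ e0); apply: filterS => j;
    rewrite sub0r normrN ger0_norm// Rintegral_ge0.
by exists (q_ j); split => //; apply/ltW/(hj j) => /=.
Qed.

(** At a point of U the kernel is eventually supported in U, so the average of the indicator is
    eventually 1 there; dominated convergence handles U, and conservation of mass the complement. *)
Let conv_open (U : set 'rV[R]_n) : open U -> (leb U < +oo)%E -> conv \1_U.
Proof.
move=> oU fU; have mU := open_measurable_rV oU; have iU := Lone_indic mU fU.
have a01 m x := avg_le1 (mk m) (k0 m) (kB m) (k1r m) x mU fU.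
have iA m := avg_Lone (mk m) (k0 m) (kB m) (k1l m) iU.
have iUA m : Lone (fun x => \1_U x * (1 - avg (kk m) \1_U x)).
  apply: (@Lone_le _ _ _ \1_U) => //.
    apply: measurable_funM; first exact: measurable_indic.
    by apply: measurable_funB => //; exact: Lone_measurable.
  move=> x; rewrite normrM ger0_norm ?indic_ge0// ler_piMr ?indic_ge0//.
  by have /andP[h1 h2] := a01 m x; rewrite ger0_norm ?subr_ge0// gerBl.
(* The average has the same integral as the indicator, so the excess outside U equals the deficit
   inside. *)
have e m : err \1_U m = 2 * \int[leb]_x (\1_U x * (1 - avg (kk m) \1_U x)).
  transitivity (\int[leb]_x (avg (kk m) \1_U x - \1_U x +
     2 * (\1_U x * (1 - avg (kk m) \1_U x)))).
    apply: eq_Rintegral => x _; have /andP[h1 h2] := a01 m x.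
    rewrite indicE; case: (x \in U) => /=.
      by rewrite ler0_norm ?subr_le0//; ring.
    by rewrite subr0 ger0_norm// mul0r mulr0 addr0.
  rewrite RintegralD//; [|exact: LoneB|exact: LoneZ].
  rewrite RintegralB//; last exact: iA.
  have -> := Rintegral_avg (mk m) (k0 m) (kB m) (k1l m) iU.
  by rewrite subrr add0r RintegralZl//; exact: iUA.
have h : (fun m => \int[leb]_x (\1_U x * (1 - avg (kk m) \1_U x))) @ \oo --> \int[leb]_x (fun=> 0) x.
  apply: (@Rintegral_dct _ _ _ _ \1_U) => //.
  - by move=> m; exact: Lone_measurable.
  - move=> x; apply: cvg_near_cst; rewrite indicE.
    have [Ux|nUx] := pselect (U x); last by apply: nearW => m; rewrite memNset// mul0r.
    have /nbhs_ballP[r /= r0 xrU] : nbhs x U by exact: open_nbhs_nbhs.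
    have := rho0 => /cvgrPdist_lt /(_ _ r0); apply: filterS => m; rewrite sub0r normrN => hr.
    rewrite (avg_eq1 (k1r m)) ?subrr ?mulr0// => y ky; apply: xrU.
    rewrite -rV_box_ball// => i; rewrite distrC.
    by rewrite (le_lt_trans (ksupp ky i))// (le_lt_trans (ler_norm _)).
  - move=> m x; rewrite normrM ger0_norm ?indic_ge0// ler_piMr ?indic_ge0//.
    by have /andP[h1 h2] := a01 m x; rewrite ger0_norm ?subr_ge0// gerBl.
rewrite /conv (funext e) -[X in _ --> X](mulr0 2); apply: cvgM; first exact: cvg_cst.
by move: h; rewrite (_ : \int[leb]_x _ = 0)// /Rintegral integral0_eq.
Qed.

Let conv_box (N : nat) (A : set 'rV[R]_n) : measurable A -> conv \1_(A `&` rV_box 0 N.+1%:R).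
Proof.
set D := rV_box 0 _.
have mD : measurable D by exact: measurable_rV_box.
have oD : open D by exact: open_rV_box.
have fD : (leb D < +oo)%E by exact: rV_box_finite.
have LD B : measurable B -> Lone (\1_(B `&` D) : _ -> R).
  move=> mB; apply: Lone_indic; first exact: measurableI.
  by apply: le_lt_trans fD; apply: le_measure; rewrite ?inE//; exact: measurableI.
move=> mA; have : <<s [set U : set 'rV[R]_n | open U] >> A by rewrite -measurable_rV_open.
move: A {mA}; apply: (@dynkin_induction _ 'rV[R]_n).
- exact: measurable_rV_open.
- by move=> A B; exact: openI.
- by rewrite setTI; exact: conv_open.
- move=> U oU; apply: conv_open; first exact: openI.
  apply: le_lt_trans fD; apply: le_measure; rewrite ?inE//.
  by apply: measurableI => //; exact: open_measurable_rV.
- move=> S mS cS; rewrite (_ : \1_(~` S `&` D) = (fun x => \1_(setT `&` D) x - \1_(S `&` D) x)).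
    apply: convB => //; [exact: LD|exact: LD|].
    by rewrite setTI; exact: conv_open.
  apply/funext => x; rewrite !indicE !in_setI in_setC in_setT.
  by case: (x \in S); case: (x \in D) => /=; ring.
move=> F mF tF cF.
pose G j := \bigcup_(i in `I_j) F i.
have mG j : measurable (G j) by apply: bigcup_measurable.
have mbF : measurable (\bigcup_i F i) by apply: bigcup_measurable.
have D1 B x : `|\1_(B `&` D) x : R| <= \1_D x.
  by rewrite ger0_norm ?indic_ge0// !indicE in_setI; case: (x \in B); case: (x \in D).
apply: (@conv_lim (fun j => \1_(G j `&` D)) _ \1_D) => //.
- exact: Lone_indic.
- by move=> j; exact: LD.
- exact: LD.
- move=> x; apply: cvg_near_cst.
  have [[i _ Fix]|nF] := pselect ((\bigcup_i F i) x).
    exists i.+1 => // j /= ij; rewrite !indicE !in_setI; congr (_ && _)%:R.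
    by rewrite !mem_set//; [exists i|exists i].
  apply: nearW => j; rewrite !indicE !in_setI; congr (_ && _)%:R.
  rewrite !memNset// => -[i _ Fix]; apply: nF; by exists i.
- elim=> [|j IH].
    rewrite /G (_ : \bigcup_(i in _) _ = set0) ?set0I; last by rewrite bigcup_mkord big_ord0.
    by rewrite indic0; exact: conv0.
  rewrite (_ : \1_(G j.+1 `&` D) = (fun x => \1_(G j `&` D) x + \1_(F j `&` D) x)).
    by apply: convD => //; exact: LD.
  apply/funext => x; rewrite !indicE !in_setI.
  have -> : (x \in G j.+1) = (x \in G j) || (x \in F j).
    rewrite -in_setU; congr (x \in _); rewrite /G !bigcup_mkord big_ord_recr//.
  have : ~~ ((x \in G j) && (x \in F j)).
    apply/negP => /andP[]; rewrite !inE => -[i /= ij Fix] Fjx.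
    move/trivIsetP : tF => /(_ i j I I); rewrite neq_ltn ij => /(_ isT) FF.
    by have : (F i `&` F j) x by []; rewrite FF.
  by case: (x \in G j); case: (x \in F j); case: (x \in D) => //= _; rewrite ?addr0 ?add0r.
Qed.

Let conv_indic (A : set 'rV[R]_n) : measurable A -> (leb A < +oo)%E -> conv \1_A.
Proof.
move=> mA fA.
have LA N : Lone (\1_(A `&` rV_box 0 N.+1%:R) : _ -> R).
  apply: Lone_indic; first by apply: measurableI => //; exact: measurable_rV_box.
  apply: le_lt_trans fA; apply: le_measure; rewrite ?inE//.
  by apply: measurableI => //; exact: measurable_rV_box.
apply: (@conv_lim (fun N => \1_(A `&` rV_box 0 N.+1%:R)) _ \1_A) => //.
- exact: Lone_indic.
- exact: Lone_indic.
- move=> x; apply: cvg_near_cst.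
  have := rV_box_cover x; apply: filterS => N xN.
  by rewrite !indicE in_setI [x \in rV_box _ _]mem_set// andbT.
- move=> N x; rewrite ger0_norm ?indic_ge0// !indicE in_setI.
  by case: (x \in A); case: (x \in rV_box _ _).
- by move=> x; rewrite ger0_norm ?indic_ge0.
- by move=> N; exact: conv_box.
Qed.

(** Density argument: open sets, then measurable sets inside a box by Dynkin's theorem, sets of
    finite measure, simple functions, and L^1 closure. *)
Lemma avg_cvg q : Lone q -> (fun m => \int[leb]_x `|avg (kk m) q x - q x|) @ \oo --> 0.
Proof.
move=> iq; apply: conv_closed => // e e0.
have [g [ig _ hg]] := approximation_sfun_integrable measurableT iq.
have hg' : (fun j => \int[leb]_x `|q x - g j x|) @ \oo --> 0.
  by apply: fine_cvg; exact: hg.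
have [j _ hj] : \forall j \near \oo, \int[leb]_x `|q x - g j x| < e.
  by have := hg' => /cvgrPdist_lt /(_ _ e0); apply: filterS => j;
    rewrite sub0r normrN ger0_norm// Rintegral_ge0.
exists (g j); split => //; [exact: ig| |by apply/ltW/(hj j) => /=].
pose s := finmap.enum_fset (fset_set (range (g j : 'rV[R]_n -> R))).
pose t (i : nat) := fun x : 'rV[R]_n => s`_i * \1_((g j : 'rV[R]_n -> R) @^-1` [set s`_i]) x.
have ht i : Lone (t i) /\ conv (t i).
  rewrite /t; set r := s`_i; set A := _ @^-1` _.
  have [->|r0] := eqVneq r 0.
    by under eq_fun do rewrite mul0r; split; [exact: Lone0|exact: conv0].
  have mA : measurable A.
    rewrite /A -[X in measurable X]setTI.
    by apply: (Lone_measurable (ig j)) => //; exact: measurable_set1.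
  have fA : (leb A < +oo)%E.
    have r'0 : 0 < `|r| by rewrite normr_gt0.
    have := @le_integral_abse _ _ _ leb setT measurableT (EFin \o g j) _
      (measurable_int _ (ig j)) r'0.
    rewrite setTI => h.
    have fg : (\int[leb]_x `|(EFin \o g j) x| < +oo)%E by case/integrableP: (ig j).
    have : (`|r|%:E * leb A < +oo)%E.
      apply: le_lt_trans fg; apply: le_trans h; apply: lee_wpmul2l; first by rewrite lee_fin.
      apply: le_measure; rewrite ?inE//.
        rewrite -[X in measurable X]setTI; apply: measurable_lee => //.
        by apply: measurableT_comp => //; exact: measurable_int (ig j).
      by move=> x /= ->.
    rewrite [in X in _ -> X]ltey => h'; apply/eqP => e1; move: h'.
    by rewrite e1 gt0_muley ?lte_fin// ltxx.
  have iA := Lone_indic mA fA.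
  by split; [exact: LoneZ|apply: convZ => //; exact: conv_indic].
suff : Lone (fun x => \sum_(i < size s) t i x) /\ conv (fun x => \sum_(i < size s) t i x).
  case=> _; rewrite (_ : (fun x => _) = g j)//; apply/funext => x.
  exact: esym (fimfunEord _ _).
elim: (size s) => [|N [IH1 IH2]].
  by under eq_fun do rewrite big_ord0; split; [exact: Lone0|exact: conv0].
have [h1 h2] := ht N.
by under eq_fun do rewrite big_ord_recr /=; split; [exact: LoneD|exact: convD].
Qed.

Lemma avg_weak_cvg q (phi : 'rV[R]_n -> R) (B : R) : Lone q -> measurable_fun setT phi ->
  (forall x, `|phi x| <= B) ->
  (fun m => \int[leb]_x (phi x * avg (kk m) q x)) @ \oo --> \int[leb]_x (phi x * q x).
Proof.
move=> iq mphi pB; have B0 : 0 <= B by exact: le_trans (pB 0).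
apply/cvgrPdist_lt => e e0.
have e'0 : 0 < e / (B + 1) by rewrite divr_gt0// ltr_pwDr.
have := avg_cvg iq => /cvgrPdist_lt /(_ _ e'0); apply: filterS => m.
have iA := avg_Lone (mk m) (k0 m) (kB m) (k1l m) iq.
rewrite sub0r normrN ger0_norm ?Rintegral_ge0// => h.
rewrite -RintegralB//; try exact: (Lone_bounded _ mphi pB).
have iD : Lone (fun x => phi x * q x - phi x * avg (kk m) q x).
  by apply: LoneB; exact: (Lone_bounded _ mphi pB).
apply: le_lt_trans (le_normr_Rintegral measurableT iD) _.
apply: (@le_lt_trans _ _ (B * \int[leb]_x `|avg (kk m) q x - q x|)).
  rewrite -RintegralZl//; last exact: Lone_err.
  apply: le_Rintegral => //; first exact: Lone_abs.
    exact/LoneZ/Lone_err.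
  by move=> x _; rewrite -mulrBr normrM distrC ler_wpM2r.
move: h; rewrite ltr_pdivlMr ?ltr_pwDr//; apply: le_lt_trans.
by rewrite mulrC ler_wpM2l ?Rintegral_ge0// lerDl.
Qed.

End avg_convergence.

(** * Functions with bounded gradient and quadratic Taylor remainder *)

Section tame.
Variables (R : realType) (n : nat).
Implicit Types (x y : 'rV[R]_n) (f g : 'rV[R]_n -> R).

(* Bounded functions with a bounded Lipschitz derivative [D]; the single
   constant [B] makes the class uniformly stable under products. *)
Record tame f (D : 'rV[R]_n -> 'rV[R]_n) (B : R) : Prop := Tame {
  tame_cst : 0 <= B;
  tame_bound : forall x, `|f x| <= B;
  tame_grad : forall x, dotv (D x) (D x) <= B;
  tame_lip : forall x y, (f y - f x) ^+ 2 <= B * dotv (y - x) (y - x);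
  tame_rem : forall x y,
    `|f y - f x - dotv (D x) (y - x)| <= B * dotv (y - x) (y - x) }.

Lemma tame_le f D (B B' : R) : B <= B' -> tame f D B -> tame f D B'.
Proof.
move=> BB' [h0 h1 h2 h3 h4]; split.
- exact: le_trans BB'.
- by move=> x; exact: le_trans BB'.
- by move=> x; exact: le_trans BB'.
- by move=> x y; apply: le_trans (h3 x y) _; rewrite ler_wpM2r ?dotv_ge0.
- by move=> x y; apply: le_trans (h4 x y) _; rewrite ler_wpM2r ?dotv_ge0.
Qed.

Lemma dotv_delta x (j : 'I_n) : dotv x (delta_mx ord0 j) = x ord0 j.
Proof.
rewrite /dotv (bigD1 j)//= mxE !eqxx mulr1 big1 ?addr0// => i ij.
by rewrite mxE (negbTE ij) andbF mulr0.
Qed.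

Lemma dotvD_sqr_le x y : dotv (x + y) (x + y) <= 2 * dotv x x + 2 * dotv y y.
Proof.
have := dotv_ge0 (x - y).
by rewrite dotvBl !dotvBr dotvDl !dotvDr [dotv y x]dotvC; lra.
Qed.

(** The quadratic remainder forces [D] to be the gradient, so a [D] known only to exist can be
    identified afterwards. *)
Lemma tame_partial f D B (j : 'I_n) x : tame f D B -> partial j f x = D x ord0 j.
Proof.
move=> [B0 _ _ _ rem]; rewrite /partial /derive; apply/cvg_lim => //.
apply/cvgrPdist_lt => e e0.
have d0 : 0 < e / (B + 1) by rewrite divr_gt0// ltr_pwDr.
exists (e / (B + 1)) => //= h; rewrite /ball_ /= sub0r normrN => he hn.
have hp : 0 < `|h| by rewrite normr_gt0.
have := rem x (h *: delta_mx ord0 j + x).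
rewrite addrK !dotvZr dotvZl dotv_delta dotv_delta mxE !eqxx mulr1.
have -> : f (h *: delta_mx ord0 j + x) - f x - h * D x ord0 j =
   - (h * (D x ord0 j - h^-1 *: (f (h *: delta_mx ord0 j + x) - f x))).
  by rewrite /GRing.scale /= mulrBr mulrA mulfV// mul1r opprB.
rewrite normrN normrM -expr2 -real_normK ?num_real// expr2 mulrCA ler_pM2l//.
move=> /le_lt_trans; apply.
move: he; rewrite ltr_pdivlMr ?ltr_pwDr//; apply: le_lt_trans.
by rewrite mulrC ler_wpM2l// lerDl.
Qed.

Lemma tame_cst1 : tame (fun=> 1) (fun=> 0) 1.
Proof.
have z (v : 'rV[R]_n) : dotv 0 v = 0 :> R by rewrite -(scale0r (0 : 'rV[R]_n)) dotvZl mul0r.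
split => //.
- by move=> x; rewrite normr1.
- by move=> x; rewrite z.
- by move=> x y; rewrite subrr expr0n/= mul1r dotv_ge0.
- by move=> x y; rewrite subrr z subrr normr0 mul1r dotv_ge0.
Qed.

(** The constant only has to dominate B^2 (size), 4B^3 (gradient and Lipschitz bounds) and 2B^2 + B
    (remainder). *)
Lemma tameM f g Df Dg (B : R) : tame f Df B -> tame g Dg B ->
  tame (fun x => f x * g x) (fun x => f x *: Dg x + g x *: Df x)
    (B + 3 * B ^+ 2 + 4 * B ^+ 3).
Proof.
move=> [B0 f1 f2 f3 f4] [_ g1 g2 g3 g4].
have B2 : 0 <= B ^+ 2 by rewrite exprn_ge0.
have B3 : 0 <= B ^+ 3 by rewrite exprn_ge0.
have sq (a : R) : `|a| <= B -> a ^+ 2 <= B ^+ 2.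
  by move=> h; rewrite -real_normK ?num_real// ler_pXn2r ?nnegrE.
have cub (a c : R) : `|a| <= B -> 0 <= c -> c <= B -> a ^+ 2 * c <= B ^+ 3.
  by move=> h c0 cB; rewrite (exprSr B 2) ler_pM ?sqr_ge0// sq.
split.
- lra.
- move=> x; apply: (@le_trans _ _ (B ^+ 2)); last lra.
  by rewrite normrM expr2 ler_pM.
- move=> x; apply: le_trans (dotvD_sqr_le _ _) _.
  rewrite !dotvZl !dotvZr !mulrA -[2 * f x * f x]mulrA -[2 * g x * g x]mulrA -!expr2 -!mulrA.
  have h1 := cub _ _ (f1 x) (dotv_ge0 (Dg x)) (g2 x).
  have h2 := cub _ _ (g1 x) (dotv_ge0 (Df x)) (f2 x).
  by move: h1 h2; lra.
- move=> x y; set d := dotv _ _; have d0 : 0 <= d by exact: dotv_ge0.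
  have -> : f y * g y - f x * g x = f y * (g y - g x) + g x * (f y - f x) by ring.
  apply: (@le_trans _ _ (2 * (f y ^+ 2 * (g y - g x) ^+ 2) + 2 * (g x ^+ 2 * (f y - f x) ^+ 2))).
    rewrite -subr_ge0 [leRHS](_ : _ = (f y * (g y - g x) - g x * (f y - f x)) ^+ 2).
      exact: sqr_ge0.
    ring.
  have h1 : f y ^+ 2 * (g y - g x) ^+ 2 <= B ^+ 2 * (B * d).
    by rewrite ler_pM ?sqr_ge0// sq.
  have h2 : g x ^+ 2 * (f y - f x) ^+ 2 <= B ^+ 2 * (B * d).
    by rewrite ler_pM ?sqr_ge0// sq.
  have h3 : 0 <= B * d by rewrite mulr_ge0.
  have h4 : 0 <= B ^+ 2 * d by rewrite mulr_ge0.
  have e1 : B ^+ 2 * (B * d) = B ^+ 3 * d by ring.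
  rewrite e1 in h1 h2.
  by rewrite 2!mulrDl -!mulrA; move: h1 h2 h3 h4; lra.
- move=> x y; set d := dotv (y - x) (y - x); have d0 : 0 <= d by exact: dotv_ge0.
  rewrite dotvDl !dotvZl.
  have -> : f y * g y - f x * g x - (f x * dotv (Dg x) (y - x) + g x * dotv (Df x) (y - x)) =
    g x * (f y - f x - dotv (Df x) (y - x)) + f x * (g y - g x - dotv (Dg x) (y - x))
    + (f y - f x) * (g y - g x) by ring.
  apply: le_trans (ler_normD _ _) _.
  have h1 : `|g x * (f y - f x - dotv (Df x) (y - x))| <= B * (B * d).
    by rewrite normrM ler_pM.
  have h2 : `|f x * (g y - g x - dotv (Dg x) (y - x))| <= B * (B * d).
    by rewrite normrM ler_pM.
  have h3 : `|(f y - f x) * (g y - g x)| <= B * d.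
    have a1 := f3 x y; have a2 := g3 x y; rewrite -/d in a1 a2.
    rewrite normrM; have := sqr_ge0 (`|f y - f x| - `|g y - g x|).
    rewrite sqrrB !real_normK ?num_real// mulr2n.
    move: a1 a2; lra.
  have h4 : 0 <= B ^+ 3 * d by rewrite mulr_ge0.
  have h5 : 0 <= B ^+ 2 * d by rewrite mulr_ge0.
  have e1 : B * (B * d) = B ^+ 2 * d by ring.
  rewrite e1 in h1 h2.
  apply: le_trans (lerD (le_trans (ler_normD _ _) (lerD h1 h2)) h3) _.
  by move: h4 h5; lra.
Qed.

(** The order of quantifiers is the point: B' precedes the functions, so one constant serves all
    translates of a kernel. *)
Lemma tame_prod (B : R) (s : seq 'I_n) : 0 <= B -> exists B', forall (F : 'I_n -> 'rV[R]_n -> R) DF,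
  (forall i, tame (F i) (DF i) B) ->
  exists D, tame (fun x => \prod_(i <- s) F i x) D B'.
Proof.
move=> B0; elim: s => [|j s [B' IH]].
  by exists 1 => F DF _; exists (fun=> 0); under eq_fun do rewrite big_nil; exact: tame_cst1.
pose M := B + `|B'|.
exists (M + 3 * M ^+ 2 + 4 * M ^+ 3) => F DF h.
have [D hD] := IH F DF h.
exists (fun x => F j x *: D x + (\prod_(i <- s) F i x) *: DF j x).
under eq_fun do rewrite big_cons.
apply: tameM.
  by apply: tame_le (h j); rewrite /M lerDl.
by apply: tame_le hD; rewrite /M (le_trans (ler_norm _))// lerDr.
Qed.

Lemma compact_support_bounded (rho : R) (f : R -> R) : continuous f ->
  (forall u, rho < `|u| -> f u = 0) -> exists2 B, 0 <= B & forall u, `|f u| <= B.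
Proof.
move=> cf f0.
have cn : {within `[- `|rho|, `|rho|], continuous (fun u => `|f u|)}.
  apply: continuous_subspaceT => u; apply: (continuous_comp (cf u)); exact: norm_continuous.
have le : - `|rho| <= `|rho| by rewrite (le_trans _ (normr_ge0 rho))// oppr_le0.
have [c _ hc] := EVT_max le cn.
exists `|f c| => // u; have [ur|ur] := leP `|u| `|rho|.
  by apply: hc; rewrite in_itv/= -ler_norml.
by rewrite f0 ?normr0// (le_lt_trans (ler_norm _)).
Qed.

Lemma derive1_support (rho : R) (g : R -> R) : C1d 1 g ->
  (forall u, rho < `|u| -> g u = 0) -> forall u, rho < `|u| -> derive1 g u = 0.
Proof.
move=> cg g0 u hu; rewrite derive1E.
have : is_derive u 1 g (0 : R); last by move=> h; exact: derive_val.
apply: (@near_eq_is_derive R R^o R^o (cst 0)).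
have cu : {for u, continuous (fun u : R => `|u|)} by exact: norm_continuous.
have : \forall v \near u, rho < `|v| by apply: (cvgr_gt _ cu).
by apply: filterS => v hv; rewrite g0.
Qed.

Lemma tame1 (rho : R) (f : R -> R) : C1d 2 f -> (forall u, rho < `|u| -> f u = 0) ->
  exists2 B, 0 <= B & [/\ forall u, `|f u| <= B, forall u, `|derive1 f u| <= B,
    forall u v, `|f v - f u| <= B * `|v - u| &
    forall u v, `|f v - f u - derive1 f u * (v - u)| <= B * (v - u) ^+ 2].
Proof.
move=> cf f0; have c1 : C1d 1 (derive1 f) by case: cf.
have loc := derive1_support (rho := rho).
have f'0 := loc _ (C1dW cf) f0.
have [B1 B10 h1] := compact_support_bounded (C1d_continuous cf) f0.
have [B2 B20 h2] := compact_support_bounded (C1d_continuous c1) f'0.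
have c2 : C1d 0 (derive1 (derive1 f)) by case: c1.
have [B3 B30 h3] := compact_support_bounded (C1d_continuous c2) (loc _ c1 f'0).
have mvt (g : R -> R) (B : R) : C1d 1 g -> (forall u, `|derive1 g u| <= B) ->
    forall u v, exists c, [/\ `|c - u| <= `|v - u|, g v - g u = derive1 g c * (v - u) &
      `|g v - g u| <= B * `|v - u|].
  move=> cg gB u v.
  have key a b : a <= b -> exists c, [/\ a <= c, c <= b & g b - g a = derive1 g c * (b - a)].
    move=> ab; have cw : {within `[a, b], continuous g}.
      exact: (continuous_subspaceT (C1d_continuous cg)).
    have [c] := @MVT_segment R g (derive1 g) a b ab (fun (x : R) _ => C1d_is_derive x cg) cw.
    by rewrite in_itv/= => /andP[h4 h5] h6; exists c.
  have [uv|/ltW vu] := leP u v.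
    have [c [uc cv e]] := key _ _ uv; exists c; split => //.
      by rewrite !ger0_norm ?subr_ge0// lerD2r.
    by rewrite e normrM ler_wpM2r.
  have [c [vc cu e]] := key _ _ vu.
  have e' : g v - g u = derive1 g c * (v - u) by rewrite -opprB e; ring.
  exists c; split => //.
    by rewrite !ler0_norm ?subr_le0// lerN2 lerD2r.
  by rewrite e' normrM ler_wpM2r.
exists (B1 + B2 + B3); first by rewrite !addr_ge0.
have m2 := mvt _ _ (C1dW cf) h2.
split.
- by move=> u; rewrite (le_trans (h1 u))// -addrA lerDl addr_ge0.
- by move=> u; rewrite (le_trans (h2 u))// addrAC lerDr addr_ge0.
- move=> u v; have [_ [_ _ h]] := m2 u v; apply: le_trans h _.
  by rewrite ler_wpM2r// addrAC lerDr addr_ge0.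
- move=> u v; have [c [hc e _]] := m2 u v; rewrite e -mulrBl.
  have [_ [_ _ h]] := mvt _ _ c1 h3 u c.
  rewrite normrM -[(v - u) ^+ 2]real_normK ?num_real// expr2 mulrA ler_wpM2r//.
  apply: le_trans h _; apply: ler_pM => //.
  by rewrite lerDr addr_ge0.
Qed.

Lemma tame_coordinate (rho a : R) (f : R -> R) : C1d 2 f ->
  (forall u, rho < `|u| -> f u = 0) ->
  exists B, forall (i : 'I_n) b,
    tame (fun x => f (a * x ord0 i + b))
      (fun x => (a * derive1 f (a * x ord0 i + b)) *: delta_mx ord0 i) B.
Proof.
move=> cf f0; have [B B0 [h1 h2 h3 h4]] := tame1 cf f0.
have B2 : 0 <= B ^+ 2 by exact: sqr_ge0.
have a2 : 0 <= a ^+ 2 by exact: sqr_ge0.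
have aB1 : 0 <= a ^+ 2 * B by rewrite mulr_ge0.
have aB2 : 0 <= a ^+ 2 * B ^+ 2 by rewrite mulr_ge0.
have sq (c : R) : `|c| <= B -> c ^+ 2 <= B ^+ 2.
  by move=> h; rewrite -real_normK ?num_real// ler_pXn2r ?nnegrE.
exists (B + a ^+ 2 * B + a ^+ 2 * B ^+ 2) => i b.
have di x : x ord0 i ^+ 2 <= dotv x x.
  rewrite /dotv (bigD1 i)//= -expr2 lerDl; apply: sumr_ge0 => j _.
  by rewrite -expr2 sqr_ge0.
have aff x y : (a * y ord0 i + b) - (a * x ord0 i + b) = a * (y - x) ord0 i.
  by rewrite !mxE; ring.
split.
- lra.
- by move=> x; apply: le_trans (h1 _) _; lra.
- move=> x; rewrite dotvZl dotvZr dotv_delta mxE !eqxx mulr1 -expr2 exprMn.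
  have := ler_wpM2l a2 (sq _ (h2 (a * x ord0 i + b))); lra.
- move=> x y; have := h3 (a * x ord0 i + b) (a * y ord0 i + b); rewrite aff => h.
  apply: (@le_trans _ _ ((B * `|a * (y - x) ord0 i|) ^+ 2)).
    by rewrite -real_normK ?num_real// ler_pXn2r ?nnegrE// mulr_ge0.
  rewrite exprMn real_normK ?num_real// exprMn.
  have := ler_wpM2l aB2 (di (y - x)).
  have := mulr_ge0 B0 (dotv_ge0 (y - x)); have := mulr_ge0 aB1 (dotv_ge0 (y - x)).
  have -> : B ^+ 2 * (a ^+ 2 * (y - x) ord0 i ^+ 2) = a ^+ 2 * B ^+ 2 * (y - x) ord0 i ^+ 2 by ring.
  by rewrite 2!mulrDl; lra.
- move=> x y; have := h4 (a * x ord0 i + b) (a * y ord0 i + b); rewrite aff => h.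
  rewrite dotvZl dotvC dotv_delta.
  have -> : a * derive1 f (a * x ord0 i + b) * (y - x) ord0 i =
    derive1 f (a * x ord0 i + b) * (a * (y - x) ord0 i) by ring.
  apply: le_trans h _; rewrite exprMn.
  have := ler_wpM2l aB1 (di (y - x)).
  have := mulr_ge0 B0 (dotv_ge0 (y - x)); have := mulr_ge0 aB2 (dotv_ge0 (y - x)).
  have -> : B * (a ^+ 2 * (y - x) ord0 i ^+ 2) = a ^+ 2 * B * (y - x) ord0 i ^+ 2 by ring.
  by rewrite 2!mulrDl; lra.
Qed.

End tame.

Lemma mollifier_le (R : realType) (rho rho' : R) th : rho <= rho' ->
  mollifier rho th -> mollifier rho' th.
Proof.
move=> h [h1 h2 h3 h4]; split => // u hu; apply: h3; exact: le_lt_trans hu.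
Qed.

Section kernel_regularity.
Variables (R : realType) (n : nat) (rho : R) (th : 'I_n -> R -> R).
Hypothesis hth : forall i, mollifier rho (th i).
Local Notation leb := (lebesgue_rV R n).
Implicit Types (x y : 'rV[R]_n).

Lemma prodf_bounded (t : 'I_n -> R -> R) : (forall i, continuous (t i)) ->
  (forall i u, rho < `|u| -> t i u = 0) ->
  exists B, forall x, `|prodf t x| <= B.
Proof.
move=> ct t0.
have /choice[B hB] : forall i, exists B, forall u, `|t i u| <= B.
  by move=> i; have [B _ h] := compact_support_bounded (ct i) (t0 i); exists B.
exists (\prod_i B i) => x; rewrite /prodf normr_prod.
by apply: ler_prod => i _; rewrite normr_ge0 hB.
Qed.

Let dth i j : (forall k, C1d k (dfactor j th i)) /\
  (forall u, rho < `|u| -> dfactor j th i u = 0).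
Proof.
have [cth _ sth _] := hth i; rewrite /dfactor; case: ifP => _; last by [].
split; first by move=> k; case: (cth k.+1).
exact: derive1_support (cth 1%N) sth.
Qed.

Lemma kernel_bounded : exists B, forall x y, kernel_of th x y <= B.
Proof.
have [B hB] : exists B, forall x, `|prodf th x| <= B.
  apply: prodf_bounded => i; first by case: (hth i) => h _ _ _; exact: (C1d_continuous (h 0%N)).
  by case: (hth i).
by exists B => x y; exact: le_trans (ler_norm _) (hB _).
Qed.

Lemma dkernel_bounded j : exists B, forall x y, `|kernel_of (dfactor j th) x y| <= B.
Proof.
have [B hB] : exists B, forall x, `|prodf (dfactor j th) x| <= B.
  apply: prodf_bounded => i; first by case: (dth i j) => h _; exact: (C1d_continuous (h 0%N)).
  by case: (dth i j).
by exists B => x y; exact: hB.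
Qed.

Lemma dkernel_support j x y : kernel_of (dfactor j th) x y != 0 ->
  forall i, `|y ord0 i - x ord0 i| <= rho.
Proof.
move=> h i; rewrite leNgt; apply: contra_neqN h => h.
rewrite /kernel_of (prodfD1 i) !mxE; case: (dth i j) => _ -> //.
by rewrite mul0r.
Qed.

Lemma measurable_dkernel j x : measurable_fun setT (kernel_of (dfactor j th) x).
Proof.
rewrite (_ : kernel_of _ x = prodf (fun i u => dfactor j th i (u - x ord0 i))).
  apply: measurable_prodf => i.
  have mt : measurable_fun [set: measurableTypeR R] (dfactor j th i).
    by case: (dth i j) => h _; exact: (C1d_measurable (h 0%N)).
  by apply: (measurableT_comp mt); exact: measurable_funB.
by apply/funext => y; apply: eq_bigr => i _; rewrite !mxE.
Qed.

(** Uniformity in y permits integration over y. The kernel depends on y - x, hence the minus sign in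
    the gradient with respect to x. *)
Lemma kernel_tame : exists B, forall y,
  tame (fun x => kernel_of th x y) (fun x => \row_j - kernel_of (dfactor j th) x y) B.
Proof.
have /choice[B hB] : forall i, exists B, forall b,
    tame (fun x : 'rV[R]_n => th i (-1 * x ord0 i + b))
      (fun x => (-1 * derive1 (th i) (-1 * x ord0 i + b)) *: delta_mx ord0 i) B.
  move=> i; have [cth _ sth _] := hth i.
  by have [B h] := tame_coordinate n (-1) (cth 2%N) sth; exists B => b; exact: h.
have B0 i : 0 <= B i by exact: tame_cst (hB i 0).
pose M := \sum_i B i.
have BM i : B i <= M by rewrite /M (bigD1 i)//= lerDl sumr_ge0.
have M0 : 0 <= M by exact: sumr_ge0.
have [B' hB'] := tame_prod (index_enum 'I_n) M0.
exists B' => y.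
have [D hD] := hB' _ _ (fun i => tame_le (BM i) (hB i (y ord0 i))).
have e : (fun x => \prod_i th i (-1 * x ord0 i + y ord0 i)) = kernel_of th ^~ y.
  by apply/funext => x; apply: eq_bigr => i _; rewrite !mxE mulN1r addrC.
rewrite e in hD.
rewrite (_ : (fun x => \row_j _) = D)//; apply/funext => x; apply/rowP => j.
rewrite mxE -(tame_partial j x hD).
have e2 : kernel_of th ^~ y = prodf (fun i u => th i (-1 * u + y ord0 i)).
  by rewrite -e.
have dj (i : 'I_n) (u : R) : is_derive u 1 (fun u : R => th i (-1 * u + y ord0 i))
    (- derive1 (th i) (-1 * u + y ord0 i)).
  have d1 : is_derive u 1 (fun u : R => -1 * u + y ord0 i) (-1).
    by apply: is_derive_eq; rewrite /GRing.scale /=; ring.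
  have [cth _ _ _] := hth i.
  apply: is_derive_eq; first exact: (is_derive1_comp (C1d_is_derive _ (cth 1%N)) d1).
  by rewrite mulrN1.
rewrite e2 partial_prodf; last by case: (dj j (x ord0 j)).
rewrite prodf_dfactor derive1E (@derive_val _ _ _ _ _ _ _ (dj j (x ord0 j))).
rewrite /kernel_of prodf_dfactor !mxE [y ord0 j - _]addrC mulN1r -mulNr.
by congr (_ * _); apply: eq_bigr => i _; rewrite !mxE mulN1r addrC.
Qed.

End kernel_regularity.

(** * Weak gradients tested against kernels *)

Section weak_gradient_kernel.
Variables (R : realType) (n : nat) (f : 'rV[R]_n -> R) (G : 'rV[R]_n -> 'rV[R]_n).
Local Notation leb := (lebesgue_rV R n).
Hypothesis wg : weak_gradient f G.

(** Truncation turns local integrability into integrability, and a kernel whose support lies in the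
    box does not see it. *)
Definition boxed (N : R) (q : 'rV[R]_n -> R) (x : 'rV[R]_n) : R :=
  q x * \1_(rV_box 0 N) x.

Lemma boxed_in N q x : rV_box 0 N x -> boxed N q x = q x.
Proof. by move=> h; rewrite /boxed indicE mem_set// mulr1. Qed.

Lemma boxed_out N q x : ~ rV_box 0 N x -> boxed N q x = 0.
Proof. by move=> h; rewrite /boxed indicE memNset// mulr0. Qed.

(** The kernel at [x] is itself a test function, and both it and its derivative vanish outside the
    box. *)
Lemma weak_gradient_avg (rho N : R) (th : 'I_n -> R -> R) (i : 'I_n) (x : 'rV[R]_n) :
  (forall j, mollifier rho (th j)) ->
  (forall j, `|x ord0 j| + rho < N) ->
  \int[leb]_y (boxed N f y * kernel_of (dfactor i th) x y) =
  - avg (kernel_of th) (boxed N (fun y => G y ord0 i)) x.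
Proof.
move=> hth hN.
have inN (y : 'rV[R]_n) : (forall j, `|y ord0 j - x ord0 j| <= rho) -> rV_box 0 N y.
  move=> h j; rewrite mxE sub0r normrN.
  apply: le_lt_trans (hN j); rewrite -[y ord0 j](subrKC (x ord0 j)).
  by apply: le_trans (ler_normD _ _) _; rewrite lerD2l.
have := wg (test_function_kernel hth x) i.
rewrite /Rintegral /avg /Rintegral => h.
have -> : (\int[leb]_y (boxed N f y * kernel_of (dfactor i th) x y)%:E =
           \int[leb]_y (f y * partial i (kernel_of th x) y)%:E)%E.
  apply: eq_integral => y _; rewrite (partial_kernel hth).
  have [->|k0] := eqVneq (kernel_of (dfactor i th) x y) 0; first by rewrite !mulr0.
  by rewrite boxed_in//; apply: inN; exact: (dkernel_support hth k0).
rewrite h fineN; congr (- fine _); apply: eq_integral => y _.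
have [->|k0] := eqVneq (kernel_of th x y) 0; first by rewrite !mulr0.
by rewrite boxed_in//; apply: inN; exact: (kernel_support hth k0).
Qed.

End weak_gradient_kernel.

Lemma Rintegral_le0_ae (R : realType) n (q : 'rV[R]_n -> R) : Lone q ->
  (forall x, 0 <= q x) -> \int[lebesgue_rV R n]_x q x <= 0 ->
  {ae lebesgue_rV R n, forall x, q x = 0}.
Proof.
move=> iq q0 h.
have mq : measurable_fun setT (EFin \o q) by exact: measurable_int iq.
have h0 : (\int[lebesgue_rV R n]_x `|(q x)%:E| = 0)%E.
  under eq_integral do rewrite gee0_abs ?lee_fin//.
  have /fineK <- : (\int[lebesgue_rV R n]_x (q x)%:E)%E \is a fin_num.
    exact: (integrable_fin_num measurableT iq).
  congr EFin; apply/eqP; rewrite eq_le; apply/andP; split; first exact: h.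
  exact: Rintegral_ge0.
have /(ae_eq_integral_abs _ measurableT mq) := h0.
by apply: filterS => x /(_ I) [].
Qed.

Section kernel_convergence.
Variables (R : realType) (n : nat).
Local Notation leb := (lebesgue_rV R n).

Lemma kernel_weak_cvg (rho : nat -> R) (th : nat -> 'I_n -> R -> R) (q phi : 'rV[R]_n -> R) (B : R) :
  (forall m i, mollifier (rho m) (th m i)) -> rho @ \oo --> 0 -> Lone q ->
  measurable_fun setT phi -> (forall x, `|phi x| <= B) ->
  (fun m => \int[leb]_x (phi x * avg (kernel_of (th m)) q x)) @ \oo -->
    \int[leb]_x (phi x * q x).
Proof.
move=> hth rho0 iq mphi pB.
have /choice[Bk hB] m := kernel_bounded (hth m).
apply: (avg_weak_cvg (Bk := Bk) (rho := rho) _ _ hB _ _ _ rho0 iq mphi pB).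
- by move=> m; exact: measurable_kernel_of (hth m).
- by move=> m x y; exact: kernel_ge0 (hth m) _ _.
- by move=> m x; exact: integral_kernelr (hth m) _.
- by move=> m x; exact: integral_kernell (hth m) _.
- by move=> m x y h j; exact: (kernel_support (hth m) h j).
Qed.

Lemma kernel_avg_Lone rho (th : 'I_n -> R -> R) (q : 'rV[R]_n -> R) :
  (forall i, mollifier rho (th i)) -> Lone q -> Lone (avg (kernel_of th) q).
Proof.
move=> hth iq; have [Bk hB] := kernel_bounded hth.
apply: (@avg_Lone _ _ _ Bk) => //.
- exact: measurable_kernel_of hth.
- by move=> x y; exact: kernel_ge0 hth _ _.
- by move=> x; exact: integral_kernell hth _.
Qed.

End kernel_convergence.

(** * The weak gradient vanishes almost everywhere on the zero set of a nonnegative function *)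

Section gradient_on_zero_set.
Variables (R : realType) (n : nat) (f : 'rV[R]_n -> R) (G : 'rV[R]_n -> 'rV[R]_n).
Local Notation leb := (lebesgue_rV R n).
Hypothesis wg : weak_gradient f G.
Hypothesis f0 : forall x, 0 <= f x.
Hypothesis iF : forall N, Lone (boxed N f).
Variable i : 'I_n.
Hypothesis iG : forall N, Lone (boxed N (fun x => G x ord0 i)).

Let sided (sg d : R) (j : 'I_n) (u : R) : R :=
  scaled_bump d (if j == i then sg * u else u).

Let mollifier_sign (sg rho : R) th : sg = 1 \/ sg = -1 -> mollifier rho th ->
  mollifier rho (fun u => th (sg * u)).
Proof.
move=> [->|->] h; first by under eq_fun do rewrite mul1r.
by under eq_fun do rewrite mulN1r; exact: mollifierN.
Qed.

Let mollifier_sided sg d j : sg = 1 \/ sg = -1 -> 0 < d -> mollifier d (sided sg d j).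
Proof.
rewrite /sided => h d0; case: eqP => _; last exact: scaled_bump_mollifier.
by apply: (mollifier_sign h); exact: scaled_bump_mollifier.
Qed.

(** The i-th factor of J is the one-sided kernel, whose derivative is at most 2/tau times a
    mollifier of the smaller width d. As f >= 0, moving the derivative from G to the kernel gives a
    lower bound by an average of f at scale d alone. *)
Let one_sided_avg (sg tau d N : R) : sg = 1 \/ sg = -1 -> 0 < d -> d <= tau / 2 ->
  exists J : 'I_n -> R -> R, (forall j, mollifier (tau + d) (J j)) /\
    forall x : 'rV[R]_n, (forall j, `|x ord0 j| + (tau + d) < N) ->
    - (2 / tau * avg (kernel_of (sided sg d)) (boxed N f) x) <=
    sg * avg (kernel_of J) (boxed N (fun y => G y ord0 i)) x.
Proof.
move=> hsg d0 dtau; have tau0 : 0 < tau by lra.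
have [th [hth dth]] := one_sided_kernel d0 dtau.
pose J j := if j == i then (fun u : R => th (sg * u)) else scaled_bump d.
have hJ j : mollifier (tau + d) (J j).
  rewrite /J; case: eqP => _; first exact: mollifier_sign.
  by apply: (mollifier_le _ (scaled_bump_mollifier d0)); rewrite lerDr ltW.
have hS j : mollifier d (sided sg d j) by exact: mollifier_sided.
have [Bk hB] := kernel_bounded hS.
exists J; split => // x hx.
have := weak_gradient_avg wg i hJ hx => /(congr1 (fun v => - v)); rewrite opprK => <-.
rewrite mulrN lerN2.
have sg2 : sg * sg = 1 by case: hsg => ->; rewrite ?mulr1// mulrNN mulr1.
have dJ y : sg * kernel_of (dfactor i J) x y <= 2 / tau * kernel_of (sided sg d) x y.
  rewrite /kernel_of prodf_dfactor (prodfD1 i) /sided eqxx mulrA mulrA.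
  rewrite [X in _ * X <= _](_ : _ = \prod_(j | j != i) scaled_bump d ((y - x) ord0 j)); last first.
    by apply: eq_bigr => j /negPf ji; rewrite /J ji.
  rewrite [X in _ <= _ * X](_ : _ = \prod_(j | j != i) scaled_bump d ((y - x) ord0 j)); last first.
    by apply: eq_bigr => j /negPf ->.
  rewrite ler_wpM2r//.
    by apply: prodr_ge0 => j _; case: (scaled_bump_mollifier d0).
  have [cth _ _ _] := hth.
  have d1 (u : R) : is_derive u (1 : R) (fun u : R => sg * u) sg.
    by apply: is_derive_eq; rewrite /GRing.scale /= mulr1.
  set u := (y - x) ord0 i.
  have := is_derive1_comp (C1d_is_derive (sg * u) (cth 1%N)) (d1 u).
  move=> /(@derive_val _ _ _ _ _ _ _) e.
  have -> : derive1 (J i) u = derive1 th (sg * u) * sg.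
    by rewrite [LHS]derive1E -e /J eqxx.
  by rewrite mulrCA sg2 mulr1; exact: dth.
have iJ : Lone (fun y => boxed N f y * kernel_of (dfactor i J) x y).
  have [B hB'] := dkernel_bounded hJ i.
  have := Lone_bounded (iF N) (measurable_dkernel hJ i x) (hB' x).
  by under eq_fun do rewrite mulrC.
have iK : Lone (fun y => boxed N f y * kernel_of (sided sg d) x y).
  have mk : measurable_fun setT (kernel_of (sided sg d) x).
    exact: (measurable_kernel_section (measurable_kernel_of hS)).
  have := @Lone_bounded _ _ (kernel_of (sided sg d) x) _ Bk (iF N) mk.
  under eq_fun do rewrite mulrC; apply => y.
  by rewrite ger0_norm ?hB//; exact: kernel_ge0 hS _ _.
rewrite -RintegralZl// /avg -RintegralZl//.
apply: le_Rintegral => //; [exact: LoneZ|exact: LoneZ|move=> y _].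
have fy : 0 <= boxed N f y by rewrite mulr_ge0 ?f0 ?indicE//.
rewrite mulrCA [leRHS]mulrCA; exact: ler_wpM2l.
Qed.

(** With tau fixed and d tending to 0, the averages of f tested against phi tend to the integral of
    phi f, which is 0 because phi lives on {f = 0}. Then tau tends to 0. *)
Let gradient_sign (sg N : R) (phi : 'rV[R]_n -> R) : sg = 1 \/ sg = -1 ->
  measurable_fun setT phi -> (forall x, 0 <= phi x <= 1) ->
  (forall x, phi x != 0 -> f x = 0 /\ forall j, `|x ord0 j| + 1 < N) ->
  0 <= sg * \int[leb]_x (phi x * boxed N (fun y => G y ord0 i) x).
Proof.
move=> hsg mphi phi01 phiN.
have phi1 x : `|phi x| <= 1 by rewrite ger0_norm; case/andP: (phi01 x).
pose tau m : R := m.+1%:R^-1 / 2.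
have tau0 m : 0 < tau m by rewrite divr_gt0// invr_gt0.
have tauc : tau @ \oo --> 0.
  by rewrite -[X in _ --> X](mul0r 2^-1); apply: cvgMl; exact: cvg_harmonic.
have z0 : \int[leb]_x (phi x * boxed N f x) = 0.
  rewrite -[RHS]/(fine 0%E) -(integral0 leb setT); congr fine.
  apply: eq_integral => x _; congr EFin.
  have [->|/phiN[fx _]] := eqVneq (phi x) 0; first by rewrite mul0r.
  by rewrite /boxed fx mul0r mulr0.
(* The target tau^2 beats the factor 2/tau of [one_sided_avg] and leaves an error 2 tau. *)
have /choice[d hd] m : exists d, [/\ 0 < d, d <= tau m / 2 &
    \int[leb]_x (phi x * avg (kernel_of (sided sg d)) (boxed N f) x) <= tau m ^+ 2].
  pose dd j : R := tau m / 2 * j.+1%:R^-1.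
  have dd0 j : 0 < dd j by rewrite mulr_gt0 ?invr_gt0// divr_gt0.
  have hdd : dd @ \oo --> 0.
    by rewrite -[X in _ --> X](mulr0 (tau m / 2)); apply: cvgMr; exact: cvg_harmonic.
  have := @kernel_weak_cvg _ _ dd (fun j => sided sg (dd j)) _ phi 1
    (fun j k => mollifier_sided k hsg (dd0 j)) hdd (iF N) mphi phi1.
  rewrite z0 => /cvgrPdist_le /(_ (tau m ^+ 2)) /(_ (exprn_gt0 _ (tau0 m))) [j _ hj].
  exists (dd j); split; first exact: dd0.
    by rewrite ler_piMr ?invf_le1 ?ler1n// divr_ge0// ltW.
  have := hj j (leqnn j); rewrite sub0r normrN; apply: le_trans; exact: ler_norm.
have /choice[J hJ] m := one_sided_avg N hsg (let: And3 h _ _ := hd m in h) (let: And3 _ h _ := hd m in h).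
have taud m : tau m + d m <= 1.
  have [_ h _] := hd m; have : tau m <= 2^-1.
    by rewrite /tau ler_pdivrMr// mulVf// invf_le1 ?ler1n.
  by lra.
have c0 : (fun m => tau m + d m) @ \oo --> 0.
  apply: (@squeeze_cvgr _ _ _ _ (fun=> 0) (fun m => 2 * tau m)).
  - apply: nearW => m; have [h1 h2 _] := hd m; have := tau0 m; lra.
  - exact: cvg_cst.
  - by rewrite -[X in _ --> X](mulr0 2); apply: cvgMr.
have L := @kernel_weak_cvg _ _ _ _ _ phi 1 (fun m => (hJ m).1) c0 (iG N) mphi phi1.
have iA m : Lone (avg (kernel_of (J m)) (boxed N (fun y => G y ord0 i))).
  exact: kernel_avg_Lone (hJ m).1 (iG N).
have iS m : Lone (avg (kernel_of (sided sg (d m))) (boxed N f)).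
  have [h _ _] := hd m.
  exact: kernel_avg_Lone (fun j => mollifier_sided j hsg h) (iF N).
have lo m : - (2 * tau m) <= sg * \int[leb]_x (phi x *
    avg (kernel_of (J m)) (boxed N (fun y => G y ord0 i)) x).
  have [h1 h2 h3] := hd m.
  have i1 := Lone_bounded (iA m) mphi phi1; have i2 := Lone_bounded (iS m) mphi phi1.
  apply: (@le_trans _ _ (- (2 / tau m) * \int[leb]_x (phi x *
      avg (kernel_of (sided sg (d m))) (boxed N f) x))).
    rewrite mulNr lerN2; apply: (@le_trans _ _ (2 / tau m * tau m ^+ 2)).
      by rewrite ler_wpM2l// divr_ge0// ltW.
    by rewrite expr2 mulrA -(mulrA 2) mulVf ?mulr1// gt_eqF.
  rewrite -RintegralZl// -RintegralZl//.
  apply: le_Rintegral => //; [exact: LoneZ|exact: LoneZ|move=> x _].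
  rewrite mulrCA [leRHS]mulrCA.
  have [->|/phiN[_ hx]] := eqVneq (phi x) 0; first by rewrite !mul0r.
  apply: ler_wpM2l; first by case/andP: (phi01 x).
  rewrite mulNr; apply: (hJ m).2 => j; apply: le_lt_trans (hx j).
  by rewrite lerD2l.
have L2 : (fun m => sg * \int[leb]_x (phi x *
    avg (kernel_of (J m)) (boxed N (fun y => G y ord0 i)) x)) @ \oo -->
    sg * \int[leb]_x (phi x * boxed N (fun y => G y ord0 i) x) by exact: cvgMr.
have L3 : (fun m => - (2 * tau m)) @ \oo --> (0 : R).
  by rewrite -oppr0 -(mulr0 2); apply: cvgN; apply: cvgMr.
by apply: ler_cvg_to L3 L2 _; exact: nearW.
Qed.

(** Testing with the indicator of {f = 0, sg G_i < 0} in a box shows this set to be null, for either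
    sign [sg]. *)
Lemma weak_gradient_zero : {ae leb, forall x, f x = 0 -> G x ord0 i = 0}.
Proof.
have half (sg : R) : sg = 1 \/ sg = -1 ->
    {ae leb, forall x, f x = 0 -> 0 <= sg * G x ord0 i}.
  move=> hsg.
  suff H N : {ae leb, forall x, rV_box 0 N.+1%:R x -> f x = 0 -> 0 <= sg * G x ord0 i}.
    have := ae_foralln H; apply: filterS => x hx fx.
    by have [N _ /(_ N (leqnn N)) hN] := rV_box_cover x; exact: (hx N).
  pose M : R := N.+2%:R.
  pose A := [set x | [/\ rV_box 0 N.+1%:R x, boxed M f x = 0 & sg * boxed M (fun y => G y ord0 i) x < 0]].
  have inM x : rV_box 0 N.+1%:R x -> rV_box 0 M x.
    by move=> h j; apply: lt_le_trans (h j) _; rewrite ler_nat.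
  have mA : measurable A.
    have -> : A = rV_box 0 N.+1%:R `&` (boxed M f @^-1` [set 0] `&`
       (fun x => sg * boxed M (fun y => G y ord0 i) x) @^-1` `]-oo, 0[).
      by apply/seteqP; split => x /=; rewrite in_itv/=; [case|case=> h1 [h2 h3]].
    apply: measurableI; first exact: measurable_rV_box.
    apply: measurableI; rewrite -[X in measurable X]setTI.
      by apply: (Lone_measurable (iF M)).
    by apply: (Lone_measurable (LoneZ sg (iG M))).
  have mphi : measurable_fun setT (\1_A : 'rV[R]_n -> R) by exact: measurable_indic.
  have b1 (x : 'rV[R]_n) : `|\1_A x : R| <= 1 by rewrite ger0_norm ?indicE// lern1 leq_b1.
  pose q x := - sg * (\1_A x * boxed M (fun y => G y ord0 i) x).
  have iq : Lone q by apply: LoneZ; exact: (Lone_bounded (iG M) mphi b1).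
  have q0 x : 0 <= q x.
    rewrite /q indicE; have [|] := boolP (x \in A); last by rewrite mul0r mulr0.
    by rewrite inE => -[_ _ h]; rewrite mul1r mulNr oppr_ge0 ltW.
  have hI : \int[leb]_x q x <= 0.
    rewrite RintegralZl//; last exact: (Lone_bounded (iG M) mphi b1).
    rewrite mulNr oppr_le0; apply: gradient_sign => //.
      by move=> x; rewrite indicE ler0n lern1 leq_b1.
    move=> x; rewrite indicE; have [|] := boolP (x \in A); last by rewrite eqxx.
    rewrite inE => -[h1 h2 _] _; split; first by rewrite -h2 boxed_in//; exact: inM.
    by move=> j; have := h1 j; rewrite mxE sub0r normrN /M -[N.+2]addn1 natrD ltrD2r.
  have := Rintegral_le0_ae iq q0 hI; apply: filterS => x qx hx fx.
  rewrite leNgt; apply/negP => h.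
  have : x \in A by rewrite inE; split; rewrite ?boxed_in//; exact: inM.
  move=> xA; move: qx; rewrite /q indicE xA mul1r boxed_in; last exact: inM.
  by move: h; rewrite mulNr => h /eqP; rewrite oppr_eq0 lt_eqF.
have h1 := half 1 (or_introl erefl); have h2 := half (-1) (or_intror erefl).
near=> x => fx; apply/eqP; rewrite eq_le.
have h3 : f x = 0 -> 0 <= 1 * G x ord0 i by near: x.
have h4 : f x = 0 -> 0 <= -1 * G x ord0 i by near: x.
by move: (h3 fx) (h4 fx); rewrite mul1r mulN1r oppr_ge0 => -> ->.
Unshelve. all: by end_near.
Qed.

End gradient_on_zero_set.

(** * Averages of uniformly regular families, and cutoffs *)

Section vector_integral.
Variables (R : realType) (n : nat).
Local Notation leb := (lebesgue_rV R n).

Lemma Lone0 : Lone (fun _ : 'rV[R]_n => 0).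
Proof. exact: (integrable0 leb). Qed.

Lemma Rintegral_row_dotv (w : 'rV[R]_n -> 'rV[R]_n) (v : 'rV[R]_n) :
  (forall j, Lone (fun y => w y ord0 j)) ->
  Lone (fun y => dotv (w y) v) /\
  \int[leb]_y dotv (w y) v = dotv (\row_j \int[leb]_y (w y ord0 j)) v.
Proof.
move=> iw; rewrite /dotv; elim: (index_enum _) => [|j s [i1 e1]].
  under eq_fun do rewrite big_nil.
  rewrite big_nil; split; first exact: Lone0.
  by rewrite /Rintegral integral0.
have ij : Lone (fun y => w y ord0 j * v ord0 j).
  by under eq_fun do rewrite mulrC; exact: LoneZ.
under eq_fun do rewrite big_cons.
rewrite big_cons -e1 mxE; split; first exact: (LoneD ij i1).
by rewrite RintegralD//; congr (_ + _); rewrite RintegralZr//; exact: iw.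
Qed.

(** B + 1 is a bound without square roots, since B <= (B + 1)^2. *)
Lemma dotv_coor_le (u : 'rV[R]_n) (B : R) j : 0 <= B -> dotv u u <= B -> `|u ord0 j| <= B + 1.
Proof.
move=> B0 h; have {}h : u ord0 j ^+ 2 <= B.
  apply: le_trans h; rewrite /dotv (bigD1 j)//= -expr2 lerDl sumr_ge0// => i _.
  by rewrite -expr2 sqr_ge0.
rewrite -[leRHS]ger0_norm ?addr_ge0// -ler_sqr ?nnegrE//.
rewrite [leLHS](_ : _ = u ord0 j ^+ 2); last by rewrite real_normK ?num_real.
by apply: le_trans h _; rewrite real_normK ?num_real//; nra.
Qed.

End vector_integral.

Section tame_average.
Variables (R : realType) (n : nat).
Local Notation leb := (lebesgue_rV R n).
Variables (g : 'rV[R]_n -> 'rV[R]_n -> R) (D : 'rV[R]_n -> 'rV[R]_n -> 'rV[R]_n).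
Variables (B : R) (q : 'rV[R]_n -> R).
Hypothesis iq : Lone q.
Hypothesis q0 : forall w, 0 <= q w.
Hypothesis tg : forall w, tame (g ^~ w) (D ^~ w) B.
Hypothesis mg : forall x, measurable_fun setT (g x).
Hypothesis mD : forall x j, measurable_fun setT (fun w => D x w ord0 j).

Let B0 : 0 <= B. Proof. by case: (tg 0). Qed.

Let bg x w : `|g x w| <= B. Proof. by case: (tg w). Qed.

Let bD j x w : `|D x w ord0 j| <= B + 1.
Proof. by apply: dotv_coor_le => //; case: (tg w). Qed.

Let ig x : Lone (fun w => q w * g x w).
Proof. by have := Lone_bounded iq (mg x) (bg x); under eq_fun do rewrite mulrC. Qed.

Let iD j x : Lone (fun w => q w * D x w ord0 j).
Proof. by have := Lone_bounded iq (mD x j) (bD j x); under eq_fun do rewrite mulrC. Qed.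

Let bounded_average (k : 'rV[R]_n -> R) (M : R) : Lone (fun w => q w * k w) ->
  (forall w, `|k w| <= M) -> `|\int[leb]_w (q w * k w)| <= M * \int[leb]_w q w.
Proof.
move=> ik kM; apply: le_trans (le_normr_Rintegral measurableT ik) _.
rewrite -RintegralZl//; apply: le_Rintegral => //; [exact: (Lone_abs ik)|exact: LoneZ|].
by move=> w _; rewrite normrM ger0_norm// mulrC ler_wpM2r.
Qed.

Lemma tame_average_bound x : `|\int[leb]_w (q w * g x w)| <= B * \int[leb]_w q w.
Proof. exact: bounded_average. Qed.

Lemma tame_average_grad x j :
  `|\int[leb]_w (q w * D x w ord0 j)| <= (B + 1) * \int[leb]_w q w.
Proof. exact: bounded_average. Qed.

Lemma tame_average_descent x y :
  \int[leb]_w (q w * g y w) <= \int[leb]_w (q w * g x w) +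
    dotv (\row_j \int[leb]_w (q w * D x w ord0 j)) (y - x) +
    B * \int[leb]_w q w * dotv (y - x) (y - x).
Proof.
pose v w := q w *: D x w.
have [iv ev] : Lone (fun w => dotv (v w) (y - x)) /\ \int[leb]_w dotv (v w) (y - x) =
    dotv (\row_j \int[leb]_w (q w * D x w ord0 j)) (y - x).
  have [] := @Rintegral_row_dotv _ _ v (y - x).
    by move=> j; rewrite /v; under eq_fun do rewrite mxE; exact: iD.
  move=> h1 ->; split => //; congr dotv; apply/rowP => j; rewrite !mxE.
  by apply: eq_Rintegral => w _; rewrite mxE.
pose M := B * dotv (y - x) (y - x).
have iM : Lone (fun w => M * q w) by exact: LoneZ.
have igv : Lone (fun w => q w * g x w + dotv (v w) (y - x)) by exact: LoneD.
have -> : B * \int[leb]_w q w * dotv (y - x) (y - x) = \int[leb]_w (M * q w).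
  by rewrite RintegralZl// /M mulrAC.
rewrite -ev -(RintegralD measurableT (ig x) iv) -(RintegralD measurableT igv iM).
apply: le_Rintegral => //; [exact: ig|exact: (LoneD igv iM)|].
move=> w _; rewrite dotvZl mulrC [q w * g x w]mulrC [q w * dotv _ _]mulrC.
rewrite -!mulrDl ler_wpM2r//; case: (tg w) => _ _ _ _ /(_ x y).
by move=> /(le_trans (ler_norm _)); rewrite -/M; lra.
Qed.

End tame_average.

Section cutoff.
Variables (R : realType) (n : nat).

(** Widening a cutoff keeps its constant, while its gradient gains a factor s. *)
Lemma tame_scale (f : 'rV[R]_n -> R) D B (s : R) : 0 <= s <= 1 -> tame f D B ->
  tame (fun x => f (s *: x)) (fun x => s *: D (s *: x)) B.
Proof.
move=> /andP[s0 s1] [B0 h1 h2 h3 h4].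
have sB (x : 'rV[R]_n) (M : R) : 0 <= M -> M * dotv (s *: x) (s *: x) <= M * dotv x x.
  move=> M0; rewrite ler_wpM2l// dotvZl dotvZr mulrA ler_piMl ?dotv_ge0//.
  by rewrite mulr_ile1.
split => //.
- move=> x; apply: le_trans (h2 (s *: x)); have := sB (D (s *: x)) 1 ler01.
  by rewrite !mul1r.
- by move=> x y; apply: le_trans (h3 _ _) _; rewrite -scalerBr sB.
- move=> x y; rewrite dotvZl -dotvZr scalerBr; apply: le_trans (h4 _ _) _.
  by rewrite -scalerBr sB.
Qed.

Lemma cutoff_exists : exists (z : 'rV[R]_n -> R) (D : 'rV[R]_n -> 'rV[R]_n) (B : R),
  [/\ tame z D B, forall x, 0 <= z x, z 0 = 1,
    forall x, z x != 0 -> forall i, `|x ord0 i| <= 1 &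
    measurable_fun setT z /\ forall j, measurable_fun setT (fun x => D x ord0 j)].
Proof.
have b0 : 0 < bump_fun (2^-1 : R) by apply: bump_gt0; apply/andP; split; lra.
pose psi (u : R) := bump_fun (1 * u + 2^-1) * (bump_fun (2^-1 : R))^-1.
have cpsi k : C1d k psi.
  by apply: C1dM; [apply: C1d_affine; exact: C1d_bump|exact: C1d_cst].
have psi0 u : 0 <= psi u by rewrite mulr_ge0 ?bump_ge0// invr_ge0 ltW.
have psis u : 1 < `|u| -> psi u = 0.
  move=> hu; rewrite /psi bump_out ?mul0r// mul1r; apply/negP => /andP[h1 h2].
  by move: hu; rewrite ltNge => /negP; apply; rewrite ler_norml; apply/andP; split; lra.
have [B1 hB1] := tame_coordinate n 1 (cpsi 2%N) psis.
have [B hB] : exists B, forall (F : 'I_n -> 'rV[R]_n -> R) DF,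
    (forall i, tame (F i) (DF i) (`|B1|)) ->
    exists D, tame (fun x => \prod_(i <- index_enum 'I_n) F i x) D B by exact: tame_prod.
have [D hD] := hB _ _ (fun i => tame_le (ler_norm B1) (hB1 i 0)).
have e : (fun x : 'rV[R]_n => \prod_(i <- index_enum 'I_n) psi (1 * x ord0 i + 0)) =
    prodf (fun=> psi).
  by apply/funext => x; apply: eq_bigr => i _; rewrite mul1r addr0.
rewrite e in hD; exists (prodf (fun=> psi)), D, B; split => //.
- by move=> x; apply: prodr_ge0.
- apply: big1 => i _; rewrite mxE /psi mulr0 add0r divff// gt_eqF//.
- move=> x zx i; rewrite leNgt; apply: contra_neqN zx => hx.
  by rewrite (prodfD1 i) psis// mul0r.
split.
  by apply: measurable_prodf => i; exact: (C1d_measurable (cpsi 0%N)).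
move=> j; rewrite (_ : (fun x => _) = prodf (dfactor j (fun=> psi))).
  apply: measurable_prodf => i; rewrite /dfactor; case: ifP => _.
    by have [_ h] := cpsi 1%N; exact: (C1d_measurable (h : C1d 0 _)).
  exact: (C1d_measurable (cpsi 0%N)).
apply/funext => x; rewrite -(tame_partial j x hD) partial_prodf//.
by have [+ _] := cpsi 1%N; apply.
Qed.

End cutoff.

(* A log-Sobolev inequality for the density [p], restricted to functions
   that satisfy a one-sided second-order Taylor bound. *)
Definition smooth_lsi (R : realType) n (p : 'rV[R]_n -> R) (C0 : R) : Prop :=
  forall (h : 'rV[R]_n -> R) (H : 'rV[R]_n -> 'rV[R]_n) (delta M B K : R),
  0 < delta -> 0 <= K -> measurable_fun setT h ->
  measurable_fun setT (fun x => dotv (H x) (H x)) ->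
  (forall x, delta <= h x <= M) -> (forall x, dotv (H x) (H x) <= B) ->
  (forall x y, h y <= h x + dotv (H x) (y - x) + K / 2 * dotv (y - x) (y - x)) ->
  \int[lebesgue_rV R n]_x (h x * ln (h x) * p x) -
    \int[lebesgue_rV R n]_x (h x * p x) * ln (\int[lebesgue_rV R n]_x (h x * p x)) <=
  C0 * \int[lebesgue_rV R n]_x (dotv (H x) (H x) / h x * p x).

(** * The inequality for a mollified and cut off density *)

Section regularized_inequality.
Variables (R : realType) (n : nat).
Local Notation leb := (lebesgue_rV R n).
Variables (f : 'rV[R]_n -> R) (G : 'rV[R]_n -> 'rV[R]_n).
Hypothesis wg : weak_gradient f G.
Hypothesis f0 : forall x, 0 <= f x.
Hypothesis G0 : forall x, f x = 0 -> G x = 0.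

Let fisher x : R := dotv (G x) (G x) / f x.

Hypothesis iF : forall N, Lone (boxed N f).
Hypothesis iG : forall N j, Lone (boxed N (fun x => G x ord0 j)).
Hypothesis iI : forall N, Lone (boxed N fisher).

(** The Fisher integrand |G|^2 / f is the supremum over a of 2 G.a - f |a|^2, a family linear in (f,
    G). Where f = 0 the bound holds because G = 0 there. *)
Lemma fisher_dual a y : 2 * dotv (G y) a <= fisher y + f y * dotv a a.
Proof.
rewrite /fisher; have [fy|fy] := eqVneq (f y) 0.
  rewrite fy G0// (_ : dotv 0 a = 0); last first.
    by rewrite /dotv big1// => i _; rewrite mxE mul0r.
  by rewrite invr0 !mulr0 mul0r addr0.
have fy0 : 0 < f y by rewrite lt_neqAle eq_sym fy f0.
have := dotv_ge0 (G y - f y *: a).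
rewrite dotvBl !dotvBr !dotvZl !dotvZr (dotvC a) => h.
rewrite -subr_ge0 (_ : _ - _ = (f y)^-1 * (dotv (G y) (G y) - f y * dotv (G y) a -
   (f y * dotv (G y) a - f y * (f y * dotv a a)))); last by field.
by rewrite mulr_ge0// invr_ge0.
Qed.

Let boxed_ge0 N (q : 'rV[R]_n -> R) x : (forall x, 0 <= q x) -> 0 <= boxed N q x.
Proof. by move=> q0; rewrite mulr_ge0// indicE. Qed.

Let fisher_ge0 x : 0 <= fisher x. Proof. by rewrite divr_ge0// dotv_ge0. Qed.

Section kernel.
Variables (rho N : R) (th : 'I_n -> R -> R).
Hypothesis hth : forall i, mollifier rho (th i).

Let k := kernel_of th.
Let A x := avg k (boxed N f) x.
Let g x : 'rV[R]_n := \row_j avg k (boxed N (fun y => G y ord0 j)) x.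
Let P x := avg k (boxed N fisher) x.

Let ik x q : Lone q -> Lone (fun y => q y * k x y).
Proof.
have [Bk hB] := kernel_bounded hth.
apply: (@avg_integrand_Lone _ _ _ Bk (measurable_kernel_of hth)) => // u v.
exact: kernel_ge0 hth _ _.
Qed.

Let k0 x y : 0 <= k x y. Proof. exact: kernel_ge0 hth _ _. Qed.

Let A0 x : 0 <= A x.
Proof. by apply: avg_ge0 => // y; apply: boxed_ge0. Qed.

(** Jensen's inequality for |G|^2 / f: [fisher_dual] is linear, hence survives averaging, and is
    then optimized over multiples of the averaged gradient. *)
Lemma avg_fisher x : dotv (g x) (g x) <= A x * P x.
Proof.
have dual a : 2 * dotv (g x) a <= P x + A x * dotv a a.
  pose w y : 'rV[R]_n := \row_j (boxed N (fun y => G y ord0 j) y * k x y).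
  have [iw ew] : Lone (fun y => dotv (w y) a) /\ \int[leb]_y dotv (w y) a = dotv (g x) a.
    have [|h1 ->] := @Rintegral_row_dotv _ _ w a.
      by move=> j; rewrite /w; under eq_fun do rewrite mxE; exact: ik.
    split => //; congr dotv; apply/rowP => j; rewrite !mxE.
    by apply: eq_Rintegral => y _; rewrite mxE.
  have i1 := ik x (iI N); have i2 := LoneZ (dotv a a) (ik x (iF N)).
  rewrite -ew mulrC -RintegralZr// [A x * _]mulrC /A /P /avg -RintegralZl//; last exact: ik.
  rewrite -RintegralD//; apply: le_Rintegral => //.
  - by have := LoneZ 2 iw; under eq_fun do rewrite mulrC.
  - exact: (LoneD i1 i2).
  move=> y _; have -> : w y = (\1_(rV_box 0 N) y * k x y) *: G y.
    by apply/rowP => j; rewrite !mxE /boxed; ring.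
  rewrite dotvZl /boxed mulrC.
  have := fisher_dual a y; have : 0 <= \1_(rV_box 0 N) y * k x y :> R.
    by rewrite mulr_ge0// indicE.
  by move: (\1_(rV_box 0 N) y) => u; move: (k x y) => v; nra.
set X := dotv (g x) (g x).
have X0 : 0 <= X by exact: dotv_ge0.
have P0 : 0 <= P x by apply: avg_ge0 => // y; apply: boxed_ge0.
(* The vector is t times the averaged gradient. The best choice is t = 1/A; if A = 0, a large t
   forces X = 0. *)
have dX t : 2 * t * X <= P x + A x * t ^+ 2 * X.
  by have := dual (t *: g x); rewrite !dotvZr dotvZl -/X; lra.
have := A0 x; rewrite le_eqVlt => /predU1P[Ax|Ax].
  rewrite -Ax mul0r leNgt; apply/negP => hX.
  have := dX ((P x + 1) / X); rewrite -Ax !mul0r -mulrA divfK ?gt_eqF//; lra.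
have := dX (A x)^-1; rewrite -subr_ge0 => h.
rewrite -subr_ge0 (_ : _ - _ = A x * (P x + A x * (A x)^-1 ^+ 2 * X - 2 * (A x)^-1 * X)).
  by rewrite mulr_ge0.
by field; rewrite gt_eqF.
Qed.


Section cutoff.
Variables (z : 'rV[R]_n -> R) (Dz : 'rV[R]_n -> 'rV[R]_n) (Bz rz : R).
Hypothesis tz : tame z Dz Bz.
Hypothesis z0 : forall x, 0 <= z x.
Hypothesis mz : measurable_fun setT z.
Hypothesis mDz : forall j, measurable_fun setT (fun x => Dz x ord0 j).
Hypothesis zsupp : forall x, z x != 0 -> forall i, `|x ord0 i| <= rz.
Hypothesis rzN : rz + rho < N.
Variables (p : 'rV[R]_n -> R) (C0 Bp delta eps : R).
Hypothesis ip : Lone p.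
Hypothesis pB : forall x, 0 <= p x <= Bp.
Hypothesis lsi : smooth_lsi p C0.
Hypothesis C00 : 0 <= C0.
Hypothesis delta0 : 0 < delta.
Hypothesis eps0 : 0 < eps.

(** The cutoff is squared so that its gradient term 4 z^2 A^2 |Dz|^2, divided by z^2 A, stays
    bounded by 4 A |Dz|^2. *)
Definition regularized x : R := delta + z x ^+ 2 * A x.
Let h := regularized.
Let H x : 'rV[R]_n := z x ^+ 2 *: g x + (2 * z x * A x) *: Dz x.

Let mA : measurable_fun setT A.
Proof. exact: Lone_measurable (kernel_avg_Lone hth (iF N)). Qed.

Lemma measurable_regularized : measurable_fun setT regularized.
Proof. by apply: measurable_funD => //; apply: measurable_funM => //; exact: measurable_funX. Qed.

Let mH j : measurable_fun setT (fun x => H x ord0 j).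
Proof.
rewrite (_ : (fun x => _) = (fun x => z x ^+ 2 * avg k (boxed N (fun y => G y ord0 j)) x +
    2 * z x * A x * Dz x ord0 j)); last by apply/funext => x; rewrite !mxE.
apply: measurable_funD; apply: measurable_funM => //.
- exact: measurable_funX.
- exact: Lone_measurable (kernel_avg_Lone hth (iG N j)).
- by apply: measurable_funM => //; exact: measurable_funM.
Qed.

Let mh : measurable_fun setT h. Proof. exact: measurable_regularized. Qed.

Let mHH : measurable_fun setT (fun x => dotv (H x) (H x)).
Proof.
rewrite /dotv; apply: measurable_sum => j; exact: measurable_funM.
Qed.

Let gk x w := z x * (z x * k x w).
Let Dk x w : 'rV[R]_n := \row_j - kernel_of (dfactor j th) x w.
Let DD x w : 'rV[R]_n := z x *: (z x *: Dk x w + k x w *: Dz x) + (z x * k x w) *: Dz x.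

Let tame_gk : exists B, forall w, tame (gk ^~ w) (DD ^~ w) B.
Proof.
have [B1 h1] := kernel_tame hth.
pose B2 := Num.max Bz B1.
have t1 w : tame (fun x => z x * k x w) (fun x => z x *: Dk x w + k x w *: Dz x)
    (B2 + 3 * B2 ^+ 2 + 4 * B2 ^+ 3).
  apply: tameM; first by apply: tame_le tz; rewrite le_max lexx.
  by apply: tame_le (h1 w); rewrite le_max lexx orbT.
pose B3 := Num.max Bz (B2 + 3 * B2 ^+ 2 + 4 * B2 ^+ 3).
exists (B3 + 3 * B3 ^+ 2 + 4 * B3 ^+ 3) => w; apply: tameM.
  by apply: tame_le tz; rewrite le_max lexx.
by apply: tame_le (t1 w); rewrite le_max lexx orbT.
Qed.

Let hE x : \int[leb]_w (boxed N f w * gk x w) = z x ^+ 2 * A x.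
Proof.
rewrite /A /avg -RintegralZl//; last exact: ik.
by apply: eq_Rintegral => w _; rewrite /gk; ring.
Qed.

(** The derivative falls on the kernel and the weak gradient transfers it to G. This needs x well
    inside the box, which holds where z(x) is nonzero; elsewhere both sides are 0. *)
Let HE x : (\row_j \int[leb]_w (boxed N f w * DD x w ord0 j)) = H x.
Proof.
apply/rowP => j; rewrite !mxE.
have [zx|zx] := eqVneq (z x) 0.
  rewrite zx expr0n/= mulr0 !mul0r addr0 -[RHS]/(fine 0%E) -(integral0 leb setT); congr fine.
  apply: eq_integral => w _; congr EFin; rewrite !mxE zx; ring.
have hN i : `|x ord0 i| + rho < N by apply: le_lt_trans rzN; rewrite lerD2r zsupp.
have := weak_gradient_avg wg j hth hN; rewrite -/k => e.
have id : Lone (fun w => boxed N f w * kernel_of (dfactor j th) x w).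
  have [B hB] := dkernel_bounded hth j.
  by have := Lone_bounded (iF N) (measurable_dkernel hth j x) (hB x); under eq_fun do rewrite mulrC.
have -> : avg k (boxed N (fun y => G y ord0 j)) x =
    - \int[leb]_w (boxed N f w * kernel_of (dfactor j th) x w) by rewrite e opprK.
rewrite mulrN -mulNr /A /avg -(RintegralZl _ measurableT id).
rewrite mulrAC -(RintegralZl _ measurableT (ik x (iF N))) -RintegralD//.
- by apply: eq_Rintegral => w _; rewrite !mxE; ring.
- exact: (LoneZ _ id).
- exact: (LoneZ _ (ik x (iF N))).
Qed.

Let mgk x : measurable_fun setT (gk x).
Proof.
by do 2!apply: measurable_funM => //; exact: (measurable_kernel_section (measurable_kernel_of hth)).
Qed.

Let mDD x j : measurable_fun setT (fun w => DD x w ord0 j).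
Proof.
have mk : measurable_fun setT (k x) by exact: (measurable_kernel_section (measurable_kernel_of hth)).
rewrite (_ : (fun w => _) = (fun w => z x * (z x * (- kernel_of (dfactor j th) x w) + k x w * Dz x ord0 j) +
    (z x * k x w) * Dz x ord0 j)); last by apply/funext => w; rewrite !mxE.
apply: measurable_funD; apply: measurable_funM => //.
  apply: measurable_funD; apply: measurable_funM => //.
  by apply: measurableT_comp => //; exact: measurable_dkernel hth j x.
exact: measurable_funM.
Qed.

Let regular : exists M B K, [/\ 0 <= K, forall x, delta <= h x <= M,
  forall x, dotv (H x) (H x) <= B &
  forall x y, h y <= h x + dotv (H x) (y - x) + K / 2 * dotv (y - x) (y - x)].
Proof.
have [B hB] := tame_gk; have fN w : 0 <= boxed N f w by exact: boxed_ge0.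
have B0 : 0 <= B by case: (hB 0).
set I := \int[leb]_w boxed N f w; have I0 : 0 <= I by exact: Rintegral_ge0.
exists (delta + B * I), (n%:R * ((B + 1) * I) ^+ 2), (2 * (B * I)); split.
- by rewrite !mulr_ge0.
- move=> x; rewrite /h /regularized lerDl lerD2l mulr_ge0 ?sqr_ge0 ?A0//= -hE.
  exact: le_trans (ler_norm _) (tame_average_bound (iF N) fN hB mgk x).
- move=> x; rewrite /dotv -[n in n%:R]card_ord -sum1_card natr_sum mulr_suml.
  apply: ler_sum => j _; rewrite mul1r -expr2 -HE mxE -real_normK ?num_real//.
  rewrite ler_pXn2r ?nnegrE ?mulr_ge0// ?addr_ge0//.
  exact: (tame_average_grad (iF N) fN hB mDD x j).
- move=> x y; rewrite /h /regularized -!hE -HE; set d := dotv (y - x) (y - x).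
  have -> : 2 * (B * I) / 2 * d = B * I * d by field.
  by have := tame_average_descent (iF N) fN hB mgk mDD x y; rewrite -/I -/d; lra.
Qed.

Lemma regularized_bounded : exists M, forall x, delta <= regularized x <= M.
Proof. by have [M [_ [_ [_ + _ _]]]] := regular; exists M. Qed.

Let hgt0 x : 0 < h x.
Proof. by rewrite ltr_wpDr// mulr_ge0// sqr_ge0. Qed.

(** Young's inequality with weight [eps] separates the two parts of H. Then [avg_fisher] bounds the
    first, and h >= z^2 A absorbs the denominator of both. *)
Lemma regularized_fisher x : dotv (H x) (H x) / h x <=
  (1 + eps) * (z x ^+ 2 * P x) + (1 + eps^-1) * 4 * (dotv (Dz x) (Dz x) * A x).
Proof.
have hg := avg_fisher x.
have P0 : 0 <= P x by apply: avg_ge0 => // y; apply: boxed_ge0.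
have split (u v : 'rV[R]_n) : dotv (u + v) (u + v) <= (1 + eps) * dotv u u + (1 + eps^-1) * dotv v v.
  have := dotv_young u v eps0; rewrite dotvDl !dotvDr (dotvC v u).
  have -> : (2 * eps)^-1 = eps^-1 / 2 by field; rewrite gt_eqF.
  lra.
have := split (z x ^+ 2 *: g x) ((2 * z x * A x) *: Dz x).
rewrite !dotvZl !dotvZr -/(H x); set d := dotv (Dz x) (Dz x) => hH.
have d0 : 0 <= d by exact: dotv_ge0.
set T := (X in _ <= X); have T0 : 0 <= T.
  by rewrite addr_ge0 ?mulr_ge0 ?sqr_ge0 ?addr_ge0 ?invr_ge0// ltW.
rewrite ler_pdivrMr//; apply: le_trans hH _.
apply: (@le_trans _ _ (T * (z x ^+ 2 * A x))); last first.
  by rewrite ler_wpM2l// lerDr ltW.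
rewrite [leRHS]mulrDl; apply: lerD.
  rewrite -mulrA ler_wpM2l ?addr_ge0 ?(ltW eps0)//.
  by have := sqr_ge0 (z x); move: (z x ^+ 2) hg => s hg s0; nra.
by rewrite le_eqVlt; apply/orP; left; apply/eqP; ring.
Qed.

Lemma regularized_lsi :
  \int[leb]_x (h x * ln (h x) * p x) -
    \int[leb]_x (h x * p x) * ln (\int[leb]_x (h x * p x)) <=
  C0 * ((1 + eps) * \int[leb]_x (z x ^+ 2 * p x * P x) +
        (1 + eps^-1) * 4 * \int[leb]_x (dotv (Dz x) (Dz x) * p x * A x)).
Proof.
have [M [B [K [K0 hM HB hdesc]]]] := regular.
apply: le_trans (lsi delta0 K0 mh mHH hM HB hdesc) _.
rewrite ler_wpM2l//.
have mp : measurable_fun setT p by exact: Lone_measurable.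
have [Bz0 zB DzB _ _] := tz.
have i1 : Lone (fun x => z x ^+ 2 * p x * P x).
  apply: (@Lone_bounded _ _ _ _ (Bz ^+ 2 * Bp)).
  - exact: kernel_avg_Lone hth (iI N).
  - by apply: measurable_funM => //; exact: measurable_funX.
  move=> x; have /andP[p0 pBp] := pB x.
  rewrite normrM (ger0_norm p0) ger0_norm ?sqr_ge0// ler_pM ?sqr_ge0//.
  by rewrite ler_pXn2r ?nnegrE// -[z x]ger0_norm.
have mDD2 : measurable_fun setT (fun x => dotv (Dz x) (Dz x)).
  by rewrite /dotv; apply: measurable_sum => j; exact: measurable_funM.
have i2 : Lone (fun x => dotv (Dz x) (Dz x) * p x * A x).
  apply: (@Lone_bounded _ _ _ _ (Bz * Bp)).
  - exact: kernel_avg_Lone hth (iF N).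
  - exact: measurable_funM.
  move=> x; have /andP[p0 pBp] := pB x.
  by rewrite normrM (ger0_norm p0) ger0_norm ?dotv_ge0// ler_pM ?dotv_ge0.
rewrite -(RintegralZl _ measurableT i1) -(RintegralZl _ measurableT i2).
rewrite -RintegralD//; [|exact: LoneZ i1|exact: LoneZ i2].
have j1 := LoneD (LoneZ (1 + eps) i1) (LoneZ ((1 + eps^-1) * 4) i2).
apply: le_Rintegral => //.
  apply: (bounded_mul_integrable (B := B / delta)) => //.
    by apply: measurable_funM => //; exact: measurable_funV.
  move=> x; rewrite ger0_norm ?divr_ge0 ?dotv_ge0 ?(ltW (hgt0 x))//.
  have /andP[dh _] := hM x.
  by apply: ler_pM => //; rewrite ?dotv_ge0 ?invr_ge0 ?(ltW (hgt0 x))// lef_pV2 ?posrE.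
move=> x _; have /andP[p0 _] := pB x; have := regularized_fisher x => hx.
by apply: le_trans (ler_wpM2r p0 hx) _; rewrite le_eqVlt; apply/orP; left; apply/eqP; ring.
Qed.

End cutoff.
End kernel.
End regularized_inequality.

(** * Passage to the limit: mollification, then cutoff *)

Section entropy_facts.
Variable R : realType.
Implicit Types a b x y m : R.

Lemma entropy_tangent m y : 0 < m -> 0 < y -> (1 + ln m) * y - m <= y * ln y.
Proof. by move=> m0 y0; have := entropy_gap_ge0 m0 y0; lra. Qed.

Lemma entropy_cvg (u : nat -> R) m : 0 < m -> u @ \oo --> m ->
  (fun k => u k * ln (u k)) @ \oo --> m * ln m.
Proof.
move=> m0 um; apply: cvgM => //.
by apply: (cvg_comp _ _ um); exact: continuous_ln.
Qed.

Lemma ln_bounded a b x : 0 < a -> a <= x <= b -> `|ln x| <= `|ln a| + `|ln b|.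
Proof.
move=> a0 /andP[ax xb]; have x0 := lt_le_trans a0 ax; have b0 := lt_le_trans x0 xb.
have h1 : ln a <= ln x by rewrite ler_ln ?posrE.
have h2 : ln x <= ln b by rewrite ler_ln ?posrE.
rewrite ler_norml; apply/andP; split.
  by have := ler_norm (- ln a); rewrite normrN; have := normr_ge0 (ln b); lra.
by have := ler_norm (ln b); have := normr_ge0 (ln a); lra.
Qed.

End entropy_facts.

Section cutoff_inequality.
Variables (R : realType) (n : nat).
Local Notation leb := (lebesgue_rV R n).
Variables (f : 'rV[R]_n -> R) (G : 'rV[R]_n -> 'rV[R]_n).
Hypothesis wg : weak_gradient f G.
Hypothesis f0 : forall x, 0 <= f x.
Hypothesis G0 : forall x, f x = 0 -> G x = 0.
Let fisher x : R := dotv (G x) (G x) / f x.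
Hypothesis iF : forall N, Lone (boxed N f).
Hypothesis iG : forall N j, Lone (boxed N (fun x => G x ord0 j)).
Hypothesis iI : forall N, Lone (boxed N fisher).
Variables (z : 'rV[R]_n -> R) (Dz : 'rV[R]_n -> 'rV[R]_n) (Bz rz N : R).
Hypothesis tz : tame z Dz Bz.
Hypothesis z0 : forall x, 0 <= z x.
Hypothesis mz : measurable_fun setT z.
Hypothesis mDz : forall j, measurable_fun setT (fun x => Dz x ord0 j).
Hypothesis zsupp : forall x, z x != 0 -> forall i, `|x ord0 i| <= rz.
Hypothesis rzN : rz < N.
Variables (p : 'rV[R]_n -> R) (C0 Bp delta eps Mx : R).
Hypothesis ip : Lone p.
Hypothesis pB : forall x, 0 <= p x <= Bp.
Hypothesis p1 : \int[leb]_x p x = 1.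
Hypothesis lsi : smooth_lsi p C0.
Hypothesis C00 : 0 <= C0.
Hypothesis delta0 : 0 < delta.
Hypothesis delta1 : delta <= 1.
Hypothesis eps0 : 0 < eps.
Hypothesis Mx1 : 1 <= Mx.

Definition cutoff_density x : R := delta + z x ^+ 2 * boxed N f x.
Let Y := cutoff_density.
Let zt x := Num.min (Y x) Mx.

(** Removes the mollification. The entropy of the mollified function is bounded below by the tangent
    of y ln y at [zt], the truncated limit. This minorant is linear in the function and has bounded
    coefficients because delta <= zt <= Mx, so convergence against bounded functions suffices. *)
Lemma cutoff_lsi :
  \int[leb]_x (zt x * ln (zt x) * p x) -
    \int[leb]_x (Y x * p x) * ln (\int[leb]_x (Y x * p x)) <=
  C0 * ((1 + eps) * \int[leb]_x (z x ^+ 2 * p x * boxed N fisher x) +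
        (1 + eps^-1) * 4 * \int[leb]_x (dotv (Dz x) (Dz x) * p x * boxed N f x)).
Proof.
have mp : measurable_fun setT p by exact: Lone_measurable.
have [Bz0 zB DzB _ _] := tz.
have Bp0 : 0 <= Bp by have /andP[] := pB 0; exact: le_trans.
have mz2 : measurable_fun setT (fun x => z x ^+ 2) by exact: measurable_funX.
have mDD2 : measurable_fun setT (fun x => dotv (Dz x) (Dz x)).
  by rewrite /dotv; apply: measurable_sum => j; exact: measurable_funM.
have mf : measurable_fun setT (boxed N f) by exact: Lone_measurable.
have mY : measurable_fun setT Y by apply: measurable_funD => //; exact: measurable_funM.
have bf0 x : 0 <= boxed N f x by rewrite mulr_ge0// indicE.
have Yd x : delta <= Y x by rewrite lerDl mulr_ge0 ?sqr_ge0.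
have mzt : measurable_fun setT zt by exact: measurable_minr.
have ztd x : delta <= zt x by rewrite le_min Yd (le_trans delta1).
have ztM x : zt x <= Mx by rewrite ge_min lexx orbT.
have zt0 x : 0 < zt x by exact: lt_le_trans (ztd x).
have mln : measurable_fun setT (fun x => ln (zt x)).
  exact: (measurableT_comp (@measurable_ln R)).
pose BL := `|ln delta| + `|ln Mx|.
have lnB x : `|ln (zt x)| <= BL by apply: ln_bounded => //; rewrite ztd ztM.
have z2B x : z x ^+ 2 <= Bz ^+ 2 by rewrite ler_pXn2r ?nnegrE// -[z x]ger0_norm.
have zpB x : `|z x ^+ 2 * p x| <= Bz ^+ 2 * Bp.
  have /andP[p0 pBp] := pB x.
  by rewrite normrM (ger0_norm p0) ger0_norm ?sqr_ge0// ler_pM ?sqr_ge0.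
have DpB x : `|dotv (Dz x) (Dz x) * p x| <= Bz * Bp.
  have /andP[p0 pBp] := pB x.
  by rewrite normrM (ger0_norm p0) ger0_norm ?dotv_ge0// ler_pM ?dotv_ge0.
have LB x : `|(1 + ln (zt x)) * (z x ^+ 2 * p x)| <= (1 + BL) * (Bz ^+ 2 * Bp).
  rewrite normrM ler_pM//; apply: le_trans (ler_normD _ _) _.
  by rewrite normr1 lerD2l.
have mzp : measurable_fun setT (fun x => z x ^+ 2 * p x) by exact: measurable_funM.
have mDp : measurable_fun setT (fun x => dotv (Dz x) (Dz x) * p x) by exact: measurable_funM.
have mL : measurable_fun setT (fun x => (1 + ln (zt x)) * (z x ^+ 2 * p x)).
  by apply: measurable_funM => //; exact: measurable_funD.
pose d m : R := (N - rz) / 2 * m.+1%:R^-1.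
have d0 m : 0 < d m by rewrite mulr_gt0 ?invr_gt0// divr_gt0// subr_gt0.
have dc : d @ \oo --> 0.
  by rewrite -[X in _ --> X](mulr0 ((N - rz) / 2)); apply: cvgMr; exact: cvg_harmonic.
have dN m : rz + d m < N.
  have : d m <= (N - rz) / 2 by rewrite ler_piMr ?invf_le1 ?ler1n// divr_ge0// subr_ge0 ltW.
  by have := rzN; lra.
pose th m (i : 'I_n) := scaled_bump (d m).
have hth m i : mollifier (d m) (th m i) by exact: scaled_bump_mollifier.
pose h m := regularized f N (th m) z delta.
pose A m := avg (kernel_of (th m)) (boxed N f).
have iA m : Lone (A m) by exact: kernel_avg_Lone (hth m) (iF N).
have hE m x : h m x = delta + z x ^+ 2 * A m x by [].
have mh m : measurable_fun setT (h m) by exact: (measurable_regularized iF N (hth m) mz delta).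
have idp : Lone (fun x => delta * p x) by exact: LoneZ.
have c1 := kernel_weak_cvg hth dc (iF N) mzp zpB.
have c2 := kernel_weak_cvg hth dc (iI N) mzp zpB.
have c3 := kernel_weak_cvg hth dc (iF N) mDp DpB.
have c4 := kernel_weak_cvg hth dc (iF N) mL LB.
have iY : Lone (fun x => z x ^+ 2 * p x * boxed N f x) by exact: (Lone_bounded (iF N) mzp zpB).
have iAm m : Lone (fun x => z x ^+ 2 * p x * A m x) by exact: (Lone_bounded (iA m) mzp zpB).
have eY : \int[leb]_x (Y x * p x) = delta + \int[leb]_x (z x ^+ 2 * p x * boxed N f x).
  rewrite -[in RHS](mulr1 delta) -p1 -(RintegralZl _ measurableT ip) -(RintegralD measurableT idp iY).
  by apply: eq_Rintegral => x _; rewrite /Y /cutoff_density; ring.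
have eh m : \int[leb]_x (h m x * p x) = delta + \int[leb]_x (z x ^+ 2 * p x * A m x).
  rewrite -[in RHS](mulr1 delta) -p1 -(RintegralZl _ measurableT ip) -(RintegralD measurableT idp (iAm m)).
  by apply: eq_Rintegral => x _; rewrite hE; ring.
have Y0 : 0 < \int[leb]_x (Y x * p x).
  rewrite eY ltr_wpDr// Rintegral_ge0// => x _.
  by have /andP[? _] := pB x; rewrite !mulr_ge0.
have cM : (fun m => \int[leb]_x (h m x * p x)) @ \oo --> \int[leb]_x (Y x * p x).
  under eq_fun do rewrite eh.
  by rewrite eY; apply: cvgD => //; exact: cvg_cst.
have cE := entropy_cvg Y0 cM.
pose L0 := \int[leb]_x ((1 + ln (zt x)) * delta * p x - zt x * p x).
have iL0 : Lone (fun x => (1 + ln (zt x)) * delta * p x - zt x * p x).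
  apply: LoneB.
    apply: (Lone_bounded (B := (1 + BL) * delta) ip).
      by apply: measurable_funM => //; exact: measurable_funD.
    move=> x; rewrite normrM (gtr0_norm delta0) ler_wpM2r ?(ltW delta0)//.
    by apply: le_trans (ler_normD _ _) _; rewrite normr1 lerD2l.
  by apply: (Lone_bounded (B := Mx) ip) => // x; rewrite gtr0_norm.
have iL m : Lone (fun x => (1 + ln (zt x)) * (z x ^+ 2 * p x) * A m x).
  exact: (Lone_bounded (iA m) mL LB).
have iLY : Lone (fun x => (1 + ln (zt x)) * (z x ^+ 2 * p x) * boxed N f x).
  exact: (Lone_bounded (iF N) mL LB).
have lower m : L0 + \int[leb]_x ((1 + ln (zt x)) * (z x ^+ 2 * p x) * A m x) <=
    \int[leb]_x (h m x * ln (h m x) * p x).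
  rewrite -(RintegralD measurableT iL0 (iL m)).
  have [Mh hM] := regularized_bounded wg f0 iF (hth m) tz zsupp (dN m) delta.
  have h0 x : 0 < h m x by have /andP[+ _] := hM x; exact: lt_le_trans.
  apply: le_Rintegral => //; first exact: (LoneD iL0 (iL m)).
    apply: (Lone_bounded (B := Mh * (`|ln delta| + `|ln Mh|)) ip).
      by apply: measurable_funM => //; exact: (measurableT_comp (@measurable_ln R)).
    move=> x; have /andP[hx1 hx2] := hM x; have Mh0 := lt_le_trans (h0 x) hx2.
    rewrite normrM ler_pM//; first by rewrite gtr0_norm// h0.
    by apply: ln_bounded => //; rewrite hx1.
  move=> x _; have /andP[p0 _] := pB x.
  have := ler_wpM2r p0 (entropy_tangent (zt0 x) (h0 x)); apply: le_trans.
  by rewrite le_eqVlt hE; apply/orP; left; apply/eqP; ring.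
have main : L0 + \int[leb]_x ((1 + ln (zt x)) * (z x ^+ 2 * p x) * boxed N f x) -
    \int[leb]_x (Y x * p x) * ln (\int[leb]_x (Y x * p x)) <=
  C0 * ((1 + eps) * \int[leb]_x (z x ^+ 2 * p x * boxed N fisher x) +
        (1 + eps^-1) * 4 * \int[leb]_x (dotv (Dz x) (Dz x) * p x * boxed N f x)).
  have cL : (fun m => L0 + \int[leb]_x ((1 + ln (zt x)) * (z x ^+ 2 * p x) * A m x) -
      \int[leb]_x (h m x * p x) * ln (\int[leb]_x (h m x * p x))) @ \oo -->
    L0 + \int[leb]_x ((1 + ln (zt x)) * (z x ^+ 2 * p x) * boxed N f x) -
      \int[leb]_x (Y x * p x) * ln (\int[leb]_x (Y x * p x)).
    by apply: cvgB cE; apply: cvgD c4; exact: cvg_cst.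
  have cR : (fun m => C0 * ((1 + eps) * \int[leb]_x (z x ^+ 2 * p x *
        avg (kernel_of (th m)) (boxed N fisher) x) +
      (1 + eps^-1) * 4 * \int[leb]_x (dotv (Dz x) (Dz x) * p x * A m x))) @ \oo -->
    C0 * ((1 + eps) * \int[leb]_x (z x ^+ 2 * p x * boxed N fisher x) +
        (1 + eps^-1) * 4 * \int[leb]_x (dotv (Dz x) (Dz x) * p x * boxed N f x)).
    by apply: cvgMr; apply: cvgD; apply: cvgMr.
  apply: (ler_cvg_to cL cR).
  apply: nearW => m.
  have := regularized_lsi wg f0 G0 iF iG iI (hth m) tz z0 mz mDz zsupp (dN m) ip pB lsi C00 delta0 eps0.
  by apply: le_trans; rewrite lerD2r; exact: lower.
(* Evaluated at Y itself, the tangent at min(Y, Mx) dominates zt ln zt: with equality when Y <= Mx,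
   otherwise because ln Mx >= 0. *)
apply: le_trans main; rewrite lerD2r -(RintegralD measurableT iL0 iLY).
apply: le_Rintegral => //.
- apply: (Lone_bounded (B := Mx * BL) ip); first exact: measurable_funM.
  by move=> x; rewrite normrM ler_pM// gtr0_norm.
- exact: (LoneD iL0 iLY).
move=> x _; have /andP[p0 _] := pB x.
rewrite [leRHS](_ : _ = ((1 + ln (zt x)) * Y x - zt x) * p x); last first.
  by rewrite /Y /cutoff_density; ring.
rewrite ler_wpM2r// /zt; have [_|hM] := leP (Y x) Mx; first lra.
have lM := ln_ge0 Mx1; nra.
Qed.

End cutoff_inequality.

Section fatou_bound.
Variables (R : realType) (n : nat).
Local Notation leb := (lebesgue_rV R n).

Lemma fatou_bound (g_ : nat -> 'rV[R]_n -> R) (g : 'rV[R]_n -> R) (U : nat -> R) (l : R) :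
  (forall m, measurable_fun setT (g_ m)) -> (forall m x, 0 <= g_ m x) ->
  (forall x, g_ ^~ x @ \oo --> g x) ->
  (forall m, (\int[leb]_x (g_ m x)%:E <= (U m)%:E)%E) -> U @ \oo --> l ->
  (\int[leb]_x (g x)%:E <= l%:E)%E.
Proof.
move=> mg g0 gc gU Ul.
have -> : (\int[leb]_x (g x)%:E = \int[leb]_x limn_einf (fun m => (g_ m x)%:E))%E.
  apply: eq_integral => x _; have : (fun m => (g_ m x)%:E) @ \oo --> (g x)%:E.
    by apply: cvg_EFin; [exact: nearW|exact: gc].
  by move=> /cvg_limn_einf_sup[-> _].
apply: le_trans (fatou leb measurableT _ _) _.
- by move=> m; apply/measurable_EFinP; exact: mg.
- by move=> m x _; rewrite lee_fin.
have Ul' : (EFin \o U) @ \oo --> l%:E by apply: cvg_EFin; [exact: nearW|exact: Ul].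
rewrite limn_einf_lim -(cvg_lim _ Ul')//; apply: lee_lim.
- exact: is_cvg_einfs.
- by apply/cvg_ex; exists l%:E.
- apply: nearW => m; apply: le_trans (gU m); apply: ereal_inf_lbound.
  by exists m => //=.
Qed.

End fatou_bound.

Section full_inequality.
Variables (R : realType) (n : nat).
Local Notation leb := (lebesgue_rV R n).
Variables (f : 'rV[R]_n -> R) (G : 'rV[R]_n -> 'rV[R]_n).
Hypothesis wg : weak_gradient f G.
Hypothesis f0 : forall x, 0 <= f x.
Hypothesis G0 : forall x, f x = 0 -> G x = 0.
Let fisher x : R := dotv (G x) (G x) / f x.
Hypothesis iF : forall N, Lone (boxed N f).
Hypothesis iG : forall N j, Lone (boxed N (fun x => G x ord0 j)).
Hypothesis iI : forall N, Lone (boxed N fisher).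
Hypothesis mf : measurable_fun setT f.
Variables (p : 'rV[R]_n -> R) (C0 Bp : R).
Hypothesis ip : Lone p.
Hypothesis pB : forall x, 0 <= p x <= Bp.
Hypothesis p1 : \int[leb]_x p x = 1.
Hypothesis lsi : smooth_lsi p C0.
Hypothesis C00 : 0 <= C0.
Hypothesis ifp : Lone (fun x => f x * p x).
Hypothesis fp1 : \int[leb]_x (f x * p x) = 1.
Hypothesis iIp : Lone (fun x => fisher x * p x).

Lemma measurable_scale (s : R) : measurable_fun setT (fun x : 'rV[R]_n => s *: x).
Proof.
apply: measurable_fun_rV => i; rewrite (_ : _ \o _ = (fun x => s * rV_coor i x)).
  by apply: measurable_funM => //; exact: measurable_rV_coor.
by apply/funext => x; rewrite /= /rV_coor mxE.
Qed.

Let s m : R := m.+1%:R^-1.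

Let s0 m : 0 < s m. Proof. by rewrite invr_gt0. Qed.

Let s1 m : s m <= 1. Proof. by rewrite invf_le1 ?ler1n. Qed.

Let sc : s @ \oo --> 0. Proof. exact: cvg_harmonic. Qed.

Let boxed_cvg (q : 'rV[R]_n -> R) x : (fun m => boxed (m.+2%:R : R) q x) @ \oo --> q x.
Proof.
apply: cvg_near_cst; have := rV_box_cover x; apply: filterS => m h.
by apply: boxed_in => i; apply: lt_le_trans (h i) _; rewrite ler_nat.
Qed.

(** All parameters are tied to s = 1/(m+1) and m tends to infinity. Adding 1 makes the entropy
    integrand nonnegative, so Fatou's lemma applies before f ln f is known to be integrable. *)
Lemma entropy_lsi :
  (\int[leb]_x ((f x * ln (f x) + 1) * p x)%:E <=
   (C0 * (\int[leb]_x (fisher x * p x)) + 1)%:E)%E.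
Proof.
have mp : measurable_fun setT p by exact: Lone_measurable.
have p0 x : 0 <= p x by case/andP: (pB x).
have fi0 x : 0 <= fisher x by rewrite divr_ge0 ?dotv_ge0.
have [z [D [B [tz z0 z1 zs [mz mD]]]]] := cutoff_exists R n.
have [B0 zB DB zlip _] := tz.
pose zz m (x : 'rV[R]_n) : R := z (s m *: x).
pose Dz m (x : 'rV[R]_n) : 'rV[R]_n := s m *: D (s m *: x).
have tzz m : tame (zz m) (Dz m) B by apply: tame_scale tz; rewrite s1 ltW.
have mzz m : measurable_fun setT (zz m) by exact: (measurableT_comp mz (measurable_scale _)).
have mDz m j : measurable_fun setT (fun x => Dz m x ord0 j).
  rewrite (_ : (fun x => _) = (fun x => s m * D (s m *: x) ord0 j)).
    by apply: measurable_funM => //; exact: (measurableT_comp (mD j) (measurable_scale _)).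
  by apply/funext => x; rewrite mxE.
have zzs m x : zz m x != 0 -> forall i, `|x ord0 i| <= m.+1%:R.
  move=> /zs h i; have := h i; rewrite mxE normrM gtr0_norm//.
  by rewrite /s mulrC ler_pdivrMr// mul1r.
have zzc (x : 'rV[R]_n) : (fun m => zz m x) @ \oo --> (1 : R).
  pose c := B * dotv x x + 1; have c1 : 1 <= c by rewrite lerDr mulr_ge0 ?dotv_ge0.
  have hc m : `|zz m x - 1| <= c * s m.
    rewrite -[leRHS]ger0_norm; last by rewrite mulr_ge0 ?(ltW (s0 m))//; lra.
    rewrite -ler_sqr ?nnegrE// !real_normK ?num_real//.
    have := zlip 0 (s m *: x); rewrite z1 subr0 dotvZl dotvZr -/(zz m x).
    move=> /le_trans; apply; rewrite exprMn.
    have -> : B * (s m * (s m * dotv x x)) = B * dotv x x * s m ^+ 2 by ring.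
    by rewrite ler_wpM2r ?sqr_ge0//; move: c1; rewrite /c; nra.
  apply: (@squeeze_cvgr _ _ _ _ (fun m => 1 - c * s m) (fun m => 1 + c * s m)).
  - by apply: nearW => m; have := hc m; rewrite ler_distl.
  - rewrite -[X in _ --> X]subr0 -(mulr0 c); apply: cvgB; first exact: cvg_cst.
    exact: cvgMr.
  - rewrite -[X in _ --> X]addr0 -(mulr0 c); apply: cvgD; first exact: cvg_cst.
    exact: cvgMr.
have zz2c (x : 'rV[R]_n) : (fun m => zz m x ^+ 2) @ \oo --> (1 : R).
  by rewrite -[X in _ --> X](expr1n _ 2); apply: (@cvgM _ _ _ _ (zz ^~ x) (zz ^~ x) 1 1).
have zz2B m x : zz m x ^+ 2 <= B ^+ 2.
  by rewrite ler_pXn2r ?nnegrE// ?z0// -[zz m x]ger0_norm ?zB ?z0.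
have mzz2 m : measurable_fun setT (fun x => zz m x ^+ 2) by exact: measurable_funX.
pose Nm m : R := m.+2%:R.
(* The cutoff lives on |x_i| <= m+1, inside the box of size m+2; the lift is delta = s^2, the
   truncation level m+1, and the Young weight will be s. *)
pose Y m := cutoff_density f (zz m) (Nm m) (s m ^+ 2).
have YE m x : Y m x = s m ^+ 2 + zz m x ^+ 2 * boxed (Nm m) f x by [].
have bx0 m (q : 'rV[R]_n -> R) x : (forall x, 0 <= q x) -> 0 <= boxed (Nm m) q x by move=> h; rewrite mulr_ge0// indicE.
have bxq m (q : 'rV[R]_n -> R) x : (forall x, 0 <= q x) -> boxed (Nm m) q x <= q x.
  by move=> h; rewrite ler_piMr// indicE lern1 leq_b1.
have s2 m : 0 < s m ^+ 2 by rewrite exprn_gt0.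
have s21 m : s m ^+ 2 <= 1 by rewrite exprn_ile1 ?(ltW (s0 m)).
have s2c : (fun m => s m ^+ 2) @ \oo --> (0 : R).
  by rewrite -[X in _ --> X](mulr0 0); apply: (@cvgM _ _ _ _ s s 0 0).
have Y0 m x : s m ^+ 2 <= Y m x by rewrite YE lerDl mulr_ge0 ?sqr_ge0// bx0.
have mY m : measurable_fun setT (Y m).
  apply: measurable_funD => //; apply: measurable_funM => //; exact: Lone_measurable.
have Yc (x : 'rV[R]_n) : (fun m => Y m x) @ \oo --> f x.
  rewrite -[f x]add0r -[f x]mul1r; apply: cvgD => //.
  by apply: cvgM => //; exact: boxed_cvg.
pose zt m (x : 'rV[R]_n) : R := Num.min (Y m x) m.+1%:R.
have mzt m : measurable_fun setT (zt m) by exact: measurable_minr.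
have ztb m x : s m ^+ 2 <= zt m x <= m.+1%:R.
  by rewrite /zt le_min Y0 ge_min lexx orbT /= (le_trans (s21 m))// ler1n.
have zt0 m x : 0 < zt m x by case/andP: (ztb m x) => + _; exact: lt_le_trans.
have mln m : measurable_fun setT (fun x => ln (zt m x)).
  exact: (measurableT_comp (@measurable_ln R) (mzt m)).
have ztc (x : 'rV[R]_n) : (fun m => zt m x) @ \oo --> f x.
  have h1 : \forall m \near \oo, zt m x = Y m x.
    have /cvgrPdist_lt /(_ 1 ltr01) hY := Yc x.
    have hN := nbhs_infty_gtr (f x + 1).
    near=> m; apply/min_idPl; have hm : f x + 1 < m%:R by near: m.
    have : `|f x - Y m x| < 1 by near: m.
    rewrite ltr_distlC => /andP[_ h]; apply/ltW; apply: lt_trans h _.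
    by apply: lt_trans hm _; rewrite ltr_nat.
  apply: cvg_trans (Yc x); apply: near_eq_cvg.
  by apply: filterS h1 => m ->.
(* Where f = 0, zt = s^2 and s^2 ln(s^2) lies between -2s and 0, which matches the convention 0 ln 0
   = 0. *)
have entc (x : 'rV[R]_n) : (fun m => zt m x * ln (zt m x)) @ \oo --> f x * ln (f x).
  have := f0 x; rewrite le_eqVlt => /predU1P[fx|fx]; last exact: entropy_cvg.
  rewrite -fx mul0r.
  have e m : zt m x = s m ^+ 2.
    by rewrite /zt YE /boxed -fx mul0r mulr0 addr0; apply/min_idPl/(le_trans (s21 m)); rewrite ler1n.
  apply: (@squeeze_cvgr _ _ _ _ (fun m => - 2 * s m) (fun=> 0)); last exact: cvg_cst.
  - apply: nearW => m; rewrite e lnXn//.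
    have := @ln_sublinear _ (s m)^-1; rewrite invr_gt0 s0 lnV ?posrE// => /(_ isT) h.
    have l0 : ln (s m) <= 0 by exact: ln_le0.
    apply/andP; split; last by rewrite mulr_ge0_le0 ?(ltW (s2 m))// mulrn_wle0.
    have : s m * (- ln (s m)) <= 1.
      by rewrite -(@mulfV _ (s m)) ?gt_eqF// ler_wpM2l ?(ltW (s0 m))// ltW.
    by have := s0 m; rewrite mulr2n; nra.
  - by rewrite -[X in _ --> X](mulr0 (-2)); apply: cvgMr.
pose I m := \int[leb]_x (zz m x ^+ 2 * p x * boxed (Nm m) fisher x).
pose A m := \int[leb]_x (Y m x * p x).
pose J m := \int[leb]_x (dotv (Dz m x) (Dz m x) * p x * boxed (Nm m) f x).
have mfp : measurable_fun setT (fun x => fisher x * p x) by exact: Lone_measurable.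
have Ic : I @ \oo --> \int[leb]_x (fisher x * p x).
  apply: (@Rintegral_dct _ _ _ _ (fun x => B ^+ 2 * (fisher x * p x))) => //.
  - exact: LoneZ.
  - move=> m; apply: measurable_funM; first exact: measurable_funM.
    exact: Lone_measurable (iI _).
  - move=> x; rewrite -[X in _ --> X](_ : 1 * p x * fisher x = _); last by rewrite mul1r mulrC.
    apply: cvgM; last exact: boxed_cvg.
    by apply: cvgMl.
  - move=> m x; rewrite ger0_norm; last by exact: mulr_ge0 (mulr_ge0 (sqr_ge0 _) (p0 x)) (bx0 m _ x fi0).
    by rewrite mulrAC mulrA ler_wpM2r// ler_pM ?sqr_ge0 ?bx0 ?bxq.
have Ac : A @ \oo --> (1 : R).
  rewrite -[X in _ --> X]fp1.
  apply: (@Rintegral_dct _ _ _ _ (fun x => p x + B ^+ 2 * (f x * p x))).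
  - by apply: LoneD => //; exact: LoneZ.
  - by move=> m; exact: measurable_funM.
  - exact: measurable_funM.
  - by move=> x; apply: cvgMl; exact: Yc.
  - move=> m x; rewrite normrM (ger0_norm (p0 x)) ger0_norm; last first.
      by apply: le_trans (Y0 m x); rewrite ltW.
    rewrite mulrA -[X in X + _]mul1r -mulrDl ler_wpM2r// YE lerD//.
    by rewrite ler_pM ?sqr_ge0 ?bx0 ?bxq.
have J1 m : J m <= s m ^+ 2 * B.
  rewrite -[leRHS]mulr1 -fp1 -RintegralZl//.
  have hD x : dotv (Dz m x) (Dz m x) <= s m ^+ 2 * B.
    by rewrite /Dz dotvZl dotvZr mulrA -expr2 ler_wpM2l ?(ltW (s2 m)).
  apply: le_Rintegral => //; last 2 first.
  - exact: (LoneZ _ ifp).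
  - move=> x _; rewrite -mulrA ler_pM ?dotv_ge0 ?mulr_ge0 ?bx0//.
    by rewrite mulrC ler_wpM2r// bxq.
  apply: (@Lone_bounded _ _ _ _ (s m ^+ 2 * B * Bp)); first exact: iF.
    apply: measurable_funM => //; rewrite /dotv; apply: measurable_sum => j.
    exact: measurable_funM.
  move=> x; rewrite normrM (ger0_norm (p0 x)) ger0_norm ?dotv_ge0//.
  by rewrite ler_pM ?dotv_ge0//; case/andP: (pB x).
(* The cutoff gradient contributes (1 + 1/s) 4 s^2 B <= 8 B s, and A m ln(A m) tends to 1 ln 1 =
   0. *)
pose U m := C0 * ((1 + s m) * I m + 8 * B * s m) + A m * ln (A m) + 1.
have izt m : Lone (fun x => zt m x * ln (zt m x) * p x).
  apply: (@Lone_bounded _ _ _ _ (m.+1%:R * (`|ln (s m ^+ 2)| + `|ln m.+1%:R|))) => //.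
    exact: measurable_funM.
  move=> x; rewrite normrM ler_pM//; last exact: ln_bounded.
  by rewrite gtr0_norm//; case/andP: (ztb m x).
have bound m : \int[leb]_x (zt m x * ln (zt m x) * p x) <= U m - 1.
  have rzN : m.+1%:R < Nm m by rewrite ltr_nat.
  have h := cutoff_lsi wg f0 G0 iF iG iI (tzz m) (fun x => z0 _) (mzz m) (mDz m) (zzs m) rzN
     ip pB p1 lsi C00 (s2 m) (s21 m) (s0 m) (ler1n _ m.+1 : 1 <= m.+1%:R).
  rewrite /U addrK -lerBlDr; apply: le_trans h _.
  rewrite ler_wpM2l// lerD2l -/(J m).
  have sV : (s m)^-1 * s m = 1 by rewrite mulVf ?gt_eqF.
  have sV0 : 0 < (s m)^-1 by rewrite invr_gt0.
  apply: (@le_trans _ _ ((1 + (s m)^-1) * 4 * (s m ^+ 2 * B))).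
    by rewrite ler_wpM2l// mulr_ge0// addr_ge0// ltW.
  have -> : (1 + (s m)^-1) * 4 * (s m ^+ 2 * B) = 4 * B * s m * (s m + (s m)^-1 * s m) by ring.
  rewrite sV; have : 0 <= 4 * B * s m by rewrite !mulr_ge0// ltW.
  by have := s1 m; nra.
have Uc : U @ \oo --> C0 * (\int[leb]_x (fisher x * p x)) + 1.
  have -> : C0 * (\int[leb]_x (fisher x * p x)) =
      C0 * ((1 + 0) * (\int[leb]_x (fisher x * p x)) + 8 * B * 0) + 1 * ln 1.
    by rewrite ln1 mulr0 !addr0 mulr0 addr0 mul1r.
  apply: cvgD; last exact: cvg_cst.
  apply: cvgD; last exact: entropy_cvg.
  apply: cvgMr; apply: cvgD; last exact: cvgMr.
  by apply: cvgM => //; apply: cvgD => //; exact: cvg_cst.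
apply: (fatou_bound (g_ := fun m x => (zt m x * ln (zt m x) + 1) * p x) (U := U)) Uc.
- move=> m; apply: measurable_funM => //; apply: measurable_funD => //.
  exact: measurable_funM.
- move=> m x; rewrite mulr_ge0//.
  by have := entropy_tangent ltr01 (zt0 m x); rewrite ln1; have := zt0 m x; lra.
- by move=> x; apply: cvgMl; apply: cvgD; [exact: entc|exact: cvg_cst].
- move=> m; have iS := LoneD (izt m) ip.
  have -> : (\int[leb]_x ((zt m x * ln (zt m x) + 1) * p x)%:E =
     (\int[leb]_x (zt m x * ln (zt m x) * p x + p x))%:E)%E.
    rewrite /Rintegral fineK; last exact: (integrable_fin_num measurableT iS).
    by apply: eq_integral => x _; rewrite mulrDl mul1r.
  rewrite lee_fin RintegralD//; last exact: izt.
  by rewrite p1 -lerBrDr; exact: bound.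
Unshelve. all: by end_near.
Qed.

End full_inequality.

(** * Probability measures with a positive density *)

Section density_probability.
Variables (R : realType) (n : nat) (p : 'rV[R]_n -> R).
Local Notation leb := (lebesgue_rV R n).
Hypothesis mp : measurable_fun setT p.
Hypothesis p0 : forall x, 0 <= p x.
Hypothesis p1 : (\int[leb]_x (p x)%:E = 1)%E.

Let density_measure (A : set 'rV[R]_n) : \bar R := (\int[leb]_(x in A) (p x)%:E)%E.

Let density0 : density_measure set0 = 0%E.
Proof. exact: integral_set0. Qed.

Let density_ge0 A : (0 <= density_measure A)%E.
Proof. by apply: integral_ge0 => x _; rewrite lee_fin. Qed.

Let density_sigma_additive : semi_sigma_additive density_measure.
Proof.
move=> /= F mF tF mUF; rewrite /density_measure; apply: cvg_toP.
  apply: ereal_nondecreasing_is_cvgn => m k mk.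
  apply: lee_sum_nneg_natr => // j _ _.
  by apply: integral_ge0 => /= x _; rewrite lee_fin.
rewrite ge0_integral_bigcup//=.
- by apply: measurable_funTS; exact/measurable_EFinP.
- by move=> x _; rewrite lee_fin.
Qed.

HB.instance Definition _ := isMeasure.Build _ _ _ density_measure
  density0 density_ge0 density_sigma_additive.

Let density_setT : density_measure setT = 1%E.
Proof. exact: p1. Qed.

HB.instance Definition _ := @Measure_isProbability.Build _ _ R
  density_measure density_setT.

Lemma density_probability_exists : exists mu : probability 'rV[R]_n R,
  forall A, measurable A -> mu A = (\int[leb]_(x in A) (p x)%:E)%E.
Proof. by exists density_measure. Qed.

End density_probability.

Section density_integral.
Variables (R : realType) (n : nat) (p : 'rV[R]_n -> R) (mu : probability 'rV[R]_n R).
Local Notation leb := (lebesgue_rV R n).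
Hypothesis ip : Lone p.
Hypothesis p0 : forall x, 0 < p x.
Hypothesis muE : forall A, measurable A -> mu A = (\int[leb]_(x in A) (p x)%:E)%E.

Lemma density_dominates : mu `<< leb.
Proof.
apply/null_content_dominatesP => A mA A0; rewrite muE//.
apply: null_set_integral => //; exact: measurable_funTS (measurable_int _ ip).
Qed.

Lemma dominates_density (A : set 'rV[R]_n) : measurable A -> mu A = 0%E -> leb A = 0%E.
Proof.
move=> mA; rewrite muE// => h.
have mpA : measurable_fun A (EFin \o p).
  by apply: measurable_funTS; exact: measurable_int ip.
have : (\int[leb]_(x in A) `|(p x)%:E| = 0)%E.
  by rewrite -[RHS]h; apply: eq_integral => x _; rewrite gee0_abs// lee_fin ltW.
move/(ae_eq_integral_abs _ mA mpA) => -[B [mB B0 AB]].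
apply/eqP; rewrite eq_le measure_ge0 andbT -B0; apply: le_measure; rewrite ?inE//.
by move=> x Ax; apply: AB => /(_ Ax) [] /eqP; rewrite gt_eqF.
Qed.

(** The density agrees almost everywhere with the Radon-Nikodym derivative, having the same
    integrals over measurable sets. *)
Lemma ge0_integral_density (h : 'rV[R]_n -> \bar R) :
  measurable_fun setT h -> (forall x, 0 <= h x)%E ->
  (\int[mu]_x h x = \int[leb]_x (h x * (p x)%:E))%E.
Proof.
move=> mh h0; have dom := density_dominates.
rewrite -(Radon_Nikodym_SigmaFinite.change_of_variables dom h0 measurableT mh).
have mRN := measurable_int _ (Radon_Nikodym_SigmaFinite.f_integrable dom).
apply: ae_eq_integral => //.
- exact: emeasurable_funM.
- by apply: emeasurable_funM => //; exact: measurable_int ip.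
have : ae_eq leb setT (Radon_Nikodym_SigmaFinite.f mu leb) (EFin \o p).
  apply: integral_ae_eq => //.
  - exact: Radon_Nikodym_SigmaFinite.f_integrable.
  - exact: measurable_int ip.
  - by move=> A _ mA; rewrite -Radon_Nikodym_SigmaFinite.f_integral//; exact: muE.
by apply: filterS => x h1 _; rewrite (h1 I).
Qed.

Lemma ae_density (P : 'rV[R]_n -> Prop) :
  {ae mu, forall x, P x} <-> {ae leb, forall x, P x}.
Proof.
split=> -[A [mA A0 PA]]; exists A; split => //; first exact: dominates_density.
by rewrite muE//; apply: null_set_integral => //; exact: measurable_funTS (measurable_int _ ip).
Qed.

End density_integral.

Lemma weak_gradient_ae (R : realType) n (f f' : 'rV[R]_n -> R) (G G' : 'rV[R]_n -> 'rV[R]_n) :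
  measurable_fun setT f -> measurable_fun setT f' ->
  (forall i, measurable_fun setT (fun x => G x ord0 i)) ->
  (forall i, measurable_fun setT (fun x => G' x ord0 i)) ->
  {ae lebesgue_rV R n, forall x, f x = f' x} ->
  (forall i, {ae lebesgue_rV R n, forall x, G x ord0 i = G' x ord0 i}) ->
  weak_gradient f G -> weak_gradient f' G'.
Proof.
move=> mf mf' mG mG' ef eG wg phi tphi i.
have [cphi _] := tphi.
have mphi : measurable_fun setT phi by exact: (continuous_measurable_rV (cphi 0%N)).
have mpphi : measurable_fun setT (partial i phi).
  by have [_ /(_ i) h] := cphi 1%N; exact: continuous_measurable_rV.
have := wg phi tphi i.
rewrite (ae_eq_integral (fun x => (f' x * partial i phi x)%:E)) //; last 3 first.
- by apply/measurable_EFinP; exact: measurable_funM.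
- by apply/measurable_EFinP; exact: measurable_funM.
- by apply: filterS ef => x -> _.
move=> ->; congr (- _)%E; apply: ae_eq_integral => //.
- by apply/measurable_EFinP; exact: measurable_funM.
- by apply/measurable_EFinP; exact: measurable_funM.
- by apply: filterS (eG i) => x -> _.
Qed.

(** On the box |f| <= f^2 + 1, and the box has finite measure. *)
Lemma Lfun2_boxed (R : realType) n (f : 'rV[R]_n -> R) N :
  f \in Lfun (lebesgue_rV R n) 2%:E -> measurable_fun setT f -> Lone (boxed N f).
Proof.
move=> fL mf; have i2 := Lfun2_integrable_sqr fL.
have iB : Lone (\1_(rV_box (0 : 'rV[R]_n) N) : 'rV[R]_n -> R).
  by apply: Lone_indic; [exact: measurable_rV_box|exact: rV_box_finite].
apply: (Lone_le (LoneD i2 iB)).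
  by apply: measurable_funM => //; apply: measurable_indic; exact: measurable_rV_box.
move=> x; rewrite /boxed normrM [leRHS]ger0_norm ?addr_ge0 ?sqr_ge0//.
rewrite indicE; case: (x \in _); rewrite /= ?normr1 ?normr0 ?mulr0 ?addr0 ?sqr_ge0// mulr1.
by rewrite -real_normK ?num_real//; have := sqr_ge0 (`|f x| - 1); nra.
Qed.

(** * From regular functions to all densities with a weak gradient *)

Section log_sobolev_of_smooth.
Variables (R : realType) (n : nat) (p : 'rV[R]_n -> R) (mu : probability 'rV[R]_n R).
Local Notation leb := (lebesgue_rV R n).
Variables (C0 Bp beta alpha : R).
Hypothesis ip : Lone p.
Hypothesis p0 : forall x, 0 < p x.
Hypothesis pB : forall x, p x <= Bp.
Hypothesis plow : forall N, exists2 c, 0 < c & forall x, rV_box 0 N x -> c <= p x.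
Hypothesis muE : forall A, measurable A -> mu A = (\int[leb]_(x in A) (p x)%:E)%E.
Hypothesis lsi : smooth_lsi p C0.
Hypothesis C00 : 0 < C0.
Hypothesis beta0 : 0 < beta.
Hypothesis alphaE : (2 * alpha)^-1 * beta^-1 = C0.

Let p1E : (\int[leb]_x (p x)%:E = 1)%E.
Proof. by rewrite -muE// probability_setT. Qed.

Let p1 : \int[leb]_x p x = 1. Proof. by rewrite /Rintegral p1E. Qed.

Let pB' x : 0 <= p x <= Bp. Proof. by rewrite pB ltW. Qed.

Section nonnegative_representative.
Variables (f : 'rV[R]_n -> R) (G : 'rV[R]_n -> 'rV[R]_n).
Hypothesis mf : measurable_fun setT f.
Hypothesis f0 : forall x, 0 <= f x.
Hypothesis mG : forall j, measurable_fun setT (fun x => G x ord0 j).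
Hypothesis G0 : forall x, f x = 0 -> G x = 0.
Hypothesis wg : weak_gradient f G.
Hypothesis iF : forall N, Lone (boxed N f).
Hypothesis iG : forall N j, Lone (boxed N (fun x => G x ord0 j)).
Hypothesis f1 : (\int[mu]_x (f x)%:E = 1)%E.

Let fisher x : R := dotv (G x) (G x) / f x.

(** An infinite Fisher information makes the bound trivial since C0 > 0; otherwise the integrability
    that [entropy_lsi] requires is available. The added 1 is subtracted at the end, as mu has mass
    1. *)
Lemma log_sobolev_nonneg :
  (\int[mu]_x (f x * ln (f x))%:E <= C0%:E * \int[mu]_x (fisher x)%:E)%E.
Proof.
have mp : measurable_fun setT p by exact: Lone_measurable.
have fi0 x : 0 <= fisher x by rewrite divr_ge0 ?dotv_ge0.
have mfi : measurable_fun setT fisher.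
  apply: measurable_funM; last exact: measurable_funV.
  by rewrite /dotv; apply: measurable_sum => j; exact: measurable_funM.
have ge0_density (h : 'rV[R]_n -> R) : measurable_fun setT h -> (forall x, 0 <= h x) ->
    (\int[mu]_x (h x)%:E = \int[leb]_x (h x * p x)%:E)%E.
  move=> mh h0; rewrite (ge0_integral_density ip muE)//; exact/measurable_EFinP.
have Lone_density (h : 'rV[R]_n -> R) : measurable_fun setT h -> (forall x, 0 <= h x) ->
    (\int[mu]_x (h x)%:E < +oo)%E -> Lone (fun x => h x * p x).
  move=> mh h0 hoo; apply/integrableP; split; first by apply/measurable_EFinP; exact: measurable_funM.
  rewrite (ge0_density h mh h0) in hoo; apply: le_lt_trans hoo.
  rewrite le_eqVlt; apply/orP; left; apply/eqP; apply: eq_integral => x _.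
  by rewrite /= ger0_norm// mulr_ge0// ltW.
have [fioo|fioo] := leP +oo%E (\int[mu]_x (fisher x)%:E)%E.
  by move: fioo; rewrite leye_eq => /eqP ->; rewrite gt0_muley ?leey// lte_fin.
have iIp := Lone_density _ mfi fi0 fioo.
have ifp : Lone (fun x => f x * p x) by apply: Lone_density => //; rewrite f1 ltry.
have fp1 : \int[leb]_x (f x * p x) = 1.
  by rewrite /Rintegral -ge0_density// f1.
(* The density is bounded below on each box, so integrability against mu gives local integrability
   against Lebesgue measure. *)
have iI N : Lone (boxed N fisher).
  have [c c0 hc] := plow N.
  apply: (Lone_le (LoneZ c^-1 iIp)).
    by apply: measurable_funM => //; apply: measurable_indic; exact: measurable_rV_box.
  move=> x; have pf : 0 <= c^-1 * (fisher x * p x) by rewrite mulr_ge0 ?invr_ge0 ?(ltW c0)// mulr_ge0// ltW.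
  rewrite [leRHS]ger0_norm//.
  have [/hc cp|hx] := pselect (rV_box 0 N x); last by rewrite boxed_out// normr0.
  rewrite ger0_norm; last by rewrite mulr_ge0// indicE.
  apply: (@le_trans _ _ (fisher x)); first by rewrite ler_piMr// indicE lern1 leq_b1.
  by rewrite mulrC -mulrA ler_peMr// ler_pdivlMr// mul1r.
have main := entropy_lsi wg f0 G0 iF iG iI mf ip pB' p1 lsi (ltW C00) ifp fp1 iIp.
have mfl : measurable_fun setT (fun x => f x * ln (f x)).
  by apply: measurable_funM => //; exact: (measurableT_comp (@measurable_ln R)).
have fl0 x : 0 <= f x * ln (f x) + 1.
  have := f0 x; rewrite le_eqVlt => /predU1P[<-|fx]; first by rewrite mul0r add0r.
  by have := entropy_tangent ltr01 fx; rewrite ln1; lra.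
have mfl1 : measurable_fun setT (fun x => f x * ln (f x) + 1) by exact: measurable_funD.
rewrite -(ge0_density _ mfl1 fl0) in main.
have ifl1 : mu.-integrable setT (EFin \o (fun x => f x * ln (f x) + 1)).
  apply/integrableP; split; first exact/measurable_EFinP.
  under eq_integral do rewrite gee0_abs ?lee_fin//.
  by apply: le_lt_trans main _; rewrite ltry.
have i1 : mu.-integrable setT (EFin \o cst 1).
  exact: finite_measure_integrable_cst.
have -> : (\int[mu]_x (f x * ln (f x))%:E =
   \int[mu]_x (f x * ln (f x) + 1)%:E - 1)%E.
  have := integralB measurableT ifl1 i1.
  rewrite [X in (_ = _ - X)%E -> _](_ : _ = 1%E); last first.
    by rewrite [LHS](integral_cst mu measurableT 1)//= mul1e probability_setT.
  by move=> <-; apply: eq_integral => x _; rewrite /= -EFinB addrK.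
rewrite leeBlDr//; apply: le_trans main _.
rewrite (ge0_density _ mfi fi0) EFinD leeD2r// EFinM lee_wpmul2l ?lee_fin ?(ltW C00)//.
by rewrite /Rintegral fineK//; exact: (integrable_fin_num measurableT iIp).
Qed.

End nonnegative_representative.

(** A Radon-Nikodym derivative is nonnegative only almost everywhere, so f and G are replaced by
    representatives with f' >= 0 and G' = 0 on {f' = 0}. Because p > 0, mu and Lebesgue measure have
    the same null sets, so both sides and the weak gradient are unaffected. *)
Lemma log_sobolev_of_smooth : log_sobolev beta mu alpha.
Proof.
move=> nu f G dom hf [fL GL wg].
have mfun_of (h : 'rV[R]_n -> R) : h \in Lfun leb 2%:E -> measurable_fun setT h.
  by rewrite inE => /andP[]; rewrite inE.
have mf := mfun_of _ fL; have mG i := mfun_of _ (GL i).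
pose f' x : R := Num.max (f x) 0.
have f'0 x : 0 <= f' x by rewrite le_max lexx orbT.
have mf' : measurable_fun setT f' by exact: measurable_maxr.
have RN := ae_eq_Radon_Nikodym_SigmaFinite dom measurableT.
have ff'_mu : {ae mu, forall x, f x = f' x}.
  apply: filterS2 RN hf => x h1 h2.
  rewrite /f' max_l// -lee_fin -[(f x)%:E]/((EFin \o f) x) h2// -h1//.
  exact: Radon_Nikodym_SigmaFinite.f_ge0.
have ff' : {ae leb, forall x, f x = f' x}.
  by apply/(ae_density ip p0 muE).
have fE1 : (\int[mu]_x (f' x)%:E = 1)%E.
  rewrite -(@probability_setT _ _ _ nu).
  rewrite (Radon_Nikodym_SigmaFinite.f_integral dom measurableT).
  apply: ae_eq_integral => //; first exact/measurable_EFinP.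
    exact: measurable_int (Radon_Nikodym_SigmaFinite.f_integrable dom).
  apply: filterS3 ff'_mu RN hf => x h1 h2 h3 _.
  by rewrite h2// -h3//= h1.
have wg1 : weak_gradient f' G by apply: weak_gradient_ae wg => // i; exact: nearW.
have iF N : Lone (boxed N f').
  apply: (Lone_le (Lfun2_boxed N fL mf)).
    by apply: measurable_funM => //; apply: measurable_indic; exact: measurable_rV_box.
  move=> x; rewrite /boxed !normrM ler_wpM2r//.
  by rewrite /f' maxEle; case: ifP => _; rewrite ?normr0.
have iG N j : Lone (boxed N (fun x => G x ord0 j)) by exact: Lfun2_boxed.
(* By [weak_gradient_zero] this changes G on a null set only. *)
pose G' x : 'rV[R]_n := if f' x == 0 then 0 else G x.
have G'E x j : G' x ord0 j = (if f' x == 0 then 0 else G x ord0 j).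
  by rewrite /G'; case: ifP => // _; rewrite mxE.
have mE : measurable [set x | f' x = 0].
  by have := mf' measurableT _ (measurable_set1 (0 : R)); rewrite setTI.
have mG' j : measurable_fun setT (fun x => G' x ord0 j).
  rewrite (_ : (fun x => _) = (fun x => \1_(~` [set x | f' x = 0]) x * G x ord0 j)).
    by apply: measurable_funM => //; apply: measurable_indic; exact: measurableC.
  apply/funext => x; rewrite G'E indicE; case: eqVneq => h.
    by rewrite memNset ?mul0r//= => /(_ h).
  by rewrite mem_set ?mul1r//; exact/eqP.
have GG' j : {ae leb, forall x, G x ord0 j = G' x ord0 j}.
  have := weak_gradient_zero wg1 f'0 iF (iG ^~ j); apply: filterS => x h.
  by rewrite G'E; case: eqP => // /h.
have wg' : weak_gradient f' G' by apply: weak_gradient_ae wg1 => //; exact: nearW.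
have G'0 x : f' x = 0 -> G' x = 0 by rewrite /G' => ->; rewrite eqxx.
have iG' N j : Lone (boxed N (fun x => G' x ord0 j)).
  apply: (Lone_le (iG N j)).
    by apply: measurable_funM => //; apply: measurable_indic; exact: measurable_rV_box.
  move=> x; rewrite /boxed !normrM ler_wpM2r// G'E.
  by case: ifP => _; rewrite ?normr0.
have main := log_sobolev_nonneg mf' f'0 mG' G'0 wg' iF iG' fE1.
have fi0 x : 0 <= dotv (G' x) (G' x) / f' x by rewrite divr_ge0 ?dotv_ge0.
have mfi : measurable_fun setT (fun x => dotv (G' x) (G' x) / f' x).
  apply: measurable_funM; last exact: measurable_funV.
  by rewrite /dotv; apply: measurable_sum => j; exact: measurable_funM.
have mln (h : 'rV[R]_n -> R) : measurable_fun setT h -> measurable_fun setT (fun x => h x * ln (h x)).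
  by move=> mh; apply: measurable_funM => //; exact: (measurableT_comp (@measurable_ln R)).
have -> : (\int[mu]_x (f x * ln (f x))%:E = \int[mu]_x (f' x * ln (f' x))%:E)%E.
  apply: ae_eq_integral => //; [apply/measurable_EFinP; exact: (mln _ mf)|apply/measurable_EFinP; exact: (mln _ mf')|].
  by apply: filterS ff'_mu => x -> _.
have -> : (\int[mu]_x (carre_du_champ beta G G x / f x)%:E =
    \int[mu]_x (beta^-1%:E * (dotv (G' x) (G' x) / f' x)%:E))%E.
  apply: ae_eq_integral => //.
  - apply/measurable_EFinP; apply: measurable_funM; last exact: measurable_funV.
    rewrite /carre_du_champ; apply: measurable_funM => //.
    by rewrite /dotv; apply: measurable_sum => j; exact: measurable_funM.
  - by apply/measurable_EFinP; exact: measurable_funM.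
  apply: filterS ff'_mu => x -> _; rewrite -EFinM; congr EFin.
  rewrite /carre_du_champ /G' mulrA; case: ifP => // /eqP ->.
  by rewrite invr0 !mulr0.
rewrite ge0_integralZl//; last 3 first.
- exact/measurable_EFinP.
- by move=> x _; rewrite lee_fin.
- by rewrite lee_fin invr_ge0 ltW.
by rewrite muleA -EFinM alphaE.
Qed.

End log_sobolev_of_smooth.

(** * Gibbs measures whose potential is close to a strongly convex one *)

Section gibbs_bounded_perturbation.
Variables (R : realType) (n : nat) (W u : 'rV[R]_n -> R) (beta osc : R) (v : 'rV[R]_n).
Local Notation leb := (lebesgue_rV R n).
Hypothesis beta0 : 0 < beta.
Hypothesis cW : continuous W.
Hypothesis cvxW : forall t s x y, 0 < t -> 0 < s -> t + s = 1 ->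
  W (t *: x + s *: y) <= t * W x + s * W y - 1 / 2 * (t * s) * dotv (x - y) (x - y).
Hypothesis Wlow : forall x, W 0 + dotv v x + 1 / 2 * dotv x x <= W x.
Hypothesis mu_ : measurable_fun setT u.
Hypothesis uW : forall x, W x - osc <= u x <= W x.

Let V x := beta * W x.
Let C := expR (- (beta * (W 0 - dotv v v))).

Let VC x : expR (- V x) <= C * expR (- (beta / 4 * dotv x x)).
Proof.
rewrite /C -expRD ler_expR -opprD lerN2 /V.
(* Young's inequality with weight 1/2 gives - v.x <= |x|^2/4 + |v|^2, so half of the quadratic
   growth of W survives. *)
have half0 : 0 < 2^-1 :> R by rewrite invr_gt0.
have := dotv_young x (- v) half0; rewrite dotvNr dotvNl dotvNr opprK dotvC.
have -> : (2 * 2^-1)^-1 = 1 :> R by rewrite mulfV ?invr1.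
move=> h; have -> : beta * (W 0 - dotv v v) + beta / 4 * dotv x x =
  beta * (W 0 - dotv v v + dotv x x / 4) by field.
by rewrite ler_wpM2l ?(ltW beta0)//; have := Wlow x; lra.
Qed.

Let mV : measurable_fun setT V.
Proof. by apply: measurable_funM => //; exact: continuous_measurable_rV. Qed.

Let cvxV t s x y : 0 < t -> 0 < s -> t + s = 1 ->
  V (t *: x + s *: y) <= t * V x + s * V y - beta / 2 * (t * s) * dotv (x - y) (x - y).
Proof.
move=> t0 s0 ts; apply: le_trans (ler_wpM2l (ltW beta0) (cvxW x y t0 s0 ts)) _.
by rewrite le_eqVlt /V; apply/orP; left; apply/eqP; field.
Qed.

Let q x := expR (- (beta * u x)).
Let Z := partition_function beta u.
Let p x := q x / Z.

Let mq : measurable_fun setT q.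
Proof.
by apply: measurableT_comp => //; apply: measurableT_comp => //; exact: measurable_funM.
Qed.

Let qV x : expR (- V x) <= q x <= expR (beta * osc) * expR (- V x).
Proof.
have /andP[h1 h2] := uW x.
rewrite -expRD !ler_expR lerN2 /V ler_wpM2l ?(ltW beta0)//=.
by rewrite lerNl opprD opprK addrC -mulrBr ler_wpM2l ?(ltW beta0).
Qed.

Let iq : Lone q.
Proof.
have ig := LoneZ (expR (beta * osc) * C) (gaussian_integrable n (divr_gt0 beta0 (ltr0n _ 4))).
apply: (Lone_le ig) => // x; rewrite !ger0_norm ?expR_ge0//; last first.
  by rewrite !mulr_ge0 ?expR_ge0.
have /andP[_ h] := qV x; apply: le_trans h _.
by rewrite -mulrA ler_wpM2l ?expR_ge0.
Qed.

Let Z0 : 0 < Z.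
Proof. by apply: positive_integral_gt0 => // x; exact: expR_gt0. Qed.

Let p0 x : 0 < p x. Proof. by rewrite divr_gt0// expR_gt0. Qed.

Let mp : measurable_fun setT p. Proof. exact: measurable_funM. Qed.

Let pab x : Z^-1 * expR (- V x) <= p x <= expR (beta * osc) / Z * expR (- V x).
Proof.
have /andP[h1 h2] := qV x; rewrite /p [q x / Z]mulrC [_ / Z]mulrC -mulrA.
by rewrite !ler_pM2l ?invr_gt0// h1.
Qed.

Let ip : Lone p.
Proof. by have := LoneZ Z^-1 iq; under eq_fun do rewrite mulrC. Qed.

Let p1 : \int[leb]_x p x = 1.
Proof. by rewrite RintegralZr// -/Z mulfV// gt_eqF. Qed.

(** The density p lies between a = 1/Z and b = exp(beta osc)/Z times exp(- beta W), so the unknown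
    partition function Z cancels in b/a. *)
Let lsi : smooth_lsi p (expR (beta * osc) * (2 * beta)^-1).
Proof.
move=> h H delta M B K delta0 K0 mh mH hM HB hd.
have Zi : 0 < Z^-1 by rewrite invr_gt0.
have := holley_stroock beta0 (divr_gt0 beta0 (ltr0n _ 4)) mV VC cvxV Zi mp pab p1
  delta0 K0 mh mH hM HB hd.
by rewrite invrK mulfVK// gt_eqF.
Qed.

Let plow N : exists2 c, 0 < c & forall x, rV_box 0 N x -> c <= p x.
Proof.
have [x0 _ hx0] : exists2 c, c \in closed_box `|N| & forall t, t \in closed_box `|N| -> W t <= W c.
  apply: compact_EVT_max.
  - by exists 0 => i; rewrite mxE normr0.
  - exact: compact_closed_box.
  - exact: continuous_subspaceT.
exists (Z^-1 * expR (- V x0)); first by rewrite mulr_gt0 ?invr_gt0 ?expR_gt0.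
move=> x hx; have /andP[h _] := pab x; apply: le_trans h.
rewrite ler_pM2l ?invr_gt0// ler_expR lerN2 ler_wpM2l ?(ltW beta0)//.
by apply: hx0; rewrite inE => i; have := hx i; rewrite mxE sub0r normrN => /ltW /le_trans; apply; exact: ler_norm.
Qed.

(** The constant solves 1/(2 alpha beta) = exp(beta osc)/(2 beta): the 1/beta from Gamma cancels
    that of the strong convexity. *)
Lemma gibbs_log_sobolev : exists pi : probability 'rV[R]_n R,
  gibbs_measure beta u pi /\ log_sobolev beta pi (expR (- (osc * beta))).
Proof.
have p1E : (\int[leb]_x (p x)%:E = 1)%E.
  by rewrite -p1 /Rintegral fineK//; exact: (integrable_fin_num measurableT ip).
have [pi piE] := density_probability_exists mp (fun x => ltW (p0 x)) p1E.
exists pi; split; first by move=> A mA; rewrite piE.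
have pB x : p x <= expR (beta * osc) / Z * C.
  have /andP[_ h] := pab x; apply: le_trans h _.
  rewrite ler_wpM2l ?divr_ge0 ?expR_ge0 ?(ltW Z0)//; apply: le_trans (VC x) _.
  rewrite ler_piMr ?expR_ge0// -expR0 ler_expR oppr_le0.
  by rewrite mulr_ge0 ?dotv_ge0// divr_ge0// ltW.
apply: (log_sobolev_of_smooth ip p0 pB plow piE lsi).
- by rewrite mulr_gt0 ?expR_gt0// invr_gt0 mulr_gt0.
- exact: beta0.
- by rewrite expRN [osc * beta]mulrC; field; rewrite !gt_eqF ?expR_gt0.
Qed.

End gibbs_bounded_perturbation.

Theorem corollary5p4 (R : realType) (L l r eta : R)
    (L_gt0 : 0 < L) (l_gt0 : 0 < l / 2) (r_gt : l / 2 < r) (eta_gt0 : 0 < eta) :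
  exists c C : R, [/\ 0 < c, 0 < C &
    forall (d : nat) (g : 'rV[R]_d -> R) (beta : R),
      (0 < d)%N ->
      Ck 2 g ->
      (forall x y : 'rV[R]_d,
         enorm (grad g x - grad g y) <=
           L * (1 + enorm x `^ l + enorm y `^ l) * enorm (x - y)) ->
      0 < beta ->
      let u := fun x : 'rV[R]_d => eta * enorm x `^ (2 * r + 2) + g x in
      exists pi_beta : probability 'rV[R]_d R,
        gibbs_measure beta u pi_beta /\
        log_sobolev beta pi_beta (c * expR (- (C * beta)))].
Proof.
have r0 : 0 < r by exact: lt_trans r_gt.
have er0 : 0 < eta * (r + 1) by rewrite mulr_gt0// addr_gt0.
have [K K0 hK] := radial_threshold L_gt0 l_gt0 r_gt eta_gt0.
(* K times the junction point of [radial], the bound of [radial_bounds]; it is fixed before the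
   dimension, g and beta are introduced. *)
pose osc := K * (K / (eta * (r + 1))) `^ r^-1.
have osc0 : 0 < osc by rewrite mulr_gt0// powR_gt0// divr_gt0.
exists 1, osc; split => // d g beta _ [dg _] gL beta0 u; rewrite mul1r.
pose F := radial K r eta; pose G := radial_slope K r eta.
have dF (q : R) : is_derive q 1 F (G q) by exact: is_derive_radial.
have Gnd : {homo G : x y / x <= y} by move=> x y; exact: radial_slope_nd.
have Gge (q : R) : 0 <= q -> L * (1 / 2 + q `^ (l / 2)) + 1 / 2 <= G q.
  by move=> q0; apply: le_trans (hK q q0) _; exact: radial_slope_ge.
have cF : continuous F.
  by move=> q; apply/differentiable_continuous/derivable1_diffP; case: (dF q).
have cg : continuous g by move=> x; exact: differentiable_continuous.
have cdot : continuous (fun x : 'rV[R]_d => dotv x x).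
  move=> x; rewrite /dotv; elim: (index_enum _) => [|i s IH].
    by rewrite (_ : (fun x => _) = cst 0) => [|]; [exact: cst_continuous|apply/funext => y; rewrite big_nil].
  rewrite (_ : (fun x => _) = (fun x : 'rV[R]_d => x ord0 i * x ord0 i +
    \sum_(j <- s) x ord0 j * x ord0 j)); last by apply/funext => y; rewrite big_cons.
  apply: (@continuousD _ _ _ (fun x : 'rV[R]_d => x ord0 i * x ord0 i)); last exact: IH.
  by apply: (@continuousM _ _ (fun x : 'rV[R]_d => x ord0 i) (fun x => x ord0 i)); exact: coord_continuous.
apply: (@gibbs_log_sobolev _ _ (fun x => F (dotv x x) + g x) u beta osc (grad g 0)) => //.
- move=> x; apply: (@continuousD _ _ _ (fun x => F (dotv x x)) g); last exact: cg.
  by apply: (@continuous_comp _ _ _ (fun x : 'rV[R]_d => dotv x x) F); [exact: cdot|exact: cF].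
- exact: strong_convexity dg gL dF Gnd Gge.
- exact: quadratic_lower_bound dg gL dF Gnd Gge.
- rewrite /u; under eq_fun do rewrite enorm_powR.
  apply: measurable_funD; last exact: continuous_measurable_rV.
  apply: measurable_funM => //; apply: (measurableT_comp (@measurable_powR R _)).
  exact: measurable_dotv.
(* In terms of q = |x|^2 the confining term is eta q^(r+1), so [radial_bounds] bounds W - u between
   0 and osc. *)
- move=> x; rewrite /u enorm_powR.
  have -> : (2 * r + 2) / 2 = r + 1 by field.
  have /andP[h1 h2] := radial_bounds K0 r0 eta_gt0 (dotv_ge0 x).
  by apply/andP; split; rewrite /F /osc; lra.
Qed.
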